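(* Let $X=N+A$ be a continuous and nonnegative semimartingale which vanishes on $H$. Then the following assertions are equivalent: (1) $X$ is a process of class $\Sigma(H)$ (with decomposition $X=N+A$); (2) there exists a unique continuous and positive $(\mathbb{Q},\mathbb{P})$-local martingale $M$ such that $M_0=1$ and $X_t=\frac{M_t}{I_t}-1$ for all $t\ge0$, where $I_t=\inf_{s\le t}M_s$. Precisely, the $(\mathbb{Q},\mathbb{P})$-local martingale $M$ is given by $M_t=(1+X_t)\exp(-A_t)$.
   Context: Setting: $\mathbb{Q}$ is a bounded signed measure on $(\Omega,\mathcal{F}_\infty)$ and $\mathbb{P}$ a probability measure on $\mathcal{F}_\infty$ with $\mathbb{Q}\ll\mathbb{P}$; $(\mathcal{F}_t)_{t\ge0}$ is a right-continuous filtration, completed with respect to $\mathbb{P}$, with $\mathcal{F}_\infty=\bigvee_t\mathcal{F}_t$. $D_t=\frac{d\mathbb{Q}|_{\mathcal{F}_t}}{d\mathbb{P}|_{\mathcal{F}_t}}$ is a uniformly integrable $\mathbb{P}$-martingale, assumed continuous. $H=\{t: D_t=0\}$; a process $X$ vanishes on $H$ if $X_t=0$ for all $t\in H$. A $(\mathbb{Q},\mathbb{P})$-local martingale is an $(\mathcal{F}_t)$-adapted $\mathbb{P}$-semimartingale $Y$ such that $YD$ is a $\mathbb{P}$-local martingale. Class $\Sigma(H)$: a non-negative $\mathbb{P}$-semimartingale $X$ is of class $\Sigma(H)$ if it decomposes as $X=N+A$ where (1) $N$ is a càdlàg $(\mathbb{Q},\mathbb{P})$-local martingale with $N_0=0$;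 (2) $A$ is a continuous nondecreasing process with $A_0=0$; (3) the measure $dA_t$ is carried by the set $\{t: X_t=0\}\cup H$.
   Formalization: Uniqueness of M as stated fails (Q=0, X=0: M=1 and M=exp(-t) both work); it is proved only on time intervals where D has no zero. For the given decomposition X=N+A, the formula M=(1+X)exp(-A) is made part of (2); the equivalence without it is for some decomposition. *)

(* Defs.v *)
From HB Require Import structures.
From mathcomp Require Import all_boot all_order all_algebra.
From mathcomp Require Import all_classical all_reals all_analysis.

Set Implicit Arguments.
Unset Strict Implicit.
Unset Printing Implicit Defensive.

Import Order.TTheory GRing.Theory Num.Theory.
Import numFieldNormedType.Exports.

Local Open Scope classical_set_scope.
Local Open Scope ring_scope.

(* The time set is [0, +oo): a process is a function on R * T of which only
   the values at times t >= 0 are ever used, and likewise for filtrations.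
   Path properties are required P-almost surely, as usual under a completed
   filtration; in particular processes are identified up to
   indistinguishability. *)
Definition process (R : realType) (T : Type) := R -> T -> R.

Section paths.
Context {R : realType}.
Implicit Types x : R -> R.

Definition continuous_path x := {within `[0, +oo[, continuous x}.

Definition cadlag_path x :=
  (forall t, 0 <= t -> x s @[s --> t^'+] --> x t) /\
  (forall t, 0 < t -> cvg (x s @[s --> t^'-])).

Definition nondecreasing_path x :=
  forall s t, 0 <= s -> s <= t -> x s <= x t.

(* da is the Lebesgue-Stieltjes measure of the path a, extended by a 0 on
   (-oo, 0]; it is carried by Z when the complement of Z in [0, +oo) is
   da-negligible. *)
Definition dcarried_by (a : R -> R) (Z : set R) :=
  exists f : cumulative R R, (forall t, f t = a (Num.max t 0)) /\
    (lebesgue_stieltjes_measure f).-negligible (`[0, +oo[ `\` Z).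

End paths.

Section stochastic.
Context {R : realType} {d : measure_display} {T : measurableType d}.
Implicit Types (F : R -> set_system T) (P : probability T R).
Implicit Types (X Y M V N A D : process R T).

Definition usual_filtration P F :=
  [/\ forall t, 0 <= t -> sigma_algebra setT (F t) /\ F t `<=` measurable,
      forall s t, 0 <= s -> s <= t -> F s `<=` F t,
      forall t, 0 <= t -> \bigcap_(s in [set s | t < s]) F s `<=` F t,
      P.-negligible `<=` F 0 &
      @measurable d T = <<s \bigcup_(t in [set t | 0 <= t]) F t >>].

Definition measurable_wrt (G : set_system T) (g : T -> R) :=
  forall B : set R, measurable B -> G (g @^-1` B).

Definition adapted F X := forall t, 0 <= t -> measurable_wrt (F t) (X t).

Definition indistinguishable P X Y :=
  {ae P, forall w, forall t, 0 <= t -> X t w = Y t w}.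

(* g is a version of the conditional expectation of f given G. *)
Definition is_cond_exp P (G : set_system T) (f g : T -> R) :=
  [/\ measurable_wrt G g, P.-integrable setT (EFin \o g) &
      forall E, G E -> (\int[P]_(w in E) (g w)%:E = \int[P]_(w in E) (f w)%:E)%E].

Definition martingale P F M :=
  [/\ adapted F M,
      forall t, 0 <= t -> P.-integrable setT (EFin \o M t) &
      forall s t, 0 <= s -> s <= t -> is_cond_exp P (F s) (M t) (M s)].

Definition stopping_time F (tau : T -> \bar R) :=
  (forall w, (0 <= tau w)%E) /\
  (forall t, 0 <= t -> F t [set w | (tau w <= t%:E)%E]).

Definition stopped X (tau : T -> \bar R) : process R T :=
  fun t w => X (fine (Order.min t%:E (tau w))) w.

(* Convention: M_0 is F_0-measurable but need not be integrable, and it is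
   M - M_0 that is localized. Requiring the stopped processes to be uniformly
   integrable as well gives the same notion (replace tau_n by min(tau_n, n)). *)
Definition local_martingale P F M :=
  [/\ adapted F M,
      {ae P, forall w, cadlag_path (M ^~ w)} &
      exists tau : nat -> T -> \bar R,
        [/\ forall n, stopping_time F (tau n),
            {ae P, forall w, forall n, (tau n w <= tau n.+1 w)%E},
            {ae P, forall w, tau n w @[n --> \oo] --> +oo%E} &
            forall n, martingale P F
              (fun t w => stopped M (tau n) t w - M 0 w)]].

Definition finite_variation_process P F V :=
  [/\ adapted F V,
      {ae P, forall w, cadlag_path (V ^~ w)} &
      {ae P, forall w, forall t, 0 <= t -> bounded_variation 0 t (V ^~ w)}].

Definition semimartingale P F X :=
  adapted F X /\
  exists M V, [/\ local_martingale P F M, finite_variation_process P F V &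
                  indistinguishable P X (fun t w => M t w + V t w)].

(* D t is a version of the Radon-Nikodym derivative, on F t, of the restriction
   of Q with respect to the restriction of P. *)
Definition density_process P (Q : {charge set T -> \bar R}) F D :=
  forall t, 0 <= t ->
    [/\ measurable_wrt (F t) (D t), P.-integrable setT (EFin \o D t) &
        forall E, F t E -> Q E = (\int[P]_(w in E) (D t w)%:E)%E].

(* The notion depends on Q only through its density process D. *)
Definition QP_local_martingale P F D Y :=
  semimartingale P F Y /\ local_martingale P F (fun t w => Y t w * D t w).

(* The random set H. *)
Definition zeros D (w : T) : set R := [set t | 0 <= t /\ D t w = 0].

Definition vanishes_on_zeros P D X :=
  {ae P, forall w, forall t, zeros D w t -> X t w = 0}.

Definition class_Sigma_with P F D X N A :=
  [/\ semimartingale P F X /\ {ae P, forall w, forall t, 0 <= t -> 0 <= X t w},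
      indistinguishable P X (fun t w => N t w + A t w),
      [/\ {ae P, forall w, cadlag_path (N ^~ w)}, QP_local_martingale P F D N &
          {ae P, forall w, N 0 w = 0}],
      [/\ adapted F A, {ae P, forall w, continuous_path (A ^~ w)},
          {ae P, forall w, nondecreasing_path (A ^~ w)} &
          {ae P, forall w, A 0 w = 0}] &
      {ae P, forall w, dcarried_by (A ^~ w) (zeros X w `|` zeros D w)}].

Definition class_Sigma P F D X := exists N A, class_Sigma_with P F D X N A.

Definition running_inf M : process R T :=
  fun t w => inf [set M s w | s in `[0, t]].

Definition represents P F D X M :=
  [/\ QP_local_martingale P F D M,
      {ae P, forall w, continuous_path (M ^~ w)},
      {ae P, forall w, forall t, 0 <= t -> 0 < M t w},
      {ae P, forall w, M 0 w = 1} &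
      {ae P, forall w, forall t, 0 <= t ->
         X t w = M t w / running_inf M t w - 1}].

(* Equality away from the zeros of D, the only times at which being a
   (Q, P)-local martingale constrains a process: M and M' have the same
   multiplicative increments over every time interval on which D does not
   vanish. When D has no zero and M_0 = M'_0, this is indistinguishability. *)
Definition eq_off_zeros P D M' M :=
  {ae P, forall w, forall s t, 0 <= s -> s <= t ->
     (forall u, s <= u <= t -> D u w != 0) ->
     M' t w / M' s w = M t w / M s w}.

(* Indistinguishability would be too much to ask: for Q = 0, hence D = 0 and
   X = 0, every positive continuous adapted nonincreasing M with M_0 = 1
   represents X. *)
Definition unique_represents P F D X M :=
  represents P F D X M /\
  forall M', represents P F D X M' -> eq_off_zeros P D M' M.

End stochastic.

(* Main.v *)
Require Import Defs.
From HB Require Import structures.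
From mathcomp Require Import all_boot all_order all_algebra.
From mathcomp Require Import all_classical all_reals all_analysis.
From mathcomp Require Import measurable_realfun.
From mathcomp Require Import ring lra.

Import Order.TTheory GRing.Theory Num.Theory.
Import numFieldNormedType.Exports.

Local Open Scope classical_set_scope.
Local Open Scope ring_scope.

Set Implicit Arguments.
Unset Strict Implicit.
Unset Printing Implicit Defensive.

(** Put M = (1 + X) exp(-A), that is, X = M exp(A) - 1.  The theorem says that
    X = N + A is of class Sigma(H) exactly when exp(-A) is the running infimum I
    of M.

    From Sigma(H) to M.  Since X vanishes on H, the measure dA is carried by
    {X = 0}; so A is constant on every interval on which X has no zero.  If g is
    the last zero of X before t, then A_g = A_t, hence
    M_g = exp(-A_t) <= M_s for all s <= t, and inf_(s <= t) M_s = exp(-A_t)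
    ([reflection_inf]).  Integration by parts gives
      d(M D) = exp(-A) d(N D) + (1 + A) exp(-A) dD - exp(-A) X D dA,
    and the last term vanishes: M D is a local martingale.

    From M to Sigma(H).  Put A = -log I = log(1 + X) - log M and N = X - A.  The
    infimum I decreases only when M = I, that is, when X = 0 ([running_inf_flat]),
    so dA is carried by {X = 0}, and
      d(N D) = exp(A) d(M D) - (1 + A) dD + exp(A) M D dA - D dA
    where the dA terms add up to X D dA = 0.

    Uniqueness.  If M and M' represent X, with compensators A and A', then
    (A - A') D is a local martingale, hence so is the integral of D against
    d(A - A').  This one is continuous and of finite variation, so it is zero
    ([fv_local_martingale0]), and A - A' is constant wherever D has no zero
    ([path_integral_inj]).

    All the stochastic calculus needed reduces to one formula: for a local
    martingale Y and a continuous nondecreasing adapted B with B_0 = 0, the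
    process Y B - int Y dB is a local martingale ([integration_by_parts]).  The
    integral int Y dB is the limit of the sums
      sum_k Y(t_(k+1)) (B(t_(k+1)) - B(t_k))
    with the integrand taken at the right end of each interval.  For a martingale
    Y and a bounded B, Abel summation turns Y B minus such a sum into
    sum_k B(t_k) (Y(t_(k+1)) - Y(t_k)), a martingale; and the sums are uniformly
    integrable, by a conditional Jensen inequality for (|y| - K)^+
    ([excess_weight]), so the martingale property passes to the limit
    ([integral_martingale]).  Taking for B the indicator of {tau <= t} the same
    statement is the optional stopping theorem ([optional_stopping]), which gives
    the stability of local martingales under sums and reduces
    [integration_by_parts] to bounded B by localization.  The sums converge, path
    by path, by dominated convergence for the Lebesgue-Stieltjes measure
    ([stieltjes_cvg]). *)

(** * Expectations of real random variables *)

Section expectation.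
Context {R : realType} {d : measure_display} {T : measurableType d}.
Variable P : probability T R.
Implicit Types (f g h : T -> R) (G : set_system T).

Definition expect f : R := \int[P]_x f x.
Definition intble f := P.-integrable setT (EFin \o f).

Lemma intble_meas f : intble f -> measurable_fun setT f.
Proof. by move=> /measurable_int /measurable_EFinP. Qed.

(** The domination is only almost sure because path properties of processes are. *)
Lemma intble_le f g : measurable_fun setT f -> intble g ->
  {ae P, forall w, `|f w| <= `|g w|} -> intble f.
Proof.
move=> mf ig fg; have mg := intble_meas ig.
apply/integrableP; split; first exact/measurable_EFinP.
move/integrableP: ig => [_]; apply: le_lt_trans.
apply: ae_ge0_le_integral => //.
- by apply/measurable_EFinP; exact: measurableT_comp.
- by apply/measurable_EFinP; exact: measurableT_comp.
- by apply: filterS fg => w; rewrite /= lee_fin.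
Qed.

Lemma intble_ae f g : intble f -> measurable_fun setT g ->
  {ae P, forall w, f w = g w} -> intble g.
Proof.
by move=> i_f mg fg; apply: (intble_le mg i_f); apply: filterS fg => w ->.
Qed.

Lemma expect_ae f g : measurable_fun setT f -> measurable_fun setT g ->
  {ae P, forall w, f w = g w} -> expect f = expect g.
Proof.
move=> mf mg fg; congr fine; apply: ae_eq_integral => //.
- exact/measurable_EFinP.
- exact/measurable_EFinP.
- by apply: filterS fg => w -> .
Qed.

Lemma intble_cst (c : R) : intble (cst c).
Proof. exact: finite_measure_integrable_cst. Qed.

Lemma intbleD f g : intble f -> intble g -> intble (fun w => f w + g w).
Proof. by move=> i1 i2; have h := integrableD measurableT i1 i2; exact: h. Qed.

Lemma intbleN f : intble f -> intble (fun w => - f w).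
Proof. by move=> i1; have h := integrableN i1; exact: h. Qed.

Lemma intbleB f g : intble f -> intble g -> intble (fun w => f w - g w).
Proof. by move=> *; apply: intbleD => //; apply: intbleN. Qed.

Lemma intbleM (C : R) h f : measurable_fun setT h -> (forall w, `|h w| <= C) ->
  intble f -> intble (fun w => h w * f w).
Proof.
move=> mh hC i_f; have mf := intble_meas i_f.
have i2 : intble (fun w => C * f w) by have i3 := @integrableZl _ _ _ P _ measurableT C _ i_f; exact: i3.
apply: (intble_le _ i2); first exact: measurable_funM.
apply: aeW => w; rewrite !normrM ler_wpM2r//.
by apply: le_trans (hC w) (ler_norm _).
Qed.

Lemma intbleZ (c : R) f : intble f -> intble (fun w => c * f w).
Proof. by move=> i; apply: (@intbleM `|c| (cst c)). Qed.

Lemma intble_bdd (C : R) f : measurable_fun setT f -> (forall w, `|f w| <= C) -> intble f.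
Proof.
move=> mf fC; apply: (intble_le mf (intble_cst C)).
by apply: aeW => w; apply: le_trans (fC w) (ler_norm _).
Qed.

Lemma intble_sum n (f : nat -> T -> R) : (forall k, (k < n)%N -> intble (f k)) ->
  intble (fun w => \sum_(k < n) f k w).
Proof.
elim: n => [|n IH] h.
  by under eq_fun do rewrite big_ord0; exact: intble_cst.
under eq_fun do rewrite big_ord_recr /=.
by apply: intbleD; [apply: IH => k kn; apply: h; rewrite ltnS ltnW|exact: h].
Qed.

Lemma intble_norm f : intble f -> intble (fun w => `|f w|).
Proof. by move=> i; have h := @integrable_norm _ _ _ _ _ _ i; exact: h. Qed.

Lemma expectD f g : intble f -> intble g ->
  expect (fun w => f w + g w) = expect f + expect g.
Proof. by move=> i1 i2; rewrite /expect RintegralD. Qed.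

Lemma expectZ (c : R) f : intble f -> expect (fun w => c * f w) = c * expect f.
Proof. by move=> i1; rewrite /expect RintegralZl. Qed.

Lemma expectB f g : intble f -> intble g ->
  expect (fun w => f w - g w) = expect f - expect g.
Proof. by move=> i1 i2; rewrite /expect RintegralB. Qed.

Lemma expect_cst (c : R) : expect (cst c) = c.
Proof.
rewrite /expect Rintegral_cst//. 
transitivity (c * fine (1%:E : \bar R)); last by rewrite mulr1.
by congr (_ * fine _); exact: probability_setT.
Qed.

Lemma expect_sum n (f : nat -> T -> R) : (forall k, (k < n)%N -> intble (f k)) ->
  expect (fun w => \sum_(k < n) f k w) = \sum_(k < n) expect (f k).
Proof.
elim: n => [|n IH] h.
  by under eq_fun do rewrite big_ord0; rewrite big_ord0; exact: (expect_cst 0).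
under eq_fun do rewrite big_ord_recr /=.
rewrite big_ord_recr /= expectD ?IH// => [k kn| |]; last exact: h.
- by apply: h; rewrite ltnS ltnW.
- by apply: intble_sum => k kn; apply: h; rewrite ltnS ltnW.
Qed.

Lemma expect_le f g : intble f -> intble g -> (forall w, f w <= g w) ->
  expect f <= expect g.
Proof. by move=> i1 i2 h; apply: le_Rintegral. Qed.

Lemma expect_ge0 f : (forall w, 0 <= f w) -> 0 <= expect f.
Proof. by move=> h; apply: Rintegral_ge0. Qed.

Lemma expect_norm f : intble f -> `|expect f| <= expect (fun w => `|f w|).
Proof. by move=> h; apply: le_normr_Rintegral. Qed.

Lemma expect_dct (f : nat -> T -> R) f0 g :
  (forall n, measurable_fun setT (f n)) -> measurable_fun setT f0 -> intble g ->
  {ae P, forall w, f n w @[n --> \oo] --> f0 w} ->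
  (forall n w, `|f n w| <= g w) ->
  intble f0 /\ expect (f n) @[n --> \oo] --> expect f0.
Proof.
move=> mf mf0 ig cf bf.
have [] := @dominated_convergence _ _ _ P _ measurableT
  (fun n => EFin \o f n) (EFin \o f0) (EFin \o g).
- by move=> n; exact/measurable_EFinP.
- exact/measurable_EFinP.
- by apply: filterS cf => w cw _; apply/fine_cvgP; split => //; exact: nearW.
- exact: ig.
- by apply: aeW => w n _; rewrite /= lee_fin.
move=> i0 _ c; split => //.
apply: fine_cvg; rewrite fineK//.
exact: (integrable_fin_num measurableT).
Qed.

Lemma expect0_ae f : intble f -> (forall w, 0 <= f w) -> expect f = 0 ->
  {ae P, forall w, f w = 0}.
Proof.
move=> i_f f0 e0; have mf := intble_meas i_f.
have : (\int[P]_x `|(EFin \o f) x| = 0)%E.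
  transitivity (\int[P]_x (EFin \o f) x)%E.
    by apply: eq_integral => x _ /=; rewrite ger0_norm.
  by rewrite -[LHS]fineK ?(integrable_fin_num measurableT i_f)//; congr EFin.
move/(ae_eq_integral_abs P measurableT (proj2 (measurable_EFinP setT f) mf)).
by apply: filterS => w /(_ I) [].
Qed.

End expectation.

(** * Adapted processes and martingales over a complete filtration *)

Section filtration.
Context {R : realType} {d : measure_display} {T : measurableType d}.
Variables (P : probability T R) (F : R -> set_system T).
Hypothesis hF : usual_filtration P F.
Implicit Types (f g h xi : T -> R) (G : set_system T) (t s : R).
Implicit Types (X Y M N : process R T).

Lemma measurable_wrtP G g : sigma_algebra setT G ->
  measurable_wrt G g <-> measurable_fun setT (g : g_sigma_algebraType G -> R).
Proof.
move=> sG; split=> [h _ B mB|h B mB].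
  by rewrite setTI; apply: sub_sigma_algebra; exact: h.
have := h measurableT B mB; rewrite setTI => hh.
by rewrite -(sigma_algebra_id sG).
Qed.

Lemma filtration_sigma_algebra t : 0 <= t -> sigma_algebra setT (F t).
Proof. by case: hF => + _ _ _ _ t0 => /(_ _ t0)[]. Qed.

Lemma filtration_measurable t : 0 <= t -> F t `<=` measurable.
Proof. by case: hF => + _ _ _ _ t0 => /(_ _ t0)[]. Qed.

Lemma filtration_mono s t : 0 <= s -> s <= t -> F s `<=` F t.
Proof. by case: hF => _ + _ _ _; apply. Qed.

Lemma filtration_negligible t A : 0 <= t -> P.-negligible A -> F t A.
Proof. by move=> t0 nA; apply: (filtration_mono (lexx 0) t0); case: hF => _ _ _ + _; apply. Qed.

Lemma filtrationC t A : 0 <= t -> F t A -> F t (~` A).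
Proof. by move=> /filtration_sigma_algebra[_ h _] /h; rewrite setTD. Qed.

Lemma filtration0 t : 0 <= t -> F t set0.
Proof. by move=> /filtration_sigma_algebra[]. Qed.

Lemma filtrationT t : 0 <= t -> F t setT.
Proof. by move=> t0; rewrite -setC0; apply: filtrationC => //; exact: filtration0. Qed.

Lemma filtration_bigcup t (A : nat -> set T) : 0 <= t -> (forall n, F t (A n)) ->
  F t (\bigcup_n A n).
Proof. by move=> /filtration_sigma_algebra[_ _ h]; exact: h. Qed.

Lemma filtrationU t A B : 0 <= t -> F t A -> F t B -> F t (A `|` B).
Proof.
move=> t0 FA FB; rewrite -bigcup2E; apply: filtration_bigcup => // -[|[|n]] //=.
exact: filtration0.
Qed.

Lemma filtrationI t A B : 0 <= t -> F t A -> F t B -> F t (A `&` B).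
Proof.
move=> t0 FA FB; rewrite -[_ `&` _]setCK setCI.
by apply: filtrationC => //; apply: filtrationU => //; exact: filtrationC.
Qed.

Lemma measurable_wrt_fun t g : 0 <= t -> measurable_wrt (F t) g -> measurable_fun setT g.
Proof. by move=> t0 h _ B mB; rewrite setTI; apply: (filtration_measurable t0); exact: h. Qed.

Lemma measurable_wrt_mono s t g : 0 <= s -> s <= t -> measurable_wrt (F s) g ->
  measurable_wrt (F t) g.
Proof. by move=> s0 st h B mB; apply: (filtration_mono s0 st); exact: h. Qed.

(** Completeness: the set where f and g differ is in every sigma-algebra of the
    filtration.  Every almost sure modification of a process is therefore
    adapted. *)
Lemma measurable_wrt_ae t f g : 0 <= t -> measurable_wrt (F t) f ->
  {ae P, forall w, f w = g w} -> measurable_wrt (F t) g.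
Proof.
move=> t0 mf fg B mB.
have -> : g @^-1` B = (f @^-1` B `&` ~` [set w | f w <> g w]) `|`
   (g @^-1` B `&` [set w | f w <> g w]).
  apply/seteqP; split=> w /=.
    move=> gB; have [e|ne] := pselect (f w = g w); last by right.
    by left; split; [rewrite /= e|move=> /(_ e)].
  by move=> [[fB /contrapT e]|[]//]; rewrite -e.
have nE : P.-negligible [set w | f w <> g w] by exact: fg.
apply: filtrationU => //; last by apply: filtration_negligible => //; apply: negligibleS nE => w [].
by apply: filtrationI => //; [exact: mf|apply: filtrationC => //; exact: filtration_negligible].
Qed.

Section closure.
Variable t : R.
Hypothesis t0 : 0 <= t.
Local Notation mw := (measurable_wrt (F t)).
Let E g := measurable_wrtP g (filtration_sigma_algebra t0).

Lemma measurable_wrt_cst (c : R) : mw (cst c).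
Proof. by apply/E => _ B mB; have := @measurable_cst _ _ (g_sigma_algebraType (F t)) R setT c measurableT B mB. Qed.

Lemma measurable_wrtD f g : mw f -> mw g -> mw (fun w => f w + g w).
Proof. by move=> /E mf /E mg; apply/E; exact: measurable_funD. Qed.

Lemma measurable_wrtN f : mw f -> mw (fun w => - f w).
Proof. by move=> /E mf; apply/E; exact: measurable_funN. Qed.

Lemma measurable_wrtB f g : mw f -> mw g -> mw (fun w => f w - g w).
Proof. by move=> mf mg; apply: measurable_wrtD => //; exact: measurable_wrtN. Qed.

Lemma measurable_wrtM f g : mw f -> mw g -> mw (fun w => f w * g w).
Proof. by move=> /E mf /E mg; apply/E; exact: measurable_funM. Qed.

Lemma measurable_wrt_comp (h : R -> R) f : measurable_fun setT h -> mw f -> mw (fun w => h (f w)).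
Proof. by move=> mh /E mf; apply/E; exact: measurableT_comp. Qed.

Lemma measurable_wrt_sum n (f : nat -> T -> R) : (forall k, (k < n)%N -> mw (f k)) ->
  mw (fun w => \sum_(k < n) f k w).
Proof.
elim: n => [|n IH] h.
  by under eq_fun do rewrite big_ord0; exact: measurable_wrt_cst.
under eq_fun do rewrite big_ord_recr /=.
by apply: measurable_wrtD; [apply: IH => k kn; apply: h; rewrite ltnS ltnW|exact: h].
Qed.

Lemma measurable_wrt_indic A : F t A -> mw (\1_A : T -> R).
Proof.
move=> FA; apply/E; apply: measurable_indic.
exact: sub_sigma_algebra.
Qed.

(** Adaptedness of a process defined path by path, such as a pathwise integral,
    is obtained by exhibiting it as an almost sure limit of adapted ones. *)
Lemma measurable_wrt_cvg (f : nat -> T -> R) g : (forall n, mw (f n)) ->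
  {ae P, forall w, f n w @[n --> \oo] --> g w} -> mw g.
Proof.
move=> mf cf; (* off the complement of N the limit is replaced by 0, to have it everywhere *)
pose N := [set w | ~ (f n w @[n --> \oo] --> g w)].
have nN : P.-negligible N by exact: cf.
have FN : F t (~` N) by apply: filtrationC => //; exact: filtration_negligible.
pose f' n w := \1_(~` N) w * f n w; pose g' w := (\1_(~` N) w * g w : R).
have mg' : mw g'.
  apply/E; apply: (@measurable_fun_cvg _ (g_sigma_algebraType (F t)) R setT f').
    by move=> n; apply/E; apply: measurable_wrtM => //; exact: measurable_wrt_indic.
  move=> w _; rewrite /f' /g' indicE; case: (asboolP (N w)) => wN.
    rewrite memNset; last by move=> h; exact: h wN.
    by under eq_fun do rewrite mul0r; rewrite mul0r; exact: cvg_cst.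
  rewrite mem_set// mul1r; under eq_fun do rewrite mul1r.
  exact: contrapT.
apply: (measurable_wrt_ae t0 mg'); apply: filterS cf => w cw.
by rewrite /g' indicE mem_set ?mul1r//; exact/not_notP.
Qed.

End closure.

Lemma adapted_indist X Y : adapted F X -> indistinguishable P X Y -> adapted F Y.
Proof.
move=> aX XY t t0; apply: (measurable_wrt_ae t0 (aX t t0)).
by apply: filterS XY => w; apply.
Qed.

Lemma norm_indic (A : set T) w : `|\1_A w : R| <= 1.
Proof. by rewrite indicE; case: (_ \in _); rewrite ?normr0 ?normr1. Qed.

Lemma set_integral_expect A f : measurable A -> intble P f ->
  (\int[P]_(w in A) (f w)%:E)%E = (expect P (fun w => \1_A w * f w))%:E.
Proof.
move=> mA i_f; rewrite /expect /Rintegral fineK.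
  rewrite [LHS]integral_mkcond; apply: eq_integral => w _.
  by rewrite patchE indicE; case: ifP => _; rewrite ?mul1r ?mul0r.
apply: (integrable_fin_num measurableT).
exact: (intbleM (measurable_indic mA) (norm_indic A) i_f).
Qed.

Lemma martingaleP M : martingale P F M <->
  [/\ adapted F M, forall t, 0 <= t -> intble P (M t) &
    forall s t A, 0 <= s -> s <= t -> F s A ->
      expect P (fun w => \1_A w * M t w) = expect P (fun w => \1_A w * M s w)].
Proof.
split=> [[aM iM ce]|[aM iM ce]]; split => //.
- move=> s t A s0 st FA; have [_ _ /(_ A FA)] := ce s t s0 st.
  have mA := filtration_measurable s0 FA.
  rewrite !set_integral_expect//; last exact: iM.
    by move=> [].
  by apply: iM; exact: le_trans st.
- move=> s t s0 st; split; [exact: aM|exact: iM|].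
  move=> A FA; have mA := filtration_measurable s0 FA.
  have it := iM t (le_trans s0 st); have is_ := iM s s0.
  rewrite !set_integral_expect//; congr EFin; exact/esym/ce.
Qed.

Lemma martingale_ae M M' : martingale P F M ->
  (forall t, 0 <= t -> {ae P, forall w, M t w = M' t w}) -> martingale P F M'.
Proof.
move=> /martingaleP[aM iM ce] MM'; apply/martingaleP.
have aM' : adapted F M' by move=> t t0; apply: (measurable_wrt_ae t0 (aM t t0)); exact: MM'.
have mM t : 0 <= t -> measurable_fun setT (M t).
  by move=> t0; exact: (measurable_wrt_fun t0 (aM t t0)).
have mM' t : 0 <= t -> measurable_fun setT (M' t).
  by move=> t0; exact: (measurable_wrt_fun t0 (aM' t t0)).
have ee t A : 0 <= t -> measurable A -> expect P (fun w => \1_A w * M' t w) =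
    expect P (fun w => \1_A w * M t w).
  move=> t0 mA; apply: expect_ae.
  - by apply: measurable_funM; [exact: measurable_indic|exact: mM'].
  - by apply: measurable_funM; [exact: measurable_indic|exact: mM].
  - by apply: filterS (MM' t t0) => w ->.
split => //.
- by move=> t t0; apply: (intble_ae (iM t t0)); [exact: mM'|exact: MM'].
- move=> s t A s0 st FA; have mA := filtration_measurable s0 FA.
  by rewrite !ee//; [exact: ce|exact: le_trans st].
Qed.

Lemma martingaleD M N : martingale P F M -> martingale P F N ->
  martingale P F (fun t w => M t w + N t w).
Proof.
move=> /martingaleP[aM iM cM] /martingaleP[aN iN cN]; apply/martingaleP; split.
- by move=> t t0; apply: measurable_wrtD => //; [exact: aM|exact: aN].
- by move=> t t0; apply: intbleD; [exact: iM|exact: iN].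
- move=> s t A s0 st FA; have mA : measurable_fun setT (\1_A : T -> R) by exact: measurable_indic (filtration_measurable s0 FA).
  have t0 := le_trans s0 st.
  under eq_fun do rewrite mulrDr; under [in RHS]eq_fun do rewrite mulrDr.
  have iA f : intble P f -> intble P (fun w => \1_A w * f w).
    by move=> i_f; apply: (intbleM mA (norm_indic A)).
  rewrite expectD; [|exact/iA/iM|exact/iA/iN].
  rewrite expectD; [|exact/iA/iM|exact/iA/iN].
  by rewrite (cM s t)// (cN s t).
Qed.

Lemma martingaleZ (c : R) M : martingale P F M ->
  martingale P F (fun t w => c * M t w).
Proof.
move=> /martingaleP[aM iM cM]; apply/martingaleP; split.
- by move=> t t0; apply: measurable_wrtM => //; [exact: measurable_wrt_cst|exact: aM].
- by move=> t t0; apply: intbleZ; exact: iM.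
- move=> s t A s0 st FA; have mA : measurable_fun setT (\1_A : T -> R) by exact: measurable_indic (filtration_measurable s0 FA).
  have t0 := le_trans s0 st.
  under eq_fun do rewrite mulrCA; under [in RHS]eq_fun do rewrite mulrCA.
  have iA f : intble P f -> intble P (fun w => \1_A w * f w).
    by move=> i_f; apply: (intbleM mA (norm_indic A)).
  rewrite expectZ; last exact/iA/iM.
  rewrite expectZ; last exact/iA/iM.
  by rewrite (cM s t).
Qed.

Lemma martingaleB M N : martingale P F M -> martingale P F N ->
  martingale P F (fun t w => M t w - N t w).
Proof.
move=> mM mN; have := martingaleD mM (martingaleZ (-1) mN).
by under eq_fun2 do rewrite mulN1r.
Qed.

Lemma martingale_sum n (M : nat -> process R T) :
  (forall k, (k < n)%N -> martingale P F (M k)) ->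
  martingale P F (fun t w => \sum_(k < n) M k t w).
Proof.
elim: n => [|n IH] h.
  under eq_fun2 do rewrite big_ord0; apply/martingaleP; split => //.
    by move=> t t0; exact: measurable_wrt_cst.
  by move=> t t0; exact: intble_cst.
under eq_fun2 do rewrite big_ord_recr /=.
by apply: martingaleD; [apply: IH => k kn; apply: h; rewrite ltnS ltnW|exact: h].
Qed.

(** A number is within h of the sum of its layers of height h.  Applied to a
    bounded random variable this approximates it uniformly by linear combinations
    of indicators of level sets, to which the martingale property applies. *)
Lemma layer_sum n (h x : R) : 0 < h -> 0 <= x -> x <= n%:R * h ->
  0 <= x - \sum_(k < n) h * (k.+1%:R * h <= x)%R%:R <= h.
Proof.
move=> h0; elim: n x => [|n IH] x x0.
  by rewrite mul0r big_ord0 => xl; rewrite subr0 x0 (le_trans xl)// ltW.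
move=> xn; rewrite big_ord_recl /=; have [hx|xh] := leP h x.
  rewrite mul1r hx mulr1.
  rewrite (eq_bigr (fun k : 'I_n => h * (k.+1%:R * h <= x - h)%R%:R)); last first.
    by move=> k _; rewrite lerBrDr -[X in _ + X]mul1r -mulrDl natr1.
  rewrite opprD addrA; apply: IH; first by rewrite subr_ge0.
  by rewrite lerBlDr -[X in _ + X]mul1r -mulrDl natr1.
rewrite big1 => [|k _].
  by rewrite mul1r (leNgt h x) xh/= mulr0 addr0 subr0 x0 ltW.
rewrite leNgt (lt_le_trans xh) ?mulr0//.
by rewrite -[X in X <= _]mul1r ler_wpM2r ?(ltW h0)// ler1n.
Qed.

End filtration.

(** * Uniform integrability *)

Section fatou_ui.
Context {R : realType} {d : measure_display} {T : measurableType d}.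
Variable P : probability T R.
Implicit Types (f g h : T -> R).

(** Uniform integrability of a family f_n is expressed by: for every e there is K
    such that E[excess K f_n] <= e for all n. *)
Definition excess (K x : R) : R := Num.max (`|x| - K) 0.

Lemma excess_ge0 K x : 0 <= excess K x.
Proof. by rewrite /excess le_max lexx orbT. Qed.

Lemma measurable_excess K : measurable_fun setT (excess K).
Proof.
apply: measurable_maxr => //; apply: measurable_funB => //.
Qed.

Lemma excess_le K x : 0 <= K -> excess K x <= `|x|.
Proof. by move=> K0; rewrite /excess ge_max normr_ge0 andbT lerBlDr lerDl. Qed.

Lemma intble_excess K f : 0 <= K -> intble P f -> intble P (fun w => excess K (f w)).
Proof.
move=> K0 i_f; have mf := intble_meas i_f.
apply: (intble_le _ i_f).
  exact: (measurableT_comp (measurable_excess K) mf).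
by apply: aeW => w; rewrite ger0_norm ?excess_ge0// excess_le.
Qed.

Lemma fatou_expect (f : nat -> T -> R) g c :
  (forall n, intble P (f n)) -> (forall n w, 0 <= f n w) ->
  measurable_fun setT g -> {ae P, forall w, f n w @[n --> \oo] --> g w} ->
  (forall n, expect P (f n) <= c) -> intble P g /\ expect P g <= c.
Proof.
move=> i_f f0 mg cf fc.
have mf n := intble_meas (i_f n).
have g0 : {ae P, forall w, 0 <= g w}.
  apply: filterS cf => w cw; apply: (cvgr_to_ge cw).
  exact: nearW.
have efn n : (\int[P]_x (EFin \o f n) x = (expect P (f n))%:E)%E.
  by rewrite /expect /Rintegral fineK//; exact: (integrable_fin_num measurableT (i_f n)).
have eg : (\int[P]_x `|(EFin \o g) x| = \int[P]_x limn_einf (fun n => (EFin \o f n) x))%E.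
  apply: ae_eq_integral => //.
  - by apply: measurableT_comp => //; exact/measurable_EFinP.
  - rewrite /limn_einf; apply: measurableT_comp => //.
    apply: measurable_fun_limn_esup => n; apply: measurableT_comp => //.
    exact/measurable_EFinP.
  - apply: filterS2 cf g0 => w cw gw _ /=.
    rewrite ger0_norm//; suff /cvg_limn_einf_sup[-> _] : (EFin \o f n) w @[n --> \oo] --> (g w)%:E by [].
    by apply/fine_cvgP; split => //; exact: nearW.
have lec : (\int[P]_x `|(EFin \o g) x| <= c%:E)%E.
  rewrite eg; apply: le_trans.
    apply: fatou => //.
    - by move=> n; exact/measurable_EFinP.
    - by move=> n x _; rewrite /= lee_fin.
  rewrite limn_einf_lim; apply: lime_le; first exact: is_cvg_einfs.
  apply: nearW => n; apply: ereal_inf_le; exists (expect P (f n))%:E; last by rewrite lee_fin.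
  by exists n => //=; rewrite efn.
have ig : intble P g.
  apply/integrableP; split; first exact/measurable_EFinP.
  by apply: le_lt_trans lec _; rewrite ltry.
split => //.
have := expect_norm ig; move/(le_trans (ler_norm _)) => /le_trans; apply.
rewrite -lee_fin; apply: le_trans lec.
rewrite /expect /Rintegral fineK//.
exact: (integrable_fin_num measurableT (intble_norm ig)).
Qed.

Definition clip (K x : R) : R := Num.max (- K) (Num.min x K).

Lemma clip_norm K x : 0 <= K -> `|clip K x| <= K.
Proof.
move=> K0; rewrite ler_norml /clip le_max lexx/= ge_max ge_min lexx orbT andbT.
lra.
Qed.

Lemma clip_dist K x : 0 <= K -> `|x - clip K x| = excess K x.
Proof.
move=> K0; rewrite /clip /excess.
have [h1|h1] := leP x K; have [h2|h2] := leP (- K) x.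
- by rewrite subrr normr0 max_r// subr_le0 ler_norml h2 h1.
- rewrite !ler0_norm; try lra.
  by rewrite max_l; lra.
- rewrite max_r; last lra.
  rewrite !ger0_norm; try lra.
  by rewrite max_l; lra.
- lra.
Qed.

Lemma continuous_clip K : continuous (clip K).
Proof.
have cmin (f g : R -> R) : continuous f -> continuous g ->
    continuous (fun x => Num.min (f x) (g x)).
  move=> cf cg x; under eq_fun do rewrite minr_absE.
  apply: cvgM; last exact: cvg_cst.
  apply: cvgB; first by apply: cvgD; [exact: cf|exact: cg].
  by apply: cvg_norm; apply: cvgB; [exact: cf|exact: cg].
have cmax (f g : R -> R) : continuous f -> continuous g ->
    continuous (fun x => Num.max (f x) (g x)).
  move=> cf cg x; under eq_fun do rewrite maxr_absE.
  apply: cvgM; last exact: cvg_cst.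
  apply: cvgD; first by apply: cvgD; [exact: cf|exact: cg].
  by apply: cvg_norm; apply: cvgB; [exact: cf|exact: cg].
by apply: cmax; [exact: cst_continuous|apply: cmin; [by move=> ?; exact: cvg_id|exact: cst_continuous]].
Qed.

Lemma measurable_clip K : measurable_fun setT (clip K).
Proof. by apply: measurable_maxr => //; apply: measurable_minr. Qed.

Lemma cvg_clip K (u : nat -> R) l : u n @[n --> \oo] --> l ->
  clip K (u n) @[n --> \oo] --> clip K l.
Proof. by move=> ul; exact: (cvg_comp _ _ ul (@continuous_clip K l)). Qed.

(** Clipping at K changes the expectation of f_n, and by Fatou that of the limit
    g, by at most e, while the clipped variables converge boundedly.  The weight h
    is there because martingale properties are tested against indicators. *)
Lemma uniformly_integrable_cvg (f : nat -> T -> R) g h :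
  (forall n, intble P (f n)) -> measurable_fun setT g ->
  {ae P, forall w, f n w @[n --> \oo] --> g w} ->
  (forall e, 0 < e -> exists2 K, 0 <= K &
     forall n, expect P (fun w => excess K (f n w)) <= e) ->
  measurable_fun setT h -> (forall w, `|h w| <= 1) ->
  intble P g /\ expect P (fun w => h w * f n w) @[n --> \oo]
                 --> expect P (fun w => h w * g w).
Proof.
move=> i_f mg cf ui mh h1.
have exg e : 0 < e -> exists K, [/\ 0 <= K, forall n, expect P (fun w => excess K (f n w)) <= e,
    intble P (fun w => excess K (g w)) & expect P (fun w => excess K (g w)) <= e].
  move=> e0; have [K K0 le_e] := ui e e0; exists K.
  have [] // := @fatou_expect (fun n w => excess K (f n w)) (fun w => excess K (g w)) e.
  - by move=> n; exact: intble_excess.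
  - by move=> n w; exact: excess_ge0.
  - exact: (measurableT_comp (measurable_excess K) mg).
  - apply: filterS cf => w cw.
    rewrite -clip_dist//; under eq_fun do rewrite -clip_dist//.
    apply: cvg_norm; apply: cvgB => //.
    exact: cvg_clip.
have ig : intble P g.
  have [K [K0 _ iK _]] := exg 1 ltr01.
  apply: (intble_le mg (intbleD iK (intble_cst P K))).
  apply: aeW => w; rewrite [leRHS]ger0_norm ?addr_ge0 ?excess_ge0//=.
  by rewrite -lerBlDr /excess le_max lexx.
split => //.
have iM k : intble P k -> intble P (fun w => h w * k w).
  by move=> ik; exact: (intbleM mh h1 ik).
have close K k : 0 <= K -> intble P k ->
    `|expect P (fun w => h w * k w) - expect P (fun w => h w * clip K (k w))|
      <= expect P (fun w => excess K (k w)).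
  move=> K0 ik; have mk := intble_meas ik.
  have ic : intble P (fun w => clip K (k w)).
    apply: (@intble_bdd _ _ _ P K); last by move=> w; exact: clip_norm.
    exact: (measurableT_comp (measurable_clip K) mk).
  rewrite -expectB; [|exact: iM|exact: iM].
  have ib : intble P (fun w => h w * k w - h w * clip K (k w)).
    by apply: intbleB; exact: iM.
  apply: le_trans (expect_norm ib) _; apply: expect_le.
  - exact: intble_norm.
  - exact: intble_excess.
  - move=> w; rewrite -mulrBr normrM clip_dist// ler_piMl// excess_ge0//.
apply/cvgrPdist_le => e e0.
have e3 : 0 < e / 3 by lra.
have [K [K0 fK iK gK]] := exg _ e3.
have [|||||_ /cvgrPdist_le/(_ _ e3)] := @expect_dct _ _ _ P
    (fun n w => h w * clip K (f n w)) (fun w => h w * clip K (g w)) (cst K).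
- by move=> n; exact: (measurable_funM mh (measurableT_comp (measurable_clip K) (intble_meas (i_f n)))).
- exact: (measurable_funM mh (measurableT_comp (measurable_clip K) mg)).
- exact: intble_cst.
- by apply: filterS cf => w cw; apply: cvgM; [exact: cvg_cst|exact: cvg_clip].
- move=> n w; rewrite normrM; apply: le_trans (clip_norm (f n w) K0).
  by rewrite ler_piMl.
apply: filterS => n hn.
have hf := close K (f n) K0 (i_f n); have hg := close K g K0 ig.
have := fK n.
move: hf hg hn gK.
rewrite !ler_norml => /andP[? ?] /andP[? ?] /andP[? ?] ? ?.
by apply/andP; split; lra.
Qed.
End fatou_ui.

(** * Riemann-Stieltjes sums *)

Section sums.
Context {R : realType}.
Implicit Types (z b : R -> R) (t : R).

(** The n-th grid has mesh 1/(n+1) and covers [0, n+1]; its points are capped at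
    t, so that stopping a path at time r only replaces t by min(t, r)
    ([right_sum_stop]). *)
Definition gridpt n t k : R := Num.min (k%:R / n.+1%:R) t.

(** The integrand is taken at the right end of each interval: with this choice
    the sum converges for right-continuous integrands and is compatible with the
    martingale property in the form of [excess_weight]. *)
Definition right_sum n z b t : R :=
  \sum_(k < n.+1 * n.+1)
    z (gridpt n t k.+1) * (b (gridpt n t k.+1) - b (gridpt n t k)).

Definition left_sum n z b t : R :=
  \sum_(k < n.+1 * n.+1)
    b (gridpt n t k) * (z (gridpt n t k.+1) - z (gridpt n t k)).

Lemma gridpt0 n t : 0 <= t -> gridpt n t 0 = 0.
Proof. by move=> t0; rewrite /gridpt mul0r min_l. Qed.

Lemma gridpt_ge0 n t k : 0 <= t -> 0 <= gridpt n t k.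
Proof. by move=> t0; rewrite /gridpt le_min t0 divr_ge0. Qed.

Lemma gridpt_le n t k : gridpt n t k <= t.
Proof. by rewrite /gridpt ge_min lexx orbT. Qed.

Lemma gridpt_mono n t k : gridpt n t k <= gridpt n t k.+1.
Proof.
rewrite /gridpt le_min !ge_min lexx orbT andbT.
by rewrite ler_pM2r ?invr_gt0 ?ltr0Sn// ler_nat leqnSn.
Qed.

Lemma gridpt_last n t : t <= n.+1%:R -> gridpt n t (n.+1 * n.+1) = t.
Proof. by move=> tn; rewrite /gridpt min_r// natrM mulfK. Qed.

Lemma gridpt_min n t r k : gridpt n (Num.min t r) k = Num.min (gridpt n t k) r.
Proof. by rewrite /gridpt minA. Qed.

Lemma gridpt_step n t k : gridpt n t k.+1 - gridpt n t k <= n.+1%:R^-1.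
Proof.
rewrite /gridpt -(natr1 k) mulrDl mul1r.
have : 0 < n.+1%:R^-1 :> R by rewrite invr_gt0.
set a := k%:R / _; set e := n.+1%:R^-1 => e0.
by have [?|?] := leP (a + e) t; have [?|?] := leP a t; lra.
Qed.

(** Summation by parts is the source of all the martingales below: [left_sum]
    is a discrete stochastic integral. *)
Lemma abel_summation n z b t : 0 <= t -> t <= n.+1%:R ->
  left_sum n z b t = z t * b t - z 0 * b 0 - right_sum n z b t.
Proof.
move=> t0 tn; apply/eqP; rewrite eq_sym subr_eq -big_split /=; apply/eqP.
pose u k := z (gridpt n t k) * b (gridpt n t k).
rewrite (eq_bigr (fun k : 'I__ => u k.+1 - u k)); last first.
  by move=> k _; rewrite /u; ring.
have := telescope_sumr u (leq0n (n.+1 * n.+1)); rewrite big_mkord => ->.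
by rewrite /u gridpt_last// gridpt0.
Qed.

Lemma right_sum_stop n z b t r : 0 <= t -> 0 <= r ->
  right_sum n (fun s => z (Num.min s r)) (fun s => b (Num.min s r)) t =
  right_sum n z b (Num.min t r).
Proof. by move=> t0 r0; rewrite /right_sum; apply: eq_bigr => k _; rewrite !gridpt_min. Qed.

End sums.

(** * Discrete stochastic integrals *)

Section martingale_integral.
Context {R : realType} {d : measure_display} {T : measurableType d}.
Variables (P : probability T R) (F : R -> set_system T).
Hypothesis hF : usual_filtration P F.
Implicit Types (xi : T -> R) (s t : R) (y b : process R T).

Lemma layer_le (xi : T -> R) (C h : R) : 0 < h -> (forall w, 0 <= xi w <= C) ->
  forall n, C <= n%:R * h -> forall w,
  `|xi w - \sum_(k < n) h * \1_[set w | k.+1%:R * h <= xi w] w| <= h.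
Proof.
move=> h0 xiC n Cn w; have /andP[x0 xC] := xiC w.
have := layer_sum h0 x0 (le_trans xC Cn).
rewrite (eq_bigr (fun k : 'I_n => h * \1_[set w | k.+1%:R * h <= xi w] w)); last first.
  by move=> k _; rewrite indicE; congr (_ * (nat_of_bool _)%:R); apply/idP/idP; rewrite inE.
by move=> /andP[? ?]; rewrite ger0_norm.
Qed.

(** The martingale property for events extends to bounded weights by
    approximating the weight uniformly by layers. *)
Lemma martingale_weight_ge0 y xi (C : R) s t : martingale P F y -> 0 <= s -> s <= t ->
  measurable_wrt (F s) xi -> (forall w, 0 <= xi w <= C) ->
  expect P (fun w => xi w * y t w) = expect P (fun w => xi w * y s w).
Proof.
move=> /(martingaleP hF)[ay iy cy] s0 st mxi xiC.
have t0 := le_trans s0 st; have iyt := iy t t0; have iys := iy s s0.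
have mx := measurable_wrt_fun hF s0 mxi.
have nx w : `|xi w| <= C by have /andP[? ?] := xiC w; rewrite ger0_norm.
have iz := intbleB iyt iys.
apply/eqP; rewrite -subr_eq0 -expectB; [|exact: (intbleM mx nx)|exact: (intbleM mx nx)].
under eq_fun do rewrite -mulrBr.
set z := fun w => y t w - y s w.
rewrite -normr_le0; apply/ler_addgt0Pl => e e0; rewrite addr0.
pose K := expect P (fun w => `|z w|).
have K0 : 0 <= K by apply: expect_ge0.
(* with this height the layer error, at most h E|z|, is below e *)
pose h := e / (K + 1).
have h0 : 0 < h by rewrite divr_gt0// ltr_wpDl.
pose n := (Num.truncn (C / h)).+1.
have Cn : C <= n%:R * h.
  by rewrite -ler_pdivrMr// ltW// truncnS_gt.
pose x' w : R := \sum_(k < n) h * \1_[set w | k.+1%:R * h <= xi w] w.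
have Ak k : F s [set w | k.+1%:R * h <= xi w].
  have -> : [set w | k.+1%:R * h <= xi w] = xi @^-1` `[k.+1%:R * h, +oo[.
    by apply/seteqP; split => w /=; rewrite in_itv/= andbT.
  by apply: mxi; exact: measurable_itv.
have iA k w' : intble P w' -> intble P (fun w => \1_[set w | k.+1%:R * h <= xi w] w * w' w).
  move=> i; apply: (intbleM _ (norm_indic _) i); apply: measurable_indic.
  exact: (filtration_measurable hF s0 (Ak k)).
have e1 : expect P (fun w => x' w * z w) = 0.
  under eq_fun do rewrite mulr_suml.
  rewrite (expect_sum (f := fun k w => h * \1_[set w | k.+1%:R * h <= xi w] w * z w)); last first.
    by move=> k _; under eq_fun do rewrite -mulrA; apply: intbleZ; exact: iA.
  rewrite big1// => k _; under eq_fun do rewrite -mulrA.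
  rewrite expectZ; last exact: iA.
  under eq_fun do rewrite mulrBr.
  by rewrite expectB ?(cy s t)// ?subrr ?mulr0//; apply: iA.
have ix' : intble P (fun w => x' w * z w).
  under eq_fun do rewrite mulr_suml.
  apply: (intble_sum (f := fun k w => h * \1_[set w | k.+1%:R * h <= xi w] w * z w)).
  by move=> k _; under eq_fun do rewrite -mulrA; apply: intbleZ; exact: iA.
have ixz : intble P (fun w => xi w * z w) by exact: (intbleM mx nx).
have -> : expect P (fun w => xi w * z w) = expect P (fun w => xi w * z w - x' w * z w).
  by rewrite expectB// e1 subr0.
apply: le_trans (expect_norm (intbleB ixz ix')) _.
apply: (@le_trans _ _ (expect P (fun w => h * `|z w|))).
  apply: expect_le.
  - exact: intble_norm (intbleB ixz ix').
  - by apply: intbleZ; exact: intble_norm.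
  - move=> w; rewrite -mulrBl normrM ler_wpM2r//.
    exact: (layer_le h0 xiC Cn).
rewrite expectZ; last exact: intble_norm.
rewrite -/K /h mulrAC -ler_pdivlMr ?invr_gt0 ?ltr_wpDl// invrK.
by rewrite ler_wpM2l ?(ltW e0)//; lra.
Qed.

Lemma martingale_weight y xi (C : R) s t : martingale P F y -> 0 <= s -> s <= t ->
  measurable_wrt (F s) xi -> (forall w, `|xi w| <= C) ->
  expect P (fun w => xi w * y t w) = expect P (fun w => xi w * y s w).
Proof.
move=> my s0 st mxi nx.
have [ay iy cy] := (martingaleP hF y).1 my.
have t0 := le_trans s0 st; have iyt := iy t t0; have iys := iy s s0.
have mx := measurable_wrt_fun hF s0 mxi.
have h1 : expect P (fun w => (xi w + C) * y t w) = expect P (fun w => (xi w + C) * y s w).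
  apply: (@martingale_weight_ge0 _ _ (C + C)) => //.
    by apply: (measurable_wrtD hF s0) => //; exact: (measurable_wrt_cst hF s0).
  by move=> w; have := nx w; rewrite ler_norml => /andP[? ?]; lra.
have h2 : expect P (fun w => C * y t w) = expect P (fun w => C * y s w).
  have := cy s t setT s0 st (filtrationT hF s0).
  under eq_fun do rewrite indicT mul1r.
  under [in RHS]eq_fun do rewrite indicT mul1r.
  by rewrite !expectZ// => ->.
have i1 u : intble P u -> intble P (fun w => xi w * u w) by move=> iu; exact: (intbleM mx nx).
have i2 u : intble P u -> intble P (fun w => C * u w) by exact: intbleZ.
move: h1; under eq_fun do rewrite mulrDl; under [in RHS]eq_fun do rewrite mulrDl.
rewrite expectD ?i1 ?i2// expectD ?i1 ?i2// h2.
exact: addIr.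
Qed.

(** Each summand of [left_sum], seen as a process in t: before time c it is zero,
    and after c its weight b_c is fixed and known. *)
Lemma martingale_weighted_increment y b (C c c' : R) : martingale P F y -> adapted F b ->
  (forall t w, 0 <= t -> `|b t w| <= C) -> 0 <= c -> c <= c' ->
  martingale P F (fun t w => b (Num.min c t) w * (y (Num.min c' t) w - y (Num.min c t) w)).
Proof.
move=> my ab bC c0 cc'.
have [ay iy cy] := (martingaleP hF y).1 my.
have c'0 := le_trans c0 cc'.
apply/(martingaleP hF).
have mle (x t : R) : Num.min x t <= t by rewrite ge_min lexx orbT.
have m0 (x t : R) : 0 <= x -> 0 <= t -> 0 <= Num.min x t by move=> ? ?; rewrite le_min; apply/andP.
split.
- move=> t t0; apply: (measurable_wrtM hF t0) => //; last apply: (measurable_wrtB hF t0) => //.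
  + by apply: (measurable_wrt_mono hF _ (mle c t)); [exact: m0|apply: ab; exact: m0].
  + by apply: (measurable_wrt_mono hF _ (mle c' t)); [exact: m0|apply: ay; exact: m0].
  + by apply: (measurable_wrt_mono hF _ (mle c t)); [exact: m0|apply: ay; exact: m0].
- move=> t t0; apply: (intbleM (C := C)).
  + by apply: (measurable_wrt_fun hF _ (ab _ _)); exact: m0.
  + by move=> w; apply: bC; exact: m0.
  + by apply: intbleB; apply: iy; exact: m0.
move=> s t A s0 st FA; have t0 := le_trans s0 st.
have [tc|ct] := leP t c.
  rewrite !(min_r (x := c)) ?(min_r (x := c')) ?(le_trans _ cc')// ?(le_trans st)//.
  by under eq_fun do rewrite subrr mulr0 mulr0; under [in RHS]eq_fun do rewrite subrr mulr0 mulr0.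
have mixed u : 0 <= u -> F u A -> c <= u -> measurable_wrt (F u) (fun w => \1_A w * b c w).
  move=> u0 Fu cu; apply: (measurable_wrtM hF u0) => //; first exact: (measurable_wrt_indic hF u0).
  by apply: (measurable_wrt_mono hF c0 cu); exact: ab.
have nb w : `|\1_A w * b c w| <= C.
  by rewrite normrM; apply: le_trans (bC c w c0); rewrite ler_piMl// norm_indic.
have mX : measurable_fun setT (fun w => \1_A w * b c w).
  apply: measurable_funM; first exact: (measurable_indic (filtration_measurable hF s0 FA)).
  exact: (measurable_wrt_fun hF c0 (ab c c0)).
have ix u : 0 <= u -> intble P (fun w => (\1_A w * b c w) * y u w).
  by move=> u0; apply: (intbleM mX nb); exact: iy.
under eq_fun do rewrite mulrA mulrBr.
rewrite expectB; [|apply: ix; exact: m0|exact: ix].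
have [sc|cs] := leP s c.
  rewrite (min_r (le_trans sc cc')).
  under [in RHS]eq_fun do rewrite subrr mulr0 mulr0.
  rewrite (expect_cst P 0); apply/eqP; rewrite subr_eq0; apply/eqP.
  apply: (martingale_weight (C := C)) => //.
    by rewrite le_min cc' (ltW ct).
  by apply: mixed => //; exact: (filtration_mono hF s0 sc).
under [in RHS]eq_fun do rewrite mulrA mulrBr.
rewrite expectB; [|apply: ix; exact: m0|exact: ix].
congr (_ - _); have [c's|sc'] := leP c' s.
  by rewrite (min_l (le_trans c's st)).
apply: (martingale_weight (C := C)) => //.
  by rewrite le_min st (ltW sc').
by apply: mixed => //; exact: ltW.
Qed.

Lemma left_sum_martingale n y b (C : R) : martingale P F y -> adapted F b ->
  (forall t w, 0 <= t -> `|b t w| <= C) ->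
  martingale P F (fun t w => left_sum n (y ^~ w) (b ^~ w) t).
Proof.
move=> my ab bC; apply: (martingale_sum hF (M := fun k t w =>
  b (gridpt n t k) w * (y (gridpt n t k.+1) w - y (gridpt n t k) w))) => k _.
apply: (martingale_weighted_increment (C := C)) => //.
by rewrite ler_pM2r ?invr_gt0 ?ltr0Sn// ler_nat leqnSn.
Qed.

End martingale_integral.

(** * The martingale Y B - int Y dB for bounded B *)

Section integral_martingale.
Context {R : realType} {d : measure_display} {T : measurableType d}.
Variables (P : probability T R) (F : R -> set_system T).
Hypothesis hF : usual_filtration P F.
Implicit Types (xi f : T -> R) (s t : R) (y b J : process R T).

Lemma excess_small f : intble P f ->
  forall e, 0 < e -> exists2 K, 0 <= K & expect P (fun w => excess K (f w)) <= e.
Proof.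
move=> i_f e e0; have mf := intble_meas i_f.
have [|||||_ ] := @expect_dct _ _ _ P (fun n w => excess n%:R (f w)) (cst 0) (fun w => `|f w|).
- by move=> n; exact: (measurableT_comp (measurable_excess n%:R) mf).
- exact: measurable_cst.
- exact: intble_norm.
- apply: aeW => w; apply: cvg_near_cst; near=> n.
  rewrite /excess max_r// subr_le0.
  near: n; exact: nbhs_infty_ger.
- by move=> n w; rewrite ger0_norm ?excess_ge0// excess_le.
rewrite expect_cst => /cvgrPdist_le/(_ e e0)[n _ /(_ n (leqnn n))].
rewrite sub0r normrN => h; exists n%:R => //.
exact: le_trans (ler_norm _) h.
Unshelve. all: by end_near. Qed.

(** excess K x = tailsgn K x * x - K * tailind K x, and for fixed z the affine
    function x |-> tailsgn K z * x - K * tailind K z is a support of excess K at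
    z.  This is how convexity is used without conditional expectations. *)
Definition tailsgn (K x : R) : R := \1_(`]K, +oo[%classic) x - \1_(`]-oo, (- K)[%classic) x.
Definition tailind (K x : R) : R := \1_(`]K, +oo[%classic) x + \1_(`]-oo, (- K)[%classic) x.

Lemma tail_itv (K x : R) : 0 <= K ->
  (K < x /\ tailsgn K x = 1 /\ tailind K x = 1) \/
  (x < - K /\ tailsgn K x = -1 /\ tailind K x = 1) \/
  (`|x| <= K /\ tailsgn K x = 0 /\ tailind K x = 0).
Proof.
move=> K0; rewrite /tailsgn /tailind !indicE !mem_setE !in_itv/= andbT.
have [h1|h1] := ltP K x; have [h2|h2] := ltP x (- K).
- lra.
- by left; rewrite subr0 addr0.
- by right; left; rewrite sub0r add0r.
- by right; right; rewrite subr0 addr0 ler_norml h1 h2.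
Qed.

Lemma excess_tail (K x : R) : 0 <= K -> excess K x = tailsgn K x * x - K * tailind K x.
Proof.
move=> K0; rewrite /excess.
have [[h [-> ->]]|[[h [-> ->]]|[h [-> ->]]]] := tail_itv x K0.
- by rewrite ger0_norm ?max_l; lra.
- by rewrite ler0_norm ?max_l; lra.
- by rewrite max_r ?subr_le0//; lra.
Qed.

Lemma excess_tail_le (K x z : R) : 0 <= K -> tailsgn K z * x - K * tailind K z <= excess K x.
Proof.
move=> K0; rewrite /excess.
have [[h [-> ->]]|[[h [-> ->]]|[h [-> ->]]]] := tail_itv z K0.
- by rewrite le_max mul1r mulr1 lerB// ler_norm.
- by rewrite le_max mulN1r mulr1 lerB// -normrN ler_norm.
- by rewrite mul0r mulr0 subr0 le_max lexx orbT.
Qed.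

(** Conditional Jensen inequality for the convex function excess K.  The support
    line of excess K at y_s has F_s-measurable coefficients, so the martingale
    property applies to it. *)
Lemma excess_weight y xi (C K : R) s t : martingale P F y -> 0 <= s -> s <= t ->
  measurable_wrt (F s) xi -> (forall w, 0 <= xi w <= C) -> 0 <= K ->
  expect P (fun w => xi w * excess K (y s w)) <= expect P (fun w => xi w * excess K (y t w)).
Proof.
move=> my s0 st mxi xiC K0.
have [ay iy cy] := (martingaleP hF y).1 my.
have t0 := le_trans s0 st; have iyt := iy t t0; have iys := iy s s0.
have mx := measurable_wrt_fun hF s0 mxi.
have nx w : `|xi w| <= C by have /andP[? ?] := xiC w; rewrite ger0_norm.
have msgn : measurable_fun setT (tailsgn K).
  by apply: measurable_funB; apply: measurable_indic; exact: measurable_itv.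
have mind : measurable_fun setT (tailind K).
  by apply: measurable_funD; apply: measurable_indic; exact: measurable_itv.
pose xi1 w := xi w * tailsgn K (y s w).
pose xi2 w := K * (xi w * tailind K (y s w)).
have m1 : measurable_wrt (F s) xi1.
  by apply: (measurable_wrtM hF s0) => //; apply: (measurable_wrt_comp hF s0 msgn); exact: ay.
have m2 : measurable_wrt (F s) (fun w => xi w * tailind K (y s w)).
  by apply: (measurable_wrtM hF s0) => //; apply: (measurable_wrt_comp hF s0 mind); exact: ay.
have n1 w : `|xi1 w| <= C.
  rewrite normrM; apply: le_trans (nx w); rewrite ler_piMr//.
  by have [[_ [-> _]]|[[_ [-> _]]|[_ [-> _]]]] := tail_itv (y s w) K0; rewrite ?normr1 ?normrN1 ?normr0.
have n2 w : `|xi w * tailind K (y s w)| <= C.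
  rewrite normrM; apply: le_trans (nx w); rewrite ler_piMr//.
  by have [[_ [_ ->]]|[[_ [_ ->]]|[_ [_ ->]]]] := tail_itv (y s w) K0; rewrite ?normr1 ?normr0.
have i2 : intble P xi2.
  by apply: intbleZ; apply: (intble_bdd _ (measurable_wrt_fun hF s0 m2) n2).
have i1 u : intble P u -> intble P (fun w => xi1 w * u w).
  by move=> iu; apply: (intbleM (measurable_wrt_fun hF s0 m1) n1 iu).
have -> : expect P (fun w => xi w * excess K (y s w)) =
          expect P (fun w => xi1 w * y s w - xi2 w).
  by congr expect; apply/funext => w; rewrite excess_tail// /xi1 /xi2; ring.
rewrite expectB//; last exact: i1.
rewrite -(martingale_weight hF my s0 st m1 n1) -expectB//; last exact: i1.
apply: expect_le.
- by apply: intbleB => //; exact: i1.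
- by apply: (intbleM mx nx); exact: intble_excess.
move=> w; have -> : xi1 w * y t w - xi2 w =
    xi w * (tailsgn K (y s w) * y t w - K * tailind K (y s w)) by rewrite /xi1 /xi2; ring.
by apply: ler_wpM2l; [have /andP[] := xiC w|exact: excess_tail_le].
Qed.

Section bounded_integrator.
Variables (y b : process R T) (C : R).
Hypothesis my : martingale P F y.
Hypothesis ab : adapted F b.
Hypothesis b0C : forall t w, 0 <= t -> 0 <= b t w <= C.
Hypothesis b_nd : forall s t w, 0 <= s -> s <= t -> b s w <= b t w.

Let C0 : 0 <= C.
Proof.
by have /andP[h1 h2] := b0C point (lexx 0); exact: le_trans h2.
Qed.

Let S n t w := right_sum n (y ^~ w) (b ^~ w) t.

Let db n t k w : R := b (gridpt n t k.+1) w - b (gridpt n t k) w.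

Let db_bounded n t k w : 0 <= t -> 0 <= db n t k w <= C.
Proof.
move=> t0; have g0 := gridpt_ge0 n k t0; have g1 := gridpt_ge0 n k.+1 t0.
have := b_nd w g0 (gridpt_mono n t k); rewrite /db.
have /andP[? ?] := b0C w g0; have /andP[? ?] := b0C w g1 => ?.
by apply/andP; split; lra.
Qed.

Let db_measurable n t k : 0 <= t -> measurable_wrt (F (gridpt n t k.+1)) (db n t k).
Proof.
move=> t0; have g0 := gridpt_ge0 n k t0; have g1 := gridpt_ge0 n k.+1 t0.
apply: (measurable_wrtB hF g1); first exact: ab.
by apply: (measurable_wrt_mono hF g0 (gridpt_mono n t k)); exact: ab.
Qed.

Let db_sum n t w : 0 <= t -> \sum_(k < n.+1 * n.+1) db n t k w <= C.
Proof.
move=> t0; rewrite /db.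
have := telescope_sumr (fun k => b (gridpt n t k) w) (leq0n (n.+1 * n.+1)).
rewrite big_mkord => ->.
have /andP[? ?] := b0C w (gridpt_ge0 n (n.+1 * n.+1) t0).
have /andP[? ?] := b0C w (gridpt_ge0 n 0 t0); lra.
Qed.

Let S_mw n t : 0 <= t -> measurable_wrt (F t) (S n t).
Proof.
have [ay iy cy] := (martingaleP hF y).1 my.
move=> t0; apply: (measurable_wrt_sum hF t0 (f := fun k w => y (gridpt n t k.+1) w * db n t k w)) => k _.
have g1 := gridpt_ge0 n k.+1 t0.
apply: (measurable_wrt_mono hF g1 (gridpt_le n t k.+1)); apply: (measurable_wrtM hF g1); first exact: ay.
exact: db_measurable.
Qed.

Let db_intble n t k f : 0 <= t -> intble P f -> intble P (fun w => db n t k w * f w).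
Proof.
move=> t0; have g1 := gridpt_ge0 n k.+1 t0; apply: (intbleM (C := C)).
  exact: (measurable_wrt_fun hF g1 (db_measurable n k t0)).
by move=> w; have /andP[? ?] := db_bounded n k w t0; rewrite ger0_norm.
Qed.

Let S_int n t : 0 <= t -> intble P (S n t).
Proof.
have [ay iy cy] := (martingaleP hF y).1 my.
move=> t0; apply: (intble_sum (f := fun k w => y (gridpt n t k.+1) w * db n t k w)) => k _.
under eq_fun do rewrite mulrC; apply: db_intble => //; apply: iy; exact: gridpt_ge0.
Qed.

(** Uniform integrability of the right sums.  As the increments of b are
    nonnegative with sum at most C, the excess of the sum is at most the sum of
    the db_k * excess K (y at the right end), and by [excess_weight] every value
    of y can be replaced by the final one. *)
Let S_excess n t K : 0 <= t -> 0 <= K ->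
  expect P (fun w => excess (K * C) (S n t w)) <= C * expect P (fun w => excess K (y t w)).
Proof.
have [ay iy cy] := (martingaleP hF y).1 my.
move=> t0 K0.
pose G t' n t k w := db n t k w * excess K (y t' w).
have iG t' k : 0 <= t' -> intble P (G t' n t k).
  by move=> t'0; apply: db_intble => //; apply: intble_excess => //; exact: iy.
apply: (@le_trans _ _ (expect P (fun w => \sum_(k < n.+1 * n.+1) G (gridpt n t k.+1) n t k w))).
  apply: expect_le.
  - by apply: intble_excess; [exact: mulr_ge0|exact: S_int].
  - by apply: (intble_sum (f := fun k => G (gridpt n t k.+1) n t k)) => k _; apply: iG; exact: gridpt_ge0.
  move=> w; have s0 : 0 <= \sum_(k < n.+1 * n.+1) G (gridpt n t k.+1) n t k w.
    apply: sumr_ge0 => k _; rewrite mulr_ge0 ?excess_ge0//.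
    by have /andP[] := db_bounded n k w t0.
  rewrite {1}/excess ge_max s0 andbT lerBlDr.
  apply: le_trans (ler_norm_sum _ _ _) _.
  apply: (@le_trans _ _ (\sum_(k < n.+1 * n.+1) (G (gridpt n t k.+1) n t k w + K * db n t k w))).
    apply: ler_sum => k _; rewrite normrM.
    have /andP[d0 _] := db_bounded n k w t0.
    rewrite (ger0_norm d0) /G mulrC [K * _]mulrC -mulrDr ler_wpM2l//.
    by rewrite -lerBlDr /excess le_max lexx.
  rewrite big_split /= lerD2l -mulr_sumr ler_wpM2l//; exact: db_sum.
rewrite (expect_sum (f := fun k => G (gridpt n t k.+1) n t k)); last first.
  by move=> k _; apply: iG; exact: gridpt_ge0.
apply: (@le_trans _ _ (\sum_(k < n.+1 * n.+1) expect P (G t n t k))).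
  apply: ler_sum => k _; apply: (@excess_weight _ _ C) => //.
  - exact: gridpt_ge0.
  - exact: gridpt_le.
  - exact: db_measurable.
  - by move=> w; exact: db_bounded.
rewrite -(expect_sum (f := G t n t)); last by move=> k _; exact: iG.
rewrite -expectZ; last by apply: intble_excess K0 (iy t t0).
apply: expect_le.
- by apply: (intble_sum (f := G t n t)) => k _; exact: iG.
- by apply: intbleZ; apply: intble_excess => //; exact: iy.
move=> w; rewrite -mulr_suml ler_wpM2r ?excess_ge0//; exact: db_sum.
Qed.

(** By Abel summation the approximations are martingales; uniform integrability
    lets the martingale property pass to the limit.  It is used for continuous b
    and for the indicator of a stopping time having occurred. *)
Lemma integral_martingale J :
  (forall t, 0 <= t -> {ae P, forall w, right_sum n (y ^~ w) (b ^~ w) t @[n --> \oo] --> J t w}) ->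
  martingale P F (fun t w => y t w * b t w - y 0 w * b 0 w - J t w).
Proof.
move=> cJ; have [ay iy cy] := (martingaleP hF y).1 my.
have mJ t : 0 <= t -> measurable_wrt (F t) (J t).
  by move=> t0; apply: (measurable_wrt_cvg hF t0 (f := fun n => S n t)); [move=> n; exact: S_mw|exact: cJ].
have ui t (h : T -> R) : 0 <= t -> measurable_fun setT h -> (forall w, `|h w| <= 1) ->
    intble P (J t) /\ expect P (fun w => h w * S n t w) @[n --> \oo] --> expect P (fun w => h w * J t w).
  move=> t0 mh h1; apply: uniformly_integrable_cvg => //.
  - by move=> n; exact: S_int.
  - exact: (measurable_wrt_fun hF t0 (mJ t t0)).
  - exact: cJ.
  - move=> e e0; have C1 : 0 < C + 1 by rewrite ltr_wpDl.
    have [K K0 hK] := excess_small (iy t t0) (divr_gt0 e0 C1).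
    (* the right sums have weights of total mass C, hence level K * C *)
exists (K * C); first exact: mulr_ge0.
    move=> n; apply: le_trans (S_excess n t0 K0) _.
    apply: le_trans (ler_wpM2l C0 hK) _.
    rewrite mulrCA ler_piMr ?(ltW e0)// ler_pdivrMr//; lra.
have ib t (f : T -> R) : 0 <= t -> intble P f -> intble P (fun w => f w * b t w).
  move=> t0 i_f; under eq_fun do rewrite mulrC; apply: (intbleM (C := C)) => //.
    exact: (measurable_wrt_fun hF t0 (ab t0)).
  by move=> w; have /andP[? ?] := b0C w t0; rewrite ger0_norm.
pose Z t w := y t w * b t w - y 0 w * b 0 w.
have iZ t : 0 <= t -> intble P (Z t).
  by move=> t0; apply: intbleB; apply: ib => //; exact: iy.
have iJ t : 0 <= t -> intble P (J t).
  move=> t0; have [] // := ui t (cst 0) t0 (measurable_cst _) => w; rewrite normr0; exact: ler01.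
apply/(martingaleP hF); split.
- move=> t t0; apply: (measurable_wrtB hF t0); last exact: mJ.
  apply: (measurable_wrtB hF t0); first by apply: (measurable_wrtM hF t0); [exact: ay|exact: ab].
  by apply: (measurable_wrt_mono hF (lexx 0) t0); apply: (measurable_wrtM hF (lexx 0)); [exact: ay|exact: ab].
- by move=> t t0; apply: intbleB; [exact: iZ|exact: iJ].
move=> s t A s0 st FA; have t0 := le_trans s0 st.
have mA : measurable_fun setT (\1_A : T -> R) by exact: measurable_indic (filtration_measurable hF s0 FA).
have iA (f : T -> R) : intble P f -> intble P (fun w => \1_A w * f w).
  by move=> i_f; apply: (intbleM mA (norm_indic A)).
have lim u : 0 <= u ->
   expect P (fun w => \1_A w * left_sum n (y ^~ w) (b ^~ w) u) @[n --> \oo] -->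
   expect P (fun w => \1_A w * (Z u w - J u w)).
  move=> u0; have [_ cu] := ui u _ u0 mA (norm_indic A).
  under [in X in _ --> X]eq_fun do rewrite mulrBr.
  rewrite expectB; [|exact/iA/iZ|exact/iA/iJ].
  have cu2 : expect P (fun w => \1_A w * Z u w) - expect P (fun w => \1_A w * S n u w)
      @[n --> \oo] --> expect P (fun w => \1_A w * Z u w) - expect P (fun w => \1_A w * J u w).
    by apply: cvgB => //; exact: cvg_cst.
  apply: cvg_trans cu2; apply: near_eq_cvg; near=> n.
  rewrite /= -expectB; [|exact/iA/iZ|exact/iA/S_int].
  have un : u <= n%:R by near: n; exact: nbhs_infty_ger.
  congr expect; apply/funext => w; rewrite -mulrBr; congr (_ * _).
  by rewrite abel_summation// (le_trans un)// ler_nat leqnSn.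
apply: (cvg_unique _ (lim t t0)) => //.
apply: cvg_trans (lim s s0); apply: near_eq_cvg; near=> n.
have ml := @left_sum_martingale _ _ _ P F hF n y b C my ab.
have /ml/(martingaleP hF)[_ _ cl] : forall t w, 0 <= t -> `|b t w| <= C.
  by move=> v w v0; have /andP[? ?] := b0C w v0; rewrite ger0_norm.
by rewrite (cl s t).
Unshelve. all: by end_near. Qed.

End bounded_integrator.
End integral_martingale.

(** * Pathwise Stieltjes integrals of cadlag paths *)

Section paths.
Context {R : realType}.
Implicit Types (z a b x : R -> R) (t u v : R).

Lemma near_right x t (e : R) : x s @[s --> t^'+] --> x t -> 0 < e ->
  \forall s \near t, t < s -> `|x t - x s| <= e.
Proof.
by move=> /cvgrPdist_le h e0; have := h e e0; rewrite near_withinE.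
Qed.

Lemma cadlag_locally_bounded x t : cadlag_path x -> 0 <= t ->
  exists M, \forall s \near t, 0 <= s -> `|x s| <= M.
Proof.
move=> [rc ll] t0.
have [M1 h1] : exists M, \forall s \near t, t < s -> `|x s| <= M.
  exists (`|x t| + 1); have h := near_right (rc t t0) ltr01; near=> s => ts.
  by rewrite -lerBlDl (le_trans (lerB_dist _ _))// distrC (near h s).
have [M2 h2] : exists M, \forall s \near t, s < t -> 0 <= s -> `|x s| <= M.
  move: t0; rewrite le_eqVlt => /predU1P[<-|t0].
    by exists 0; near=> s => s0; rewrite leNgt s0.
  have /cvg_ex[l /cvgrPdist_le/(_ 1 ltr01)] := ll t t0.
  rewrite near_withinE => hl; exists (`|l| + 1); near=> s => st _.
  by rewrite -lerBlDl (le_trans (lerB_dist _ _))// distrC (near hl s).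
exists (Num.max (Num.max M1 M2) `|x t|).
near=> s => s0; have g1 : t < s -> `|x s| <= M1 by near: s; exact: h1.
have g2 : s < t -> 0 <= s -> `|x s| <= M2 by near: s; exact: h2.
rewrite !le_max; have [st|ts|st] := ltgtP s t.
- by rewrite (g2 st s0) orbT.
- by rewrite (g1 ts).
- by rewrite st lexx orbT.
Unshelve. all: by end_near. Qed.

Lemma cadlag_bounded x t : cadlag_path x ->
  exists M, forall s, 0 <= s <= t -> `|x s| <= M.
Proof.
move=> cx; have /compact_near_coveringP := @segment_compact R 0 t.
move=> /(_ R (+oo) (fun i s => 0 <= s -> `|x s| <= i) _).
have h : forall s, `[0, t]%classic s ->
    \forall s' \near s & i \near +oo, 0 <= s' -> `|x s'| <= i.
  move=> s /=; rewrite in_itv/= => /andP[s0 _].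
  have [M hM] := cadlag_locally_bounded cx s0.
  exists ([set s' | 0 <= s' -> `|x s'| <= M], [set i : R | M <= i]) => /=.
    by split; [exact: hM|apply: nbhs_pinfty_ge; exact: num_real].
  by case=> s' i /= [h1 h2] s'0; exact: le_trans (h1 s'0) h2.
move=> /(_ h) [M [_ hM]]; exists (M + 1) => s st.
have /andP[s0 _] := st.
by apply: (hM (M + 1)) => //; rewrite ?ltrDl// /= in_itv.
Unshelve. all: by end_near. Qed.

(** The path with a single unit jump at u.  As a function of u, the right sum of
    z against jump u is the step function taking on each grid interval the value
    of z at its right end; so these sums are both what optional stopping needs and
    what dominated convergence is applied to. *)
Definition jump u s : R := (u <= s)%R%:R.

Lemma jump_diff u s s' : s <= s' -> jump u s' - jump u s = \1_(`]s, s']%classic) u.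
Proof.
move=> ss'; rewrite /jump indicE mem_setE in_itv/=.
have [us|su] := leP u s; rewrite ?(le_trans us ss')/= ?subrr//.
by rewrite subr0.
Qed.

Lemma right_sum_jump_far n z t u : 0 <= t -> ~~ (0 < u <= t) -> right_sum n z (jump u) t = 0.
Proof.
move=> t0 h; apply: big1 => k _; rewrite jump_diff ?gridpt_mono//.
rewrite indicE mem_setE in_itv/=; case: andP; last by rewrite mulr0.
move=> [h1 h2]; move: h; rewrite (le_lt_trans (gridpt_ge0 n k t0) h1)/=.
by rewrite (le_trans h2 (gridpt_le n t k.+1)).
Qed.

(** The increments of jump u along the grid sum to 1, so the right sum is an
    average of values of z at points just after u. *)
Lemma right_sum_jump_dist n z t u (e c : R) : 0 < u -> u <= t -> t <= n.+1%:R ->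
  (forall s, u <= s -> s <= t -> s - u <= n.+1%:R^-1 -> `|c - z s| <= e) ->
  `|c - right_sum n z (jump u) t| <= e.
Proof.
move=> u0 ut tn h; have t0 := le_trans (ltW u0) ut.
pose I k : R := jump u (gridpt n t k.+1) - jump u (gridpt n t k).
have I1 : \sum_(k < n.+1 * n.+1) I k = 1.
  have := telescope_sumr (fun k => jump u (gridpt n t k)) (leq0n (n.+1 * n.+1)).
  by rewrite big_mkord => ->; rewrite gridpt_last// gridpt0// /jump ut leNgt u0 subr0.
have -> : c - right_sum n z (jump u) t = \sum_(k < n.+1 * n.+1) (c - z (gridpt n t k.+1)) * I k.
  under eq_bigr do rewrite mulrBl; rewrite big_split /= -mulr_sumr I1 mulr1.
  by rewrite sumrN.
apply: le_trans (ler_norm_sum _ _ _) _.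
rewrite -[leRHS]mulr1 -I1 mulr_sumr; apply: ler_sum => k _.
rewrite normrM /I jump_diff ?gridpt_mono// indicE mem_setE in_itv/=.
case: andP => [[h1 h2]|_]; last by rewrite normr0 !mulr0.
rewrite normr1 !mulr1; apply: h => //; first exact: gridpt_le.
by apply: le_trans (gridpt_step n t k); rewrite lerD2l lerN2 ltW.
Qed.

Lemma right_sum_jump_cvg z t u : 0 < u -> u <= t -> z s @[s --> u^'+] --> z u ->
  right_sum n z (jump u) t @[n --> \oo] --> z u.
Proof.
move=> u0 ut rz; apply/cvgrPdist_le => e e0.
have [de /= de0 hd] := near_right rz e0.
near=> n; apply: right_sum_jump_dist => //.
  apply: (@le_trans _ _ n%:R); last by rewrite ler_nat.
  by near: n; exact: nbhs_infty_ger.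
move=> s; rewrite le_eqVlt => /predU1P[<- _ _|us st sn].
  by rewrite subrr normr0 ltW.
apply: hd => //=; rewrite ltr0_norm ?subr_lt0// opprB (le_lt_trans sn)//.
rewrite -[ltRHS]invrK ltf_pV2 ?posrE ?invr_gt0// (lt_le_trans (y := n%:R))//; last by rewrite ler_nat.
by near: n; exact: nbhs_infty_gtr.
Unshelve. all: by end_near. Qed.

Lemma right_sum_bound n z b t M : 0 <= t ->
  (forall s, 0 <= s <= t -> `|z s| <= M) ->
  (forall s s', 0 <= s -> s <= s' -> b s <= b s') ->
  `|right_sum n z b t| <= M * (b t - b 0).
Proof.
move=> t0 hM nb; apply: le_trans (ler_norm_sum _ _ _) _.
have M0 : 0 <= M by apply: le_trans (hM 0 _); rewrite ?lexx ?t0.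
apply: (@le_trans _ _ (\sum_(k < n.+1 * n.+1) M * (b (gridpt n t k.+1) - b (gridpt n t k)))).
  apply: ler_sum => k _; rewrite normrM.
  have d0 : 0 <= b (gridpt n t k.+1) - b (gridpt n t k).
    by rewrite subr_ge0; apply: nb; [exact: gridpt_ge0|exact: gridpt_mono].
  by rewrite (ger0_norm d0) ler_wpM2r// hM// gridpt_ge0//= gridpt_le.
rewrite -mulr_sumr ler_wpM2l//.
have := telescope_sumr (fun k => b (gridpt n t k)) (leq0n (n.+1 * n.+1)).
rewrite big_mkord => ->; apply: lerB; apply: nb; rewrite ?gridpt_ge0 ?gridpt_le//.
Qed.

Lemma cumulative_of_path b : nondecreasing_path b ->
  (forall t, 0 <= t -> b s @[s --> t^'+] --> b t) ->
  exists f : cumulative R R, forall t, f t = b (Num.max t 0).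
Proof.
move=> nb cb; pose pcum t := b (Num.max t 0).
have f_nd : {homo pcum : x y / x <= y}.
  move=> x y xy; apply: nb; first by rewrite le_max lexx orbT.
  by rewrite ge_max !le_max xy lexx !orbT.
have f_rc : right_continuous pcum.
  move=> t; have [t0|t0] := leP 0 t.
    rewrite {2}/pcum max_l//; apply: cvg_trans (cb t t0); apply: near_eq_cvg.
    near=> s; rewrite /pcum max_l//; apply: (le_trans t0).
    by near: s; exact: nbhs_right_ge.
  rewrite {2}/pcum max_r ?(ltW t0)//; apply: cvg_near_cst.
  near=> s; rewrite /pcum max_r//.
  by near: s; exact: nbhs_right_le.
pose m := isCumulative.Build R _ R pcum f_nd f_rc.
by exists (HB.pack pcum m : cumulative R R).
Unshelve. all: by end_near. Qed.

Lemma lebesgue_stieltjes_itv (f : cumulative R R) u v : u <= v ->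
  lebesgue_stieltjes_measure f `]u, v]%classic = (f v - f u)%:E.
Proof.
move=> uv; rewrite /lebesgue_stieltjes_measure /measure_extension/=.
rewrite measurable_mu_extE/=; last exact: is_ocitv.
by rewrite wlength_itv_bnd.
Qed.

Section stieltjes.
Variables (z b : R -> R) (f : cumulative R R).
Hypothesis cz : cadlag_path z.
Hypothesis fE : forall t, f t = b (Num.max t 0).
Let mu := lebesgue_stieltjes_measure f.

Let stieltjes_itv u v : 0 <= u -> u <= v -> mu `]u, v]%classic = (b v - b u)%:E.
Proof.
by move=> u0 uv; rewrite /mu lebesgue_stieltjes_itv// !fE !max_l// (le_trans u0).
Qed.

Let integ v g := mu.-integrable `]0, v]%classic (EFin \o g).

Let mitv u v : measurable (`]u, v]%classic : set (measurableTypeR R)).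
Proof. exact: measurable_itv. Qed.

Let mrsum n t : measurable_fun setT (fun u : measurableTypeR R => right_sum n z (jump u) t).
Proof.
rewrite /right_sum; apply: measurable_sum => k.
under eq_fun do rewrite jump_diff ?gridpt_mono//.
apply: measurable_funM => //; apply: measurable_indic; exact: mitv.
Qed.

Let muD t : 0 <= t -> (mu `]0%R, t]%classic < +oo)%E.
Proof. by move=> t0; rewrite stieltjes_itv// ltry. Qed.

Let bint t (g : R -> R) (M : R) : 0 <= t ->
  measurable_fun (`]0, t]%classic : set (measurableTypeR R)) g ->
  (forall u, 0 < u <= t -> `|g u| <= M) -> integ t g.
Proof.
move=> t0 mg gM; apply: measurable_bounded_integrable => //; first exact: muD.
exists M; split; first exact: num_real.
by move=> M' MM' u /=; rewrite in_itv/= => /gM h; apply: le_trans h (ltW MM').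
Qed.

(** The right sum against b is the integral of the right sums against unit
    jumps. *)
Let right_sum_integral n t : 0 <= t ->
  \int[mu]_(u in `]0, t]) right_sum n z (jump u) t = right_sum n z b t.
Proof.
move=> t0; rewrite /right_sum.
have g0 k : 0 <= gridpt n t k by exact: gridpt_ge0.
pose I k : set (measurableTypeR R) := `]gridpt n t k, gridpt n t k.+1]%classic.
have -> : (fun u => \sum_(k < n.+1 * n.+1) z (gridpt n t k.+1) * (jump u (gridpt n t k.+1) - jump u (gridpt n t k)))
   = (fun u => \sum_(k < n.+1 * n.+1) z (gridpt n t k.+1) * \1_(I k) u).
  by apply/funext => u; apply: eq_bigr => k _; rewrite jump_diff ?gridpt_mono.
have mI k : measurable (I k) by exact: mitv.
have iI k : integ t (\1_(I k) : R -> R).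
  apply: (@bint _ _ 1) => //.
  by move=> u _; rewrite indicE; case: (_ \in _); rewrite ?normr0 ?normr1.
have iZ k : integ t (fun u => z (gridpt n t k.+1) * \1_(I k) u).
  have h := @integrableZl _ _ _ mu _ (mitv 0 t) (z (gridpt n t k.+1)) _ (iI k).
  exact: h.
have eI k : \int[mu]_(u in `]0, t]) \1_(I k) u = b (gridpt n t k.+1) - b (gridpt n t k).
  rewrite /Rintegral integral_indic//=.
  rewrite (_ : I k `&` `]0, t]%classic = I k).
    transitivity (fine (b (gridpt n t k.+1) - b (gridpt n t k))%:E) => //.
    congr fine; exact: (stieltjes_itv (g0 k) (gridpt_mono n t k)).
  apply/setIidPl => u; rewrite /I /= !in_itv/= => /andP[h1 h2].
  by rewrite (le_lt_trans (g0 k) h1) (le_trans h2 (gridpt_le n t _)).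
suff : forall m, integ t (fun u => \sum_(k < m) z (gridpt n t k.+1) * \1_(I k) u) /\
  \int[mu]_(u in `]0, t]) \sum_(k < m) z (gridpt n t k.+1) * \1_(I k) u =
  \sum_(k < m) z (gridpt n t k.+1) * (b (gridpt n t k.+1) - b (gridpt n t k)) by case/(_ (n.+1 * n.+1)%N).
elim=> [|m [IHi IH]].
  under eq_fun do rewrite big_ord0; split.
    by apply: (@bint _ _ 0) => // u _; rewrite normr0.
  by rewrite big_ord0 Rintegral_cst//= mul0r.
under eq_fun do rewrite big_ord_recr /=; split.
  have h := integrableD (mitv 0 t) IHi (iZ m); exact: h.
rewrite RintegralD//; last exact: iZ.
rewrite IH big_ord_recr /= RintegralZl// ?eI//; exact: iI.
Qed.

Let dct t : 0 <= t -> integ t z /\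
  right_sum n z b t @[n --> \oo] --> \int[mu]_(u in `]0, t]) z u.
Proof.
move=> t0; have [M hM] := cadlag_bounded t cz.
have rc u : 0 < u -> u <= t -> right_sum n z (jump u) t @[n --> \oo] --> z u.
  by move=> u0 ut; apply: right_sum_jump_cvg => //; apply: cz.1; exact: ltW.
have M0 : 0 <= M by apply: le_trans (hM 0 _); rewrite ?lexx ?t0.
have mz : measurable_fun (`]0, t]%classic : set (measurableTypeR R)) z.
  apply: (@measurable_fun_cvg _ _ _ _ (fun n u => right_sum n z (jump u) t)).
    by move=> n; apply: measurable_funTS; exact: mrsum.
  by move=> u /=; rewrite in_itv/= => /andP[? ?]; exact: rc.
have iz : integ t z.
  apply: (bint t0 mz (M := M)) => u /andP[u0 ut]; apply: hM.
  by rewrite (ltW u0).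
split => //.
have [] := @dominated_convergence _ _ _ mu _ (mitv 0 t)
  (fun n u => (right_sum n z (jump u) t)%:E) (EFin \o z) (cst M%:E).
- by move=> n; apply/measurable_EFinP; apply: measurable_funTS; exact: mrsum.
- exact/measurable_EFinP.
- apply: aeW => u /=; rewrite in_itv/= => /andP[u0 ut].
  by apply/fine_cvgP; split; [exact: nearW|exact: rc].
- by apply: (@bint _ (cst M) M) => // u _; rewrite ger0_norm.
- apply: aeW => u n /=; rewrite in_itv/= lee_fin => /andP[u0 ut].
  apply: le_trans (right_sum_bound n t0 hM _) _.
    move=> s s' s0 ss'; rewrite /jump ler_nat; have [us|//] := leP u s.
    by rewrite (le_trans us ss').
  by rewrite /jump ut (leNgt u 0) u0 subr0 mulr1.
move=> _ _ c.
have fz : (\int[mu]_(x in `]0%R, t]) (EFin \o z) x)%E \is a fin_num.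
  exact: (integrable_fin_num (mitv 0 t) iz).
have h : \int[mu]_(u in `]0, t]) right_sum n z (jump u) t @[n --> \oo] -->
    \int[mu]_(u in `]0, t]) z u.
  by apply: fine_cvg; rewrite fineK.
by under eq_fun do rewrite -right_sum_integral//.
Qed.

Lemma stieltjes_cvg_cumulative : exists J : R -> R,
  [/\ J 0 = 0,
    forall t, 0 <= t -> right_sum n z b t @[n --> \oo] --> J t,
    forall u v c, 0 <= u -> u <= v -> (forall s, u < s -> s <= v -> z s <= c) ->
      J v - J u <= c * (b v - b u) &
    forall u v c, 0 <= u -> u <= v -> (forall s, u < s -> s <= v -> c <= z s) ->
      c * (b v - b u) <= J v - J u].
Proof.
pose J t := \int[mu]_(u in `]0, t]) z u.
have cstE u v c : 0 <= u -> u <= v ->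
    \int[mu]_(s in `]u, v]) (cst c s) = c * (b v - b u).
  move=> u0 uv; rewrite Rintegral_cst//.
  transitivity (c * fine (b v - b u)%:E) => //; congr (_ * fine _).
  exact: stieltjes_itv.
have JB u v : 0 <= u -> u <= v -> mu.-integrable `]u, v]%classic (EFin \o z) /\
    J v - J u = \int[mu]_(s in `]u, v]) z s.
  move=> u0 uv; have [iz _] := dct (le_trans u0 uv).
  have split : `]0, v]%classic = (`]0, u] `|` `]u, v])%classic.
    by rewrite -itv_bndbnd_setU//= bnd_simp.
  split.
    by apply: integrableS iz => //; rewrite split; exact: subsetUr.
  rewrite /J split Rintegral_setU//; first by rewrite addrAC subrr add0r.
    by rewrite -split.
  apply/disj_setPS => s [] /=; rewrite !in_itv/= => /andP[_ su] /andP[us _].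
  by move: us; rewrite ltNge su.
have icst u v (c : R) : 0 <= u -> u <= v -> mu.-integrable `]u, v]%classic (EFin \o cst c).
  move=> u0 uv; apply: measurable_bounded_integrable => //.
    apply: (@le_lt_trans _ _ (b v - b u)%:E); last exact: ltry.
    by rewrite -(stieltjes_itv u0 uv).
  by exists `|c|; split; [exact: num_real|move=> M cM s _; exact: ltW].
exists J; split.
- by rewrite /J set_itvoc0 Rintegral_set0.
- by move=> t t0; have [] := dct t0.
- move=> u v c u0 uv h; have [iz ->] := JB u v u0 uv; rewrite -(cstE u v c u0 uv).
  apply: le_Rintegral => //; first exact: icst.
  by move=> s /=; rewrite in_itv/= => /andP[]; exact: h.
- move=> u v c u0 uv h; have [iz ->] := JB u v u0 uv; rewrite -(cstE u v c u0 uv).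
  apply: le_Rintegral => //; first exact: icst.
  by move=> s /=; rewrite in_itv/= => /andP[]; exact: h.
Qed.

End stieltjes.

(** The two bounds on increments replace all further use of the measure: they
    give continuity, monotonicity and total variation of the integral. *)
Lemma stieltjes_cvg z b : cadlag_path z -> nondecreasing_path b ->
  (forall t, 0 <= t -> b s @[s --> t^'+] --> b t) ->
  exists J : R -> R,
  [/\ J 0 = 0,
    forall t, 0 <= t -> right_sum n z b t @[n --> \oo] --> J t,
    forall u v c, 0 <= u -> u <= v -> (forall s, u < s -> s <= v -> z s <= c) ->
      J v - J u <= c * (b v - b u) &
    forall u v c, 0 <= u -> u <= v -> (forall s, u < s -> s <= v -> c <= z s) ->
      c * (b v - b u) <= J v - J u].
Proof.
move=> cz nb cb; have [f fE] := cumulative_of_path nb cb.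
exact: stieltjes_cvg_cumulative cz fE.
Qed.

End paths.

(** * Continuous and cadlag paths *)

Section path_closure.
Context {R : realType}.
Implicit Types (x y : R -> R) (t : R).

Lemma continuous_pathP x : continuous_path x <->
  (forall t, 0 < t -> x s @[s --> t] --> x t) /\ x s @[s --> 0^'+] --> x 0.
Proof.
rewrite /continuous_path continuous_within_itvcyP.
split=> -[h ?]; split => // t t0; first by apply: h; rewrite in_itv/= andbT.
by apply: h; move: t0; rewrite in_itv/= andbT.
Qed.

Lemma continuous_path_cadlag x : continuous_path x -> cadlag_path x.
Proof.
move=> /continuous_pathP[h h0]; split=> t.
  rewrite le_eqVlt => /predU1P[<-//|t0].
  exact: cvg_within_filter (h t t0).
move=> t0; apply/cvg_ex; exists (x t); exact: cvg_within_filter (h t t0).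
Qed.

Lemma continuous_path_comp (g : R -> R) x : continuous_path x ->
  (forall t, 0 <= t -> {for x t, continuous g}) -> continuous_path (fun t => g (x t)).
Proof.
move=> /continuous_pathP[h h0] cg; apply/continuous_pathP; split.
  by move=> t t0; apply: (cvg_comp _ _ (h t t0)); apply: cg; exact: ltW.
by apply: (cvg_comp _ _ h0); exact: cg.
Qed.

Lemma continuous_pathD x y : continuous_path x -> continuous_path y ->
  continuous_path (fun t => x t + y t).
Proof.
move=> /continuous_pathP[h h0] /continuous_pathP[k k0]; apply/continuous_pathP; split.
  by move=> t t0; apply: cvgD; [exact: h|exact: k].
exact: cvgD.
Qed.

Lemma continuous_pathM x y : continuous_path x -> continuous_path y ->
  continuous_path (fun t => x t * y t).
Proof.
move=> /continuous_pathP[h h0] /continuous_pathP[k k0]; apply/continuous_pathP; split.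
  by move=> t t0; apply: cvgM; [exact: h|exact: k].
exact: cvgM.
Qed.

Lemma continuous_path_cst (c : R) : continuous_path (fun=> c).
Proof. by apply/continuous_pathP; split=> [t _|]; exact: cvg_cst. Qed.

Lemma continuous_pathZ (c : R) x (cx : continuous_path x) :
  continuous_path (fun t => c * x t).
Proof. by apply: continuous_pathM => //; exact: continuous_path_cst. Qed.

Lemma continuous_pathB x y : continuous_path x -> continuous_path y ->
  continuous_path (fun t => x t - y t).
Proof.
move=> cx cy; have := continuous_pathD cx (@continuous_pathZ (-1) _ cy).
by under eq_fun do rewrite mulN1r.
Qed.

Lemma eq_continuous_path x y : (forall t, 0 <= t -> x t = y t) ->
  continuous_path x -> continuous_path y.
Proof.
move=> xy; apply: subspace_eq_continuous => t.
by rewrite inE/= in_itv/= andbT; exact: xy.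
Qed.

Lemma cadlagD x y : cadlag_path x -> cadlag_path y -> cadlag_path (fun t => x t + y t).
Proof.
move=> [h1 h2] [k1 k2]; split=> t t0; first by apply: cvgD; [exact: h1|exact: k1].
by apply: is_cvgD; [exact: h2|exact: k2].
Qed.

Lemma cadlagM x y : cadlag_path x -> cadlag_path y -> cadlag_path (fun t => x t * y t).
Proof.
move=> [h1 h2] [k1 k2]; split=> t t0; first by apply: cvgM; [exact: h1|exact: k1].
by apply: is_cvgM; [exact: h2|exact: k2].
Qed.

Lemma cadlag_cst (c : R) : cadlag_path (fun=> c).
Proof. exact/continuous_path_cadlag/continuous_path_cst. Qed.

Lemma cadlagZ (c : R) x : cadlag_path x -> cadlag_path (fun t => c * x t).
Proof. by move=> cx; apply: cadlagM => //; exact: cadlag_cst. Qed.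

Lemma cadlagB x y : cadlag_path x -> cadlag_path y -> cadlag_path (fun t => x t - y t).
Proof.
move=> cx cy; have := cadlagD cx (@cadlagZ (-1) _ cy).
by under eq_fun do rewrite mulN1r.
Qed.

Lemma eq_cadlag x y : (forall t, 0 <= t -> x t = y t) -> cadlag_path x -> cadlag_path y.
Proof.
move=> xy [h1 h2]; split=> t t0.
  rewrite -xy//; apply: cvg_trans (h1 t t0); apply: near_eq_cvg.
  near=> s; apply: xy; apply: (le_trans t0); near: s; exact: nbhs_right_ge.
have /cvg_ex[l hl] := h2 t t0; apply/cvg_ex; exists l.
apply: cvg_trans hl; apply: near_eq_cvg; near=> s; apply: xy.
near: s; exact: nbhs_left_ge.
Unshelve. all: by end_near. Qed.

Lemma cadlag_norm x : cadlag_path x -> cadlag_path (fun t => `|x t|).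
Proof.
move=> [h1 h2]; split=> t t0; first by apply: cvg_norm; exact: h1.
by apply: is_cvg_norm; exact: h2.
Qed.

Lemma cadlag_stop x (r : R) : 0 <= r -> cadlag_path x ->
  cadlag_path (fun t => x (Num.min t r)).
Proof.
move=> r0 [h1 h2]; split=> t t0.
  have [rt|tr] := leP r t.
    apply: cvg_near_cst; near=> s; rewrite min_r//.
    apply: (le_trans rt); near: s; exact: nbhs_right_ge.
  apply: cvg_trans (h1 t t0); apply: near_eq_cvg.
  near=> s; rewrite min_l//; near: s; exact: nbhs_right_le.
have [tr|rt] := leP t r.
  have /cvg_ex[l hl] := h2 t t0; apply/cvg_ex; exists l.
  apply: cvg_trans hl; apply: near_eq_cvg; near=> s; rewrite min_l//.
  apply: (le_trans _ tr); near: s; exact: nbhs_left_le.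
apply/cvg_ex; exists (x r); apply: cvg_near_cst; near=> s; rewrite min_r//.
near: s; exact: nbhs_left_ge.
Unshelve. all: by end_near. Qed.

Lemma continuous_path_local x t (e : R) : continuous_path x -> 0 <= t -> 0 < e ->
  exists2 de, 0 < de & forall s, 0 <= s -> `|t - s| < de -> `|x t - x s| <= e.
Proof.
move=> /continuous_pathP[h h0] + e0; rewrite le_eqVlt => /predU1P[<-|t0].
  have [de /= de0 hd] := near_right h0 e0; exists de => // s; rewrite le_eqVlt.
  by move=> /predU1P[<-|s0] sd; [rewrite subrr normr0 ltW|exact: hd].
have /cvgrPdist_le/(_ e e0)[de /= de0 hd] := h t t0.
by exists de => // s _ sd; exact: hd.
Qed.

Lemma continuous_path_uniform x t (e : R) : continuous_path x -> 0 < e ->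
  exists2 de, 0 < de &
    forall s s', 0 <= s <= t -> 0 <= s' -> `|s - s'| < de -> `|x s - x s'| <= e.
Proof.
move=> cx e0; have /compact_near_coveringP := @segment_compact R 0 t.
pose Q (i s : R) := 0 <= s -> forall s', 0 <= s' -> `|s - s'| < i^-1 -> `|x s - x s'| <= e.
move=> /(_ R (+oo) Q _).
have h : forall s, `[0, t]%classic s -> \forall s1 \near s & i \near +oo, Q i s1.
  move=> s /=; rewrite in_itv/= => /andP[s0 _].
  have e20 : 0 < e / 2 by lra.
  have [de de0 hd] := continuous_path_local cx s0 e20.
  have d20 : 0 < de / 2 by lra.
  exists ([set s1 | `|s - s1| < de / 2], [set i : R | (de / 2)^-1 < i]) => /=.
    split; last by apply: nbhs_pinfty_gt; exact: num_real.
    by exists (de / 2).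
  case=> s1 i /= [h1 h2] s10 s' s'0 h3.
  have i0 : 0 < i by apply: lt_trans h2; rewrite invr_gt0.
  have h4 : i^-1 < de / 2 by rewrite -[ltRHS]invrK ltf_pV2// posrE// invr_gt0.
  have g1 : `|x s - x s1| <= e / 2 by apply: hd => //; lra.
  have g2 : `|x s - x s'| <= e / 2.
    apply: hd => //; apply: le_lt_trans (ler_distD s1 _ _) _; lra.
  by apply: le_trans (ler_distD (x s) _ _) _; rewrite distrC; lra.
move=> /(_ h) [M [_ hM]]; exists (Num.max (M + 1) 1)^-1.
  by rewrite invr_gt0 lt_max ltr01 orbT.
move=> s s' st s'0 ss'; have /andP[s0 _] := st.
apply: (hM (Num.max (M + 1) 1)) => //.
by rewrite lt_max ltrDl ltr01.
Qed.

End path_closure.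

(** * Stopping times and local martingales *)

Section stopping.
Context {R : realType} {d : measure_display} {T : measurableType d}.
Variables (P : probability T R) (F : R -> set_system T).
Hypothesis hF : usual_filtration P F.
Implicit Types (s t : R) (M N X Y Z : process R T) (tau sigma : T -> \bar R).

(** Written as a random time, the stopped process is X at time clock tau t; this
    avoids carrying the conversion from extended reals through every proof. *)
Definition clock tau t w : R := fine (Order.min t%:E (tau w)).

Lemma clock_cases tau w : (0 <= tau w)%E ->
  (exists r : R, [/\ 0 <= r, tau w = r%:E & forall t, clock tau t w = Num.min t r]) \/
  (tau w = +oo%E /\ forall t, clock tau t w = t).
Proof.
rewrite /clock; case: (tau w) => [r|_|//].
  by rewrite lee_fin => r0; left; exists r; split => // t; rewrite -EFin_min.
by right; split => // t; rewrite /Order.min ltey.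
Qed.

Lemma clock_ge0 tau t w : (0 <= tau w)%E -> 0 <= t -> 0 <= clock tau t w.
Proof.
by move=> /clock_cases[[r [r0 _ ->]]|[_ ->]] // t0; rewrite le_min t0.
Qed.

Lemma clock_le tau t w : (0 <= tau w)%E -> clock tau t w <= t.
Proof.
by move=> /clock_cases[[r [r0 _ ->]]|[_ ->]] //; rewrite ge_min lexx.
Qed.

Lemma clock_le_tau tau t w : (0 <= tau w)%E -> ((clock tau t w)%:E <= tau w)%E.
Proof.
move=> /clock_cases[[r [r0 -> ->]]|[-> _]]; last by rewrite leey.
by rewrite lee_fin ge_min lexx orbT.
Qed.

Lemma clock_id tau t w : (t%:E <= tau w)%E -> clock tau t w = t.
Proof. by move=> h; rewrite /clock min_l. Qed.

Lemma clock0 tau w : (0 <= tau w)%E -> clock tau 0 w = 0.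
Proof. by move=> h; rewrite clock_id. Qed.

Lemma clock_mono tau s t w : (0 <= tau w)%E -> s <= t -> clock tau s w <= clock tau t w.
Proof.
move=> /clock_cases[[r [r0 _ h]]|[_ h]] // st; rewrite !h//.
by rewrite le_min !ge_min st lexx orbT.
Qed.

Lemma stoppedE X tau t w : stopped X tau t w = X (clock tau t w) w.
Proof. by []. Qed.

Lemma clock_clock sigma tau t w : (0 <= sigma w)%E -> (0 <= tau w)%E ->
  clock sigma (clock tau t w) w = clock (fun w => Order.min (tau w) (sigma w)) t w.
Proof.
move=> s0 t0; rewrite {1 3}/clock minA; congr (fine (Order.min _ _)).
rewrite /clock fineK//; move: t0; case: (tau w) => [r|_|//].
  by rewrite -EFin_min.
by rewrite /Order.min ltey.
Qed.

Lemma right_sum_clock n X B tau t w : (0 <= tau w)%E -> 0 <= t ->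
  right_sum n (fun s => stopped X tau s w) (fun s => stopped B tau s w) t =
  right_sum n (X ^~ w) (B ^~ w) (clock tau t w).
Proof.
move=> /clock_cases[[r [r0 _ h]]|[_ h]] t0.
  rewrite h -right_sum_stop//; apply: eq_bigr => k _.
  by rewrite !stoppedE !h.
by rewrite h; apply: eq_bigr => k _; rewrite !stoppedE !h.
Qed.

Lemma stopped_cadlag X tau w : (0 <= tau w)%E -> cadlag_path (X ^~ w) ->
  cadlag_path (fun t => stopped X tau t w).
Proof.
move=> /clock_cases[[r [r0 _ h]]|[_ h]] cX.
  apply: (eq_cadlag _ (cadlag_stop r0 cX)) => t _; by rewrite stoppedE h.
by apply: (eq_cadlag _ cX) => t _; rewrite stoppedE h.
Qed.

Definition jump_process tau : process R T := fun t w => (tau w <= t%:E)%E%:R.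

(** The integral of X against d(jump_process tau) over ]0, t]; a jump at time 0 is
    not seen by the sums. *)
Definition value_at_jump X tau : process R T := fun t w =>
  if ((0 < tau w) && (tau w <= t%:E))%E then X (fine (tau w)) w else 0.

Lemma jump_process_adapted tau : stopping_time F tau -> adapted F (jump_process tau).
Proof.
move=> [_ st] t t0; have := measurable_wrt_indic hF t0 (st t t0).
rewrite (_ : (\1_ _ : T -> R) = jump_process tau t)//; apply/funext => w.
by rewrite indicE mem_setE.
Qed.

Lemma jump_process_bounded tau t w : 0 <= jump_process tau t w <= 1.
Proof. by rewrite /jump_process; case: (_ <= _)%E; rewrite ?lexx ?ler01. Qed.

Lemma jump_process_nondecreasing tau s t w : s <= t -> jump_process tau s w <= jump_process tau t w.
Proof.
move=> st; rewrite /jump_process ler_nat; case: (leP (tau w) s%:E) => [h|//].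
by rewrite (le_trans h) ?lee_fin.
Qed.

Lemma jump_process_cvg X tau w : (0 <= tau w)%E -> cadlag_path (X ^~ w) ->
  forall t, 0 <= t ->
  right_sum n (X ^~ w) (jump_process tau ^~ w) t @[n --> \oo] --> value_at_jump X tau t w.
Proof.
move=> t0 [rc _] t tt; rewrite /value_at_jump.
have [[r [r0 e _]]|[e _]] := clock_cases t0; rewrite e /=; last first.
  have e0 n : right_sum n (X ^~ w) (jump_process tau ^~ w) t = 0.
    by apply: big1 => k _; rewrite /jump_process e /= subrr mulr0.
  by rewrite leye_eq /= andbF; under eq_fun do rewrite e0; exact: cvg_cst.
have -> : (jump_process tau ^~ w) = jump r.
  by apply/funext => u; rewrite /jump_process /jump e lee_fin.
rewrite !lte_fin lee_fin; case: ifPn => [/andP[r1 r2]|h].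
  by apply: right_sum_jump_cvg => //; exact: rc.
by under eq_fun do rewrite right_sum_jump_far//; exact: cvg_cst.
Qed.

(** X^tau = X - (X B - X_0 B_0 - int X dB) for B the indicator of {tau <= t}:
    stopping is a case of integration by parts. *)
Lemma stopped_decomp X tau t w : (0 <= tau w)%E -> 0 <= t ->
  stopped X tau t w =
  X t w - (X t w * jump_process tau t w - X 0 w * jump_process tau 0 w - value_at_jump X tau t w).
Proof.
move=> t0 tt; rewrite stoppedE /jump_process /value_at_jump.
have [[r [r0 e ->]]|[e ->]] := clock_cases t0; rewrite e /=; last first.
  by rewrite !leye_eq /= ?andbF !mulr0 !subr0.
rewrite !lee_fin lte_fin; move: r0; rewrite le_eqVlt => /predU1P[<-|r0].
  by rewrite tt lexx ltxx /= min_r//; ring.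
rewrite (leNgt r 0) r0 /=; case: (leP r t) => rt /=; ring.
Qed.

Lemma stopped_adapted X tau : adapted F X -> {ae P, forall w, cadlag_path (X ^~ w)} ->
  stopping_time F tau -> adapted F (stopped X tau).
Proof.
move=> aX cX st t t0; have [tau0 _] := st.
have aj := jump_process_adapted st.
have mJ : measurable_wrt (F t) (value_at_jump X tau t).
  apply: (measurable_wrt_cvg hF t0 (f := fun n w => right_sum n (X ^~ w) (jump_process tau ^~ w) t)); last first.
    by apply: filterS cX => w cw; exact: jump_process_cvg.
  move=> n; apply: (measurable_wrt_sum hF t0 (f := fun k w => X (gridpt n t k.+1) w *
     (jump_process tau (gridpt n t k.+1) w - jump_process tau (gridpt n t k) w))) => k _.
  have g0 := gridpt_ge0 n k t0; have g1 := gridpt_ge0 n k.+1 t0.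
  apply: (measurable_wrtM hF t0); first by apply: (measurable_wrt_mono hF g1 (gridpt_le _ _ _)); exact: aX.
  apply: (measurable_wrtB hF t0); first by apply: (measurable_wrt_mono hF g1 (gridpt_le _ _ _)); exact: aj.
  by apply: (measurable_wrt_mono hF g0 (gridpt_le _ _ _)); exact: aj.
have -> : stopped X tau t = fun w =>
  X t w - (X t w * jump_process tau t w - X 0 w * jump_process tau 0 w - value_at_jump X tau t w).
  by apply/funext => w; exact: stopped_decomp.
have m0 : measurable_wrt (F t) (fun w => X 0 w * jump_process tau 0 w).
  by apply: (measurable_wrt_mono hF (lexx 0) t0); apply: (measurable_wrtM hF (lexx 0)); [exact: aX|exact: aj].
apply: (measurable_wrtB hF t0); first exact: aX.
apply: (measurable_wrtB hF t0) => //; apply: (measurable_wrtB hF t0) => //.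
by apply: (measurable_wrtM hF t0); [exact: aX|exact: aj].
Qed.

(** [integral_martingale] applied to the indicator of {tau <= t}. *)
Lemma optional_stopping M tau : martingale P F M ->
  {ae P, forall w, cadlag_path (M ^~ w)} -> stopping_time F tau ->
  martingale P F (stopped M tau).
Proof.
move=> mM cM st; have [tau0 _] := st.
have mI : martingale P F (fun t w => M t w * jump_process tau t w - M 0 w * jump_process tau 0 w - value_at_jump M tau t w).
  apply: (@integral_martingale _ _ _ P F hF M (jump_process tau) 1) => //.
  - exact: jump_process_adapted.
  - by move=> t w _; exact: jump_process_bounded.
  - by move=> s t w _; exact: jump_process_nondecreasing.
  - by move=> t t0; apply: filterS cM => w cw; exact: jump_process_cvg.
apply: (martingale_ae hF (martingaleB hF mM mI)) => t t0.
by apply: aeW => w; rewrite stopped_decomp.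
Qed.

Lemma stopping_time_min sigma tau : stopping_time F sigma -> stopping_time F tau ->
  stopping_time F (fun w => Order.min (sigma w) (tau w)).
Proof.
move=> [s0 hs] [t0 ht]; split=> [w|t tt]; first by rewrite le_min s0 t0.
have -> : [set w | (Order.min (sigma w) (tau w) <= t%:E)%E] =
  [set w | (sigma w <= t%:E)%E] `|` [set w | (tau w <= t%:E)%E].
  by apply/seteqP; split=> w /=; rewrite ge_min => /orP.
by apply: (filtrationU hF tt); [exact: hs|exact: ht].
Qed.

Definition localizing (tau : nat -> T -> \bar R) :=
  [/\ forall n, stopping_time F (tau n),
      {ae P, forall w, forall n, (tau n w <= tau n.+1 w)%E} &
      {ae P, forall w, tau n w @[n --> \oo] --> +oo%E}].

Lemma localizing_min (tau sigma : nat -> T -> \bar R) : localizing tau -> localizing sigma ->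
  localizing (fun n w => Order.min (tau n w) (sigma n w)).
Proof.
move=> [t1 t2 t3] [s1 s2 s3]; split.
- by move=> n; exact: stopping_time_min.
- apply: filterS2 t2 s2 => w h1 h2 n.
  by rewrite le_min !ge_min h1 h2 orbT.
- apply: filterS2 t3 s3 => w /cvgeyPge h1 /cvgeyPge h2; apply/cvgeyPge => A.
  by apply: filterS2 (h1 A) (h2 A) => n g1 g2; rewrite le_min g1.
Qed.

(** Local martingales with different localizing sequences can be localized
    together, since stopping once more preserves the martingale property. *)
Lemma local_martingale_stop M tau sigma :
  adapted F M -> {ae P, forall w, cadlag_path (M ^~ w)} ->
  stopping_time F tau -> stopping_time F sigma ->
  martingale P F (fun t w => stopped M tau t w - M 0 w) ->
  martingale P F (fun t w => stopped M (fun w => Order.min (tau w) (sigma w)) t w - M 0 w).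
Proof.
move=> aM cM st ss mM; have [t0 _] := st; have [s0 _] := ss.
have cy : {ae P, forall w, cadlag_path (fun t => stopped M tau t w - M 0 w)}.
  apply: filterS cM => w cw; apply: cadlagB; last exact: cadlag_cst.
  exact: stopped_cadlag.
apply: (martingale_ae hF (optional_stopping mM cy ss)) => t tt.
by apply: aeW => w; rewrite !stoppedE clock_clock// /clock [Order.min (sigma w) _]minC.
Qed.

Lemma local_martingaleI M (tau : nat -> T -> \bar R) : adapted F M -> {ae P, forall w, cadlag_path (M ^~ w)} ->
  localizing tau ->
  (forall n, martingale P F (fun t w => stopped M (tau n) t w - M 0 w)) ->
  local_martingale P F M.
Proof. by move=> aM cM [l1 l2 l3] h; split => //; exists tau; split. Qed.

Lemma local_martingaleD M N : local_martingale P F M -> local_martingale P F N ->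
  local_martingale P F (fun t w => M t w + N t w).
Proof.
move=> [aM cM [tau [t1 t2 t3 t4]]] [aN cN [sigma [s1 s2 s3 s4]]].
apply: (local_martingaleI (tau := fun n w => Order.min (tau n w) (sigma n w))).
- by move=> t t0; apply: (measurable_wrtD hF t0); [exact: aM|exact: aN].
- by apply: filterS2 cM cN => w; exact: cadlagD.
- exact: localizing_min.
move=> n; have m1 := local_martingale_stop aM cM (t1 n) (s1 n) (t4 n).
have m2 := local_martingale_stop aN cN (s1 n) (t1 n) (s4 n).
apply: (martingale_ae hF (martingaleD hF m1 m2)) => t t0; apply: aeW => w.
rewrite !stoppedE /clock (minC (sigma n w)).
by ring.
Qed.

Lemma local_martingaleZ (c : R) M : local_martingale P F M ->
  local_martingale P F (fun t w => c * M t w).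
Proof.
move=> [aM cM [tau [t1 t2 t3 t4]]]; apply: (local_martingaleI (tau := tau)) => //.
- by move=> t t0; apply: (measurable_wrtM hF t0); [exact: (measurable_wrt_cst hF t0)|exact: aM].
- by apply: filterS cM => w; exact: cadlagZ.
move=> n; apply: (martingale_ae hF (martingaleZ hF c (t4 n))) => t t0; apply: aeW => w.
by rewrite !stoppedE; ring.
Qed.

Lemma local_martingaleB M N : local_martingale P F M -> local_martingale P F N ->
  local_martingale P F (fun t w => M t w - N t w).
Proof.
move=> lM lN; have := local_martingaleD lM (local_martingaleZ (-1) lN).
by under eq_fun2 do rewrite mulN1r.
Qed.

Lemma local_martingale_indist M N : local_martingale P F M ->
  indistinguishable P M N -> local_martingale P F N.
Proof.
move=> [aM cM [tau [t1 t2 t3 t4]]] MN; apply: (local_martingaleI (tau := tau)) => //.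
- exact: (adapted_indist hF aM MN).
- apply: filterS2 cM MN => w cw h; exact: (eq_cadlag h cw).
move=> n; apply: (martingale_ae hF (t4 n)) => t t0; apply: filterS MN => w h.
rewrite !stoppedE !h//; apply: clock_ge0 => //.
by have [] := t1 n.
Qed.

Lemma martingale_local M : martingale P F M -> {ae P, forall w, cadlag_path (M ^~ w)} ->
  local_martingale P F M.
Proof.
move=> mM cM; have [aM iM cdM] := (martingaleP hF M).1 mM.
apply: (local_martingaleI (tau := fun _ _ => +oo%E)) => //.
  split.
  - move=> n; split=> [w|t t0]; first exact: leey.
    rewrite (_ : [set _ | _] = set0); first exact: (filtration0 hF t0).
    by apply/seteqP; split => w //=; rewrite leye_eq.
  - by apply: aeW => w n.
  - by apply: aeW => w; exact: cvg_cst.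
have c0 : martingale P F (fun=> M 0).
  apply/(martingaleP hF); split => // t t0; last exact: iM.
  by apply: (measurable_wrt_mono hF (lexx 0) t0); exact: aM.
move=> n; apply: (martingale_ae hF (martingaleB hF mM c0)) => t t0; apply: aeW => w.
by rewrite stoppedE clock_id// leey.
Qed.

Section hitting.
Variable G : process R T.
Hypothesis aG : adapted F G.
Hypothesis cG : forall w, continuous_path (G ^~ w).
Hypothesis nG : forall w, nondecreasing_path (G ^~ w).
Hypothesis G0 : forall w, G 0 w = 0.

(** For a continuous nondecreasing process the first time that level n is reached
    satisfies hitting n <= t iff n <= G_t, which makes it a stopping time. *)
Definition hitting (n : nat) w : \bar R :=
  ereal_inf [set t%:E | t in [set t | 0 <= t /\ n%:R <= G t w]].

Lemma hitting_ge0 n w : (0 <= hitting n w)%E.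
Proof. by apply: le_ereal_inf_tmp => _ [t [t0 _] <-]; rewrite lee_fin. Qed.

Lemma hittingP n w t : 0 <= t -> (hitting n w <= t%:E)%E = (n%:R <= G t w).
Proof.
move=> t0; apply/idP/idP => h; last by apply: ereal_inf_lbound; exists t.
rewrite leNgt; apply/negP => Gt.
have e0 : 0 < (n%:R - G t w) / 2 by rewrite divr_gt0 ?subr_gt0.
have [de de0 hd] := continuous_path_local (@cG w) t0 e0.
have : ((t + de / 2)%:E <= hitting n w)%E.
  apply: le_ereal_inf_tmp => _ [u [u0 Gu] <-]; rewrite lee_fin leNgt; apply/negP => ut.
  have := Gu; rewrite leNgt => /negP; apply.
  have [ule|utt] := leP u t; first exact: le_lt_trans (nG w u0 ule) Gt.
  have : `|G t w - G u w| <= (n%:R - G t w) / 2 by apply: hd => //; rewrite ltr0_norm; lra.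
  rewrite ler_norml => /andP[h1 h2]; lra.
by move=> /le_trans/(_ h); rewrite lee_fin leNgt => /negP; apply; lra.
Qed.

Lemma hitting_stopping n : stopping_time F (hitting n).
Proof.
split=> [w|t t0]; first exact: hitting_ge0.
have -> : [set w | (hitting n w <= t%:E)%E] = G t @^-1` `[n%:R, +oo[.
  by apply/seteqP; split=> w /=; rewrite hittingP// in_itv/= andbT.
exact: aG.
Qed.

Lemma hitting_localizing : localizing hitting.
Proof.
split; first exact: hitting_stopping.
- apply: aeW => w n; apply: ereal_inf_le_tmp => _ [t [t0 h] <-]; exists t => //; split => //.
  by apply: le_trans h; rewrite ler_nat.
- apply: aeW => w; apply/cvgeyPge => A; pose A' := Num.max A 0.
  have A0 : 0 <= A' by rewrite le_max lexx orbT.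
  near=> n; apply: (@le_trans _ _ A'%:E); first by rewrite lee_fin le_max lexx.
  rewrite leNgt; apply/negP => /ltW; rewrite hittingP// leNgt => /negP; apply.
  near: n; exact: nbhs_infty_gtr.
Unshelve. all: by end_near. Qed.

(** By left-continuity the level is not exceeded at the hitting time itself. *)
Lemma hitting_bound n t w : 0 <= t -> 0 <= stopped G (hitting n) t w <= n%:R.
Proof.
move=> t0; rewrite stoppedE.
have u0 := clock_ge0 (hitting_ge0 n w) t0.
apply/andP; split; first by rewrite -(G0 w); exact: nG.
have := clock_le_tau t (hitting_ge0 n w).
move: (clock _ _ _) u0 => u u0 hu; rewrite leNgt; apply/negP => Gu.
have e0 : 0 < (G u w - n%:R) / 2 by rewrite divr_gt0 ?subr_gt0.
have up : 0 < u.
  rewrite lt_neqAle u0 andbT; apply/negP => /eqP u00.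
  by move: Gu; rewrite -u00 G0 ltNge ler0n.
have [de de0 hd] := continuous_path_local (@cG w) u0 e0.
pose v := Num.max 0 (u - de / 2).
have v0 : 0 <= v by rewrite le_max lexx.
have vu : v < u by rewrite gt_max up /=; lra.
have : n%:R <= G v w.
  have : `|G u w - G v w| <= (G u w - n%:R) / 2.
    apply: hd => //; rewrite gtr0_norm ?subr_gt0// ltrBlDr -ltrBlDl lt_max.
    by apply/orP; right; lra.
  rewrite ler_norml => /andP[h1 h2]; lra.
by rewrite -hittingP// => /(le_trans hu); rewrite lee_fin leNgt vu.
Qed.

End hitting.
End stopping.

(** * The path integral as a limit of right sums *)

Section path_integral.
Context {R : realType}.
Implicit Types (z a b x : R -> R) (t u v : R).

(** Defined as a limit rather than as a Lebesgue-Stieltjes integral, so that its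
    measurability in a random parameter is immediate. *)
Definition path_integral z b t : R := lim (right_sum n z b t @[n --> \oo]).

Lemma right_sumD n z1 z2 b t : right_sum n (fun s => z1 s + z2 s) b t = right_sum n z1 b t + right_sum n z2 b t.
Proof. by rewrite /right_sum -big_split /=; apply: eq_bigr => k _; rewrite mulrDl. Qed.

Lemma right_sumB n z1 z2 b t : right_sum n (fun s => z1 s - z2 s) b t = right_sum n z1 b t - right_sum n z2 b t.
Proof. by rewrite /right_sum -sumrB; apply: eq_bigr => k _; rewrite mulrBl. Qed.

Lemma right_sum_cst n (c : R) b t : 0 <= t -> t <= n.+1%:R ->
  right_sum n (fun=> c) b t = c * (b t - b 0).
Proof.
move=> t0 tn; rewrite /right_sum -mulr_sumr.
have := telescope_sumr (fun k => b (gridpt n t k)) (leq0n (n.+1 * n.+1)).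
by rewrite big_mkord => ->; rewrite gridpt_last// gridpt0.
Qed.

Lemma right_sum_cst_cvg (c : R) b t : 0 <= t ->
  right_sum n (fun=> c) b t @[n --> \oo] --> c * (b t - b 0).
Proof.
move=> t0; apply: cvg_near_cst; near=> n.
rewrite right_sum_cst//; apply: (@le_trans _ _ n%:R); last by rewrite ler_nat.
near: n; exact: nbhs_infty_ger.
Unshelve. all: by end_near. Qed.

Definition integrator_path b :=
  [/\ continuous_path b, nondecreasing_path b & b 0 = 0].

Section spec.
Variable b : R -> R.
Hypothesis hb : integrator_path b.

Let bspec z : cadlag_path z -> exists J : R -> R,
  [/\ forall t, 0 <= t -> path_integral z b t = J t, J 0 = 0,
    forall t, 0 <= t -> right_sum n z b t @[n --> \oo] --> J t,
    forall u v c, 0 <= u -> u <= v -> (forall s, u < s -> s <= v -> z s <= c) ->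
      J v - J u <= c * (b v - b u) &
    forall u v c, 0 <= u -> u <= v -> (forall s, u < s -> s <= v -> c <= z s) ->
      c * (b v - b u) <= J v - J u].
Proof.
case: hb => cb nb _ cz.
have [|J [J0 Jc Jub Jlb]] := stieltjes_cvg cz nb.
  by have [] := continuous_path_cadlag cb.
by exists J; split => // t t0; apply/cvg_lim => //; exact: Jc.
Qed.

Lemma path_integral_cvg z t : cadlag_path z -> 0 <= t ->
  right_sum n z b t @[n --> \oo] --> path_integral z b t.
Proof. by move=> /bspec[J [e _ c _ _]] t0; rewrite e//; exact: c. Qed.

Lemma path_integral0 z : cadlag_path z -> path_integral z b 0 = 0.
Proof. by move=> /bspec[J [e e0 c _ _]]; rewrite e. Qed.

Lemma path_integral_ub z u v c : cadlag_path z -> 0 <= u -> u <= v ->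
  (forall s, u < s -> s <= v -> z s <= c) ->
  path_integral z b v - path_integral z b u <= c * (b v - b u).
Proof.
by move=> /bspec[J [e _ _ h _]] u0 uv zc; rewrite !e ?(le_trans u0)//; exact: h.
Qed.

Lemma path_integral_lb z u v c : cadlag_path z -> 0 <= u -> u <= v ->
  (forall s, u < s -> s <= v -> c <= z s) ->
  c * (b v - b u) <= path_integral z b v - path_integral z b u.
Proof.
by move=> /bspec[J [e _ _ _ h]] u0 uv zc; rewrite !e ?(le_trans u0)//; exact: h.
Qed.

Lemma path_integral_uniq z t l : cadlag_path z -> 0 <= t ->
  right_sum n z b t @[n --> \oo] --> l -> path_integral z b t = l.
Proof.
move=> cz t0 h; apply/cvg_lim => //.
Qed.

Lemma path_integralD z1 z2 t : cadlag_path z1 -> cadlag_path z2 -> 0 <= t ->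
  path_integral (fun s => z1 s + z2 s) b t = path_integral z1 b t + path_integral z2 b t.
Proof.
move=> c1 c2 t0; apply: path_integral_uniq => //; first exact: cadlagD.
under eq_fun do rewrite right_sumD.
by apply: cvgD; exact: path_integral_cvg.
Qed.

Lemma path_integralB z1 z2 t : cadlag_path z1 -> cadlag_path z2 -> 0 <= t ->
  path_integral (fun s => z1 s - z2 s) b t = path_integral z1 b t - path_integral z2 b t.
Proof.
move=> c1 c2 t0; apply: path_integral_uniq => //; first exact: cadlagB.
under eq_fun do rewrite right_sumB.
by apply: cvgB; exact: path_integral_cvg.
Qed.

Lemma path_integral_dist z u v M : cadlag_path z -> 0 <= u -> u <= v ->
  (forall s, u < s -> s <= v -> `|z s| <= M) ->
  `|path_integral z b v - path_integral z b u| <= M * (b v - b u).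
Proof.
move=> cz u0 uv zM; rewrite ler_norml -mulNr; apply/andP; split.
  by apply: path_integral_lb => // s us sv; have := zM s us sv; rewrite ler_norml => /andP[].
by apply: path_integral_ub => // s us sv; have := zM s us sv; rewrite ler_norml => /andP[].
Qed.

Lemma path_integral_nd z : cadlag_path z -> (forall s, 0 <= s -> 0 <= z s) ->
  nondecreasing_path (path_integral z b).
Proof.
move=> cz z0 u v u0 uv; rewrite -subr_ge0 -(mul0r (b v - b u)).
by apply: path_integral_lb => // s us _; apply: z0; exact: le_trans u0 (ltW us).
Qed.

(** Locally the integral is Lipschitz in the integrator, because a cadlag
    integrand is locally bounded. *)
Lemma path_integral_continuous z : cadlag_path z -> continuous_path (path_integral z b).
Proof.
move=> cz; have [cb nb b0] := hb.
have key t0 : 0 <= t0 -> exists2 M, 0 <= M & forall u, 0 <= u -> u <= t0 + 1 ->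
    `|path_integral z b t0 - path_integral z b u| <= M * `|b t0 - b u|.
  move=> tt0; have [M hM] := cadlag_bounded (t0 + 1) cz.
  exists M; first by apply: le_trans (hM 0 _); rewrite // lexx addr_ge0.
  move=> u u0 ut; have [h|h] := leP u t0.
    rewrite (ger0_norm (x := b _ - _)) ?subr_ge0 ?nb//.
    apply: path_integral_dist => // s us st; apply: hM; rewrite (le_trans u0 (ltW us))/=.
    by apply: le_trans st _; rewrite lerDl.
  rewrite distrC (distrC (b _)) (ger0_norm (x := b _ - _)) ?subr_ge0 ?nb ?(ltW h)//.
  apply: path_integral_dist => //; first exact: ltW.
  by move=> s us st; apply: hM; rewrite (le_trans tt0 (ltW us))/= (le_trans st).
have lc t0 e : 0 <= t0 -> 0 < e -> exists2 de, 0 < de & forall s, 0 <= s -> `|t0 - s| < de ->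
    `|path_integral z b t0 - path_integral z b s| <= e.
  move=> tt0 e0; have [M M0 hM] := key t0 tt0.
  have e10 : 0 < e / (M + 1) by rewrite divr_gt0// ltr_wpDl.
  have [de de0 hd] := continuous_path_local cb tt0 e10.
  exists (Num.min de 1); first by rewrite lt_min de0 ltr01.
  move=> s s0; rewrite lt_min => /andP[sd s1].
  apply: le_trans (hM s s0 _) _.
    by move: s1; rewrite ltr_norml => /andP[? ?]; lra.
  apply: (@le_trans _ _ (M * (e / (M + 1)))); first by rewrite ler_wpM2l// hd.
  rewrite mulrCA ler_piMr ?(ltW e0)// ler_pdivrMr ?ltr_wpDl//; lra.
apply/continuous_pathP; split=> [t t0|].
  apply/cvgrPdist_le => e e0; have [de de0 hd] := lc t e (ltW t0) e0.
  near=> s; apply: hd.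
    by near: s; exists t => // s /=; rewrite ltr_norml => /andP[? ?]; lra.
  by near: s; exists de.
apply/cvgrPdist_le => e e0; have [de de0 hd] := lc 0 e (lexx 0) e0.
rewrite near_withinE; near=> s => s0; apply: hd; first exact: ltW.
by near: s; exists de.
Unshelve. all: by end_near. Qed.

(** The integral of |z| dominates the variation of the integral of z: both
    |z| - z and |z| + z have nondecreasing integrals. *)
Lemma path_integral_norm z u v : cadlag_path z -> 0 <= u -> u <= v ->
  `|path_integral z b v - path_integral z b u| <=
  path_integral (fun s => `|z s|) b v - path_integral (fun s => `|z s|) b u.
Proof.
move=> cz u0 uv; have v0 := le_trans u0 uv; have cn := cadlag_norm cz.
have h1 : nondecreasing_path (path_integral (fun s => `|z s| - z s) b).
  apply: path_integral_nd; first exact: cadlagB.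
  by move=> s _; rewrite subr_ge0 ler_norm.
have h2 : nondecreasing_path (path_integral (fun s => `|z s| + z s) b).
  apply: path_integral_nd; first exact: cadlagD.
  by move=> s _; rewrite -lerBlDr sub0r -normrN ler_norm.
have := h1 u v u0 uv; rewrite !path_integralB// => g1.
have := h2 u v u0 uv; rewrite !path_integralD// => g2.
by rewrite ler_norml; apply/andP; split; lra.
Qed.

End spec.

(** If a moves only where the continuous W is zero, then int W da = 0, in a
    discretized form with a second-order error.  On a small grid interval, either
    W is small or W has no zero there and a is constant. *)
Lemma flat_sum a (W : R -> R) (C : R) t (e : nat -> nat -> R) :
  0 <= t -> continuous_path a -> nondecreasing_path a -> continuous_path W ->
  (forall u v, 0 <= u -> u <= v -> v <= t -> (forall s, u <= s <= v -> W s != 0) -> a u = a v) ->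
  0 <= C ->
  (forall n k, `|e n k| <= C * (`|W (gridpt n t k.+1)| * (a (gridpt n t k.+1) - a (gridpt n t k))
     + (a (gridpt n t k.+1) - a (gridpt n t k)) ^+ 2)) ->
  \sum_(k < n.+1 * n.+1) e n k @[n --> \oo] --> (0 : R).
Proof.
move=> t0 ca na cW fl C0 he; apply/cvgrPdist_le => eps eps0.
pose V := a t - a 0.
have V0 : 0 <= V by rewrite subr_ge0; exact: na.
(* each term will be at most (C + 1) * 3h * da: 2h from W and h from the square *)
pose K := 3 * (C + 1) * (V + 1).
have K0 : 0 < K by rewrite !mulr_gt0// ltr_wpDl.
pose h := eps / K.
have h0 : 0 < h by exact: divr_gt0.
have [d1 d10 hd1] := @continuous_path_uniform _ _ t _ cW h0.
have [d2 d20 hd2] := @continuous_path_uniform _ _ t _ ca h0.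
near=> n; rewrite sub0r normrN.
have nd : n.+1%:R^-1 < Num.min d1 d2.
  have d0 : 0 < Num.min d1 d2 by rewrite lt_min d10.
  rewrite -[ltRHS]invrK ltf_pV2 ?posrE ?invr_gt0//.
  apply: (@lt_le_trans _ _ n%:R); last by rewrite ler_nat.
  near: n; exact: nbhs_infty_gtr.
have ek k : `|e n k| <= (C + 1) * (3 * h) * (a (gridpt n t k.+1) - a (gridpt n t k)).
  have g0 := gridpt_ge0 n k t0; have g1 := gridpt_ge0 n k.+1 t0.
  have gm := gridpt_mono n t k; have gl := gridpt_le n t k.+1; have gs := gridpt_step n t k.
  move: (he n k) (na _ _ g0 gm).
  move: (gridpt n t k) (gridpt n t k.+1) g0 g1 gm gl gs => p q p0 q0 pq qt pqn.
  move: nd; rewrite lt_min => /andP[n1 n2].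
  have aq : `|a q - a p| <= h.
    by apply: hd2 => //; [rewrite q0|rewrite ger0_norm ?subr_ge0//; exact: le_lt_trans n2].
  move=> hek; rewrite -subr_ge0 => da0; apply: le_trans hek _.
  rewrite -mulrA; set da := a q - a p in aq da0 *.
  have da1 : da <= h by apply: le_trans aq; rewrite ler_norm.
  have w : `|W q| * da <= 2 * h * da.
    have [wq|wq] := leP `|W q| (2 * h); first by rewrite ler_wpM2r.
    suff -> : da = 0 by rewrite !mulr0.
    apply/eqP; rewrite subr_eq0; apply/eqP/esym; apply: fl => // s /andP[ps sq].
    have : `|W q - W s| <= h.
      apply: hd1; rewrite ?q0 ?(le_trans p0 ps)// ger0_norm ?subr_ge0//.
      by apply: le_lt_trans n1; apply: le_trans pqn; rewrite lerD2l lerN2.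
    move=> ws; apply/negP => /eqP Ws0; move: ws; rewrite Ws0 subr0; lra.
  have sq : da ^+ 2 <= h * da by rewrite expr2 ler_wpM2r.
  have : C * (`|W q| * da + da ^+ 2) <= C * (3 * h * da) by apply: ler_wpM2l => //; lra.
  move/le_trans; apply; apply: ler_wpM2r; last by lra.
  by rewrite mulr_ge0// mulr_ge0// ltW.
apply: le_trans (ler_norm_sum _ _ _) _.
apply: (@le_trans _ _ (\sum_(k < n.+1 * n.+1) (C + 1) * (3 * h) * (a (gridpt n t k.+1) - a (gridpt n t k)))).
  by apply: ler_sum => k _; exact: ek.
rewrite -mulr_sumr.
have := telescope_sumr (fun k => a (gridpt n t k)) (leq0n (n.+1 * n.+1)).
rewrite big_mkord => ->; rewrite gridpt0//.
(* for small n the grid may stop before t; monotonicity of a is enough *)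
have gV : a (gridpt n t (n.+1 * n.+1)) - a 0 <= V + 1.
  have := na _ _ (gridpt_ge0 n (n.+1 * n.+1) t0) (gridpt_le n t (n.+1 * n.+1)); rewrite /V; lra.
have c0 : 0 <= (C + 1) * (3 * h) by apply: mulr_ge0; lra.
apply: le_trans (ler_wpM2l c0 gV) _.
rewrite /h; have -> : (C + 1) * (3 * (eps / K)) * (V + 1) = eps * (K / K) by rewrite /K; ring.
by rewrite divff ?mulr1// gt_eqF.
Unshelve. all: by end_near. Qed.

End path_integral.

(** * Integration by parts and continuous local martingales of finite variation *)

Section parts.
Context {R : realType} {d : measure_display} {T : measurableType d}.
Variables (P : probability T R) (F : R -> set_system T).
Hypothesis hF : usual_filtration P F.
Implicit Types (s t : R) (M N X Y Z A B G : process R T).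

Definition integrator B := adapted F B /\ forall w, integrator_path (B ^~ w).

(** Passing to a modification whose paths are good without exception lets hitting
    times be defined everywhere. *)
Lemma regularize A : adapted F A -> {ae P, forall w, continuous_path (A ^~ w)} ->
  {ae P, forall w, nondecreasing_path (A ^~ w)} -> {ae P, forall w, A 0 w = 0} ->
  exists2 B, integrator B & indistinguishable P A B.
Proof.
move=> aA cA nA A0; pose B t w := if `[< integrator_path (A ^~ w) >] then A t w else 0.
have AB : indistinguishable P A B.
  apply: filterS3 cA nA A0 => w h1 h2 h3 t t0; rewrite /B ifT//.
  by apply/asboolP; split.
exists B => //; split; first exact: (adapted_indist hF aA AB).
move=> w; rewrite /B; case: asboolP => // _; split => //.
exact: continuous_path_cst.
Qed.

Lemma integratorD B1 B2 : integrator B1 -> integrator B2 ->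
  integrator (fun t w => B1 t w + B2 t w).
Proof.
move=> [a1 h1] [a2 h2]; split.
  by move=> t t0; apply: (measurable_wrtD hF t0); [exact: a1|exact: a2].
move=> w; have [c1 n1 z1] := h1 w; have [c2 n2 z2] := h2 w; split.
- exact: continuous_pathD.
- by move=> s t s0 st; apply: lerD; [exact: n1|exact: n2].
- by rewrite z1 z2 addr0.
Qed.

Definition integral_process Y B : process R T := fun t w => path_integral (Y ^~ w) (B ^~ w) t.

Lemma integral_process_adapted Y B : adapted F Y -> {ae P, forall w, cadlag_path (Y ^~ w)} ->
  integrator B -> adapted F (integral_process Y B).
Proof.
move=> aY cY [aB hB] t t0.
apply: (measurable_wrt_cvg hF t0 (f := fun n w => right_sum n (Y ^~ w) (B ^~ w) t)); last first.
  by apply: filterS cY => w cw; exact: path_integral_cvg.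
move=> n; apply: (measurable_wrt_sum hF t0 (f := fun k w => Y (gridpt n t k.+1) w *
   (B (gridpt n t k.+1) w - B (gridpt n t k) w))) => k _.
have g0 := gridpt_ge0 n k t0; have g1 := gridpt_ge0 n k.+1 t0.
apply: (measurable_wrtM hF t0); first by apply: (measurable_wrt_mono hF g1 (gridpt_le _ _ _)); exact: aY.
apply: (measurable_wrtB hF t0); first by apply: (measurable_wrt_mono hF g1 (gridpt_le _ _ _)); exact: aB.
by apply: (measurable_wrt_mono hF g0 (gridpt_le _ _ _)); exact: aB.
Qed.

Lemma clock_min_le (sigma tau : T -> \bar R) t w : (0 <= sigma w)%E -> (0 <= tau w)%E ->
  clock (fun w => Order.min (tau w) (sigma w)) t w <= clock sigma t w.
Proof.
move=> s0 t0; rewrite -clock_clock//.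
by apply: clock_mono => //; exact: clock_le.
Qed.

(** Localize by the times of Y and the times at which B reaches the levels n.
    The stopped processes satisfy [integral_martingale] with y = Y^rho - Y_0 and
    b = B^rho <= n; subtracting Y_0, which need not be integrable, changes nothing
    in the end, since Y_0 B - int Y_0 dB = 0. *)
Lemma integration_by_parts Y B : local_martingale P F Y -> integrator B ->
  local_martingale P F (fun t w => Y t w * B t w - integral_process Y B t w).
Proof.
move=> [aY cY [tau [t1 t2 t3 t4]]] iB; have [aB hB] := iB.
have cB w : continuous_path (B ^~ w) by have [] := hB w.
have nB w : nondecreasing_path (B ^~ w) by have [] := hB w.
have B0 w : B 0 w = 0 by have [] := hB w.
have hl := hitting_localizing P aB cB nB.
have [s1 _ _] := hl.
pose rho n w := Order.min (tau n w) (hitting B n w).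
have lrho : localizing P F rho by apply: (localizing_min hF) => //; split.
have [r1 _ _] := lrho.
have aJ := integral_process_adapted aY cY iB.
apply: (local_martingaleI (tau := rho) _ _ lrho).
- by move=> t t0; apply: (measurable_wrtB hF t0); [apply: (measurable_wrtM hF t0); [exact: aY|exact: aB]|exact: aJ].
- apply: filterS cY => w cw; apply: cadlagB.
    by apply: cadlagM => //; exact: continuous_path_cadlag.
  by apply: continuous_path_cadlag; exact: path_integral_continuous.
move=> n; have [rho0 _] := r1 n; have [tau0 _] := t1 n.
pose y t w := stopped Y (rho n) t w - Y 0 w.
have my : martingale P F y by apply: (local_martingale_stop hF).
pose b := stopped B (rho n).
have bE t w : b t w = B (clock (rho n) t w) w by [].
have ab : adapted F b.
  by apply: (stopped_adapted hF) => //; apply: aeW => w; exact: continuous_path_cadlag.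
have bnd t w : 0 <= t -> 0 <= b t w <= n%:R.
  move=> t0; have c0 := clock_ge0 (rho0 w) t0.
  rewrite bE -{1}(B0 w) nB//=.
  have /andP[_] := hitting_bound cB nB B0 n w t0.
  apply: le_trans; rewrite stoppedE; apply: nB => //.
  by apply: clock_min_le => //; exact: hitting_ge0.
have bnd' s t w : 0 <= s -> s <= t -> b s w <= b t w.
  move=> s0 st; rewrite !bE; apply: nB; first exact: clock_ge0.
  exact: clock_mono.
pose J t w := integral_process Y B (clock (rho n) t w) w - Y 0 w * (b t w - b 0 w).
have cJ t : 0 <= t -> {ae P, forall w, right_sum m (y ^~ w) (b ^~ w) t @[m --> \oo] --> J t w}.
  move=> t0; apply: filterS cY => w cw.
  under eq_fun do rewrite (right_sumB _ (stopped Y (rho n) ^~ w) (fun=> Y 0 w)).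
  apply: cvgB; last exact: right_sum_cst_cvg.
  under eq_fun do rewrite right_sum_clock//.
  by apply: path_integral_cvg => //; exact: clock_ge0.
have := integral_martingale hF my ab bnd bnd' cJ.
move/(martingale_ae hF); apply=> t t0; apply: filterS cY => w cw.
have c0 : clock (rho n) 0 w = 0 by exact: clock0.
have s0 : integral_process Y B 0 w = 0 by exact: path_integral0.
rewrite /J /y !bE !stoppedE c0 B0 s0.
by ring.
Qed.

Lemma clock_gridpt (tau : T -> \bar R) n t k w : (0 <= tau w)%E ->
  clock tau (gridpt n t k) w = gridpt n (clock tau t w) k.
Proof.
move=> /clock_cases[[r [r0 _ h]]|[_ h]]; rewrite !h//.
by rewrite gridpt_min.
Qed.

Lemma left_sum_square n (u : R -> R) t : 0 <= t -> t <= n.+1%:R ->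
  u t ^+ 2 - u 0 ^+ 2 = 2 * left_sum n u u t +
    \sum_(k < n.+1 * n.+1) (u (gridpt n t k.+1) - u (gridpt n t k)) ^+ 2.
Proof.
move=> t0 tn; rewrite mulr2n mulrDl !mul1r {1}abel_summation// -addrA -big_split /=.
rewrite !expr2; set r := right_sum _ _ _ _; rewrite (_ : \sum_(_ < _) _ = r) ?subrK//.
by apply: eq_bigr => k _; ring.
Qed.

Lemma path_eq0_of_rationals (x : R -> R) : continuous_path x ->
  (forall m k, x (k%:R / m.+1%:R) = 0) -> forall t, 0 <= t -> x t = 0.
Proof.
move=> cx h t t0; apply/eqP; rewrite -normr_le0; apply/ler_addgt0Pl => e e0; rewrite addr0.
have [de de0 hd] := continuous_path_local cx t0 e0.
pose m := Num.truncn de^-1; pose k := Num.truncn (t * m.+1%:R).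
have m0 : 0 < m.+1%:R :> R by rewrite ltr0Sn.
have -> : x t = x t - x (k%:R / m.+1%:R) by rewrite h subr0.
apply: hd; first by rewrite divr_ge0.
have tm0 : 0 <= t * m.+1%:R by rewrite mulr_ge0.
have /andP[k1 k2] := truncn_itv tm0.
have mde : m.+1%:R^-1 < de.
  by rewrite -[ltRHS]invrK ltf_pV2 ?posrE ?invr_gt0// truncnS_gt.
have h1 : k%:R / m.+1%:R <= t by rewrite ler_pdivrMr.
have h2 : t < k%:R / m.+1%:R + m.+1%:R^-1.
  by rewrite -[X in _ + X]mul1r -mulrDl natr1 ltr_pdivlMr.
rewrite ger0_norm; last by rewrite subr_ge0.
by rewrite ltrBlDl (lt_trans h2)// ltrD2l.
Qed.

(** For a bounded martingale u with u_0 = 0, E[u_t^2] is the expectation of the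
    sum of the squared increments of u along a grid, because [left_sum] of u
    against itself has mean zero.  When u is continuous and of bounded variation
    this sum is bounded and tends to 0.  The variation is bounded after stopping
    when G1 + G2 reaches level n. *)
Lemma fv_local_martingale0 U G1 G2 : local_martingale P F U ->
  integrator G1 -> integrator G2 ->
  indistinguishable P U (fun t w => G1 t w - G2 t w) ->
  {ae P, forall w, forall t, 0 <= t -> U t w = 0}.
Proof.
move=> lU i1 i2 UG; pose V t w := G1 t w - G2 t w.
have [_ hG1] := i1; have [_ hG2] := i2.
have [aG hG] := integratorD i1 i2; set G : process R T := fun t w => _ in aG hG.
have cG w : continuous_path (G ^~ w) by have [] := hG w.
have nG w : nondecreasing_path (G ^~ w) by have [] := hG w.
have G0 w : G 0 w = 0 by have [] := hG w.
have cV w : continuous_path (V ^~ w).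
  by have [? _ _] := hG1 w; have [? _ _] := hG2 w; exact: continuous_pathB.
have V0 w : V 0 w = 0 by have [_ _ e1] := hG1 w; have [_ _ e2] := hG2 w; rewrite /V e1 e2 subr0.
have VG w u v : 0 <= u -> u <= v -> `|V v w - V u w| <= G v w - G u w.
  move=> u0 uv; have [_ n1 _] := hG1 w; have [_ n2 _] := hG2 w.
  have := n1 u v u0 uv; have := n2 u v u0 uv; rewrite /V /G => ? ?.
  by rewrite ler_norml; apply/andP; split; lra.
have [aV cVae [tau [t1 t2 t3 t4]]] := local_martingale_indist hF lU UG.
have hl := hitting_localizing P aG cG nG.
have [s1 _ _] := hl.
pose rho n w := Order.min (tau n w) (hitting G n w).
have lrho : localizing P F rho by apply: (localizing_min hF) => //; split.
have [r1 _ r3] := lrho.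
have zero n t : 0 <= t -> {ae P, forall w, stopped V (rho n) t w = 0}.
  move=> t0; have [rho0 _] := r1 n; have [tau0 _] := t1 n.
  pose u := stopped V (rho n).
  have uE s w : u s w = V (clock (rho n) s w) w by [].
  have mu : martingale P F u.
    have mu' := local_martingale_stop hF aV cVae (t1 n) (s1 n) (t4 n).
    apply: (martingale_ae hF mu') => s s0; apply: aeW => w.
    by rewrite -/(V 0 w) V0 subr0.
  have Gn s w : 0 <= s -> 0 <= G (clock (rho n) s w) w <= n%:R.
    move=> s0; have c0 := clock_ge0 (rho0 w) s0.
    rewrite -{1}(G0 w) nG//=.
    have /andP[_] := hitting_bound cG nG G0 n w s0.
    apply: le_trans; rewrite stoppedE; apply: nG => //.
    by apply: clock_min_le => //; exact: hitting_ge0.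
  have un s w : 0 <= s -> `|u s w| <= n%:R.
    move=> s0; have c0 := clock_ge0 (rho0 w) s0.
    have /andP[_] := Gn s w s0; apply: le_trans.
    by have := VG w 0 _ (lexx 0) c0; rewrite V0 G0 !subr0.
  have [au iu _] := (martingaleP hF u).1 mu.
  have mut : measurable_fun setT (u t) by exact: (measurable_wrt_fun hF t0 (au t t0)).
  pose q m w := \sum_(k < m.+1 * m.+1) (u (gridpt m t k.+1) w - u (gridpt m t k) w) ^+ 2.
  have mq m : measurable_fun setT (q m).
    apply: (measurable_wrt_fun hF t0); apply: (measurable_wrt_sum hF t0 (f := fun k w =>
      (u (gridpt m t k.+1) w - u (gridpt m t k) w) ^+ 2)) => k _.
    have g0 := gridpt_ge0 m k t0; have g1 := gridpt_ge0 m k.+1 t0.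
    have mw : measurable_wrt (F t) (fun w => u (gridpt m t k.+1) w - u (gridpt m t k) w).
      apply: (measurable_wrtB hF t0); first by apply: (measurable_wrt_mono hF g1 (gridpt_le _ _ _)); exact: au.
      by apply: (measurable_wrt_mono hF g0 (gridpt_le _ _ _)); exact: au.
    by under eq_fun do rewrite expr2; exact: (measurable_wrtM hF t0).
  pose g m k w := G (gridpt m (clock (rho n) t w) k.+1) w - G (gridpt m (clock (rho n) t w) k) w.
  have dug m k w : `|u (gridpt m t k.+1) w - u (gridpt m t k) w| <= g m k w.
    rewrite !uE !clock_gridpt//; apply: VG; last exact: gridpt_mono.
    by apply: gridpt_ge0; exact: clock_ge0.
  have g_ge0 m k w : 0 <= g m k w by exact: le_trans (dug m k w).
  have qn m w : `|q m w| <= n%:R * n%:R.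
    have c0 := clock_ge0 (rho0 w) t0.
    rewrite ger0_norm; last by apply: sumr_ge0 => k _; exact: sqr_ge0.
    have gp k : 0 <= G (gridpt m (clock (rho n) t w) k) w <= n%:R.
      by rewrite -clock_gridpt//; apply: Gn; exact: gridpt_ge0.
    apply: (@le_trans _ _ (\sum_(k < m.+1 * m.+1) n%:R * g m k w)).
      apply: ler_sum => k _; rewrite -real_normK ?num_real//.
      apply: (@le_trans _ _ (g m k w ^+ 2)); first by rewrite lerXn2r ?nnegrE// g_ge0.
      rewrite expr2 ler_wpM2r// /g; have := gp k; have := gp k.+1.
      by move=> /andP[? ?] /andP[? ?]; lra.
    rewrite -mulr_sumr ler_wpM2l// /g.
    have := telescope_sumr (fun k => G (gridpt m (clock (rho n) t w) k) w) (leq0n (m.+1 * m.+1)).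
    rewrite big_mkord => ->; have := gp 0%N; have := gp (m.+1 * m.+1)%N.
    by move=> /andP[? ?] /andP[? ?]; lra.
  have q0 w : q m w @[m --> \oo] --> (0 : R).
    apply: (@flat_sum _ (G ^~ w) (fun=> 0) 1 (clock (rho n) t w)
       (fun m k => (u (gridpt m t k.+1) w - u (gridpt m t k) w) ^+ 2)) => //.
    - exact: clock_ge0.
    - exact: continuous_path_cst.
    - move=> a b _ ab _ h; have := h a; rewrite lexx ab eqxx => /(_ isT) //.
    - move=> m k; rewrite normr0 mul0r add0r mul1r normrX.
      by rewrite lerXn2r ?nnegrE ?g_ge0 ?dug// -/(g m k w) g_ge0.
  have el m : expect P (fun w => left_sum m (u ^~ w) (u ^~ w) t) = 0.
    have := left_sum_martingale hF m mu au un.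
    move=> /(martingaleP hF)[_ _ /(_ 0 t setT (lexx 0) t0 (filtrationT hF (lexx 0)))].
    under eq_fun do rewrite indicT mul1r; move=> ->.
    transitivity (expect P (cst 0)); last exact: (expect_cst P 0).
    congr expect; apply/funext => w /=.
    rewrite indicT mul1r; apply: big1 => k _.
    have z0 j : gridpt m 0 j = 0 :> R by rewrite /gridpt min_r// divr_ge0.
    by rewrite !z0 subrr mulr0.
  have il m : intble P (fun w => left_sum m (u ^~ w) (u ^~ w) t).
    by have /(martingaleP hF)[_ + _] := left_sum_martingale hF m mu au un; apply.
  have iq m : intble P (q m) by exact: (intble_bdd P (mq m) (qn m)).
  have eu m : t <= m.+1%:R -> expect P (fun w => u t w ^+ 2) = expect P (q m).
    move=> tm; transitivity (expect P (fun w => 2 * left_sum m (u ^~ w) (u ^~ w) t + q m w)).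
      congr expect; apply/funext => w; rewrite -left_sum_square//.
      have u0 : u 0 w = 0 by rewrite uE clock0.
      by rewrite u0 expr0n subr0.
    by rewrite expectD ?expectZ ?el ?mulr0 ?add0r//; exact: intbleZ.
  have [_ cq] := expect_dct mq (measurable_cst _) (intble_cst P _) (aeW P q0) qn.
  have e0 : expect P (fun w => u t w ^+ 2) = 0.
    rewrite -(expect_cst P 0); apply: (cvg_unique _ _ cq) => //.
    apply: cvg_near_cst; near=> m; rewrite -eu//.
    apply: (@le_trans _ _ m%:R); last by rewrite ler_nat.
    near: m; exact: nbhs_infty_ger.
  have iu2 : intble P (fun w => u t w ^+ 2).
    apply: (@intble_bdd _ _ _ _ (n%:R ^+ 2)).
      by under eq_fun do rewrite expr2; exact: measurable_funM.
    by move=> w; rewrite normrX lerXn2r ?nnegrE// un.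
  apply: filterS (expect0_ae iu2 (fun w => sqr_ge0 _) e0) => w /eqP.
  by rewrite sqrf_eq0 => /eqP.
have all0 : {ae P, forall w, forall n m k, stopped V (rho n) (k%:R / m.+1%:R) w = 0}.
  apply: ae_foralln => n; apply: ae_foralln => m; apply: ae_foralln => k.
  by apply: zero; rewrite divr_ge0.
apply: filterS3 all0 r3 UG => w h1 h2 h3 t t0; rewrite h3//.
apply: (path_eq0_of_rationals (cV w)) => // m k.
have /cvgeyPge/(_ (k%:R / m.+1%:R))[n _ /(_ n (leqnn n)) hn] := h2.
by have := h1 n m k; rewrite stoppedE clock_id.
Unshelve. all: by end_near. Qed.

End parts.

(** * Paths that are constant off a set *)

Section path_lemmas.
Context {R : realType}.
Implicit Types (x a b z W : R -> R) (s t u v : R).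

(** The support condition on da in the form in which it is used: a is constant on
    every interval on which W has no zero. *)
Definition flat_off a W := forall u v, 0 <= u -> u <= v ->
  (forall s, u <= s <= v -> W s != 0) -> a u = a v.

Lemma dcarried_flat a W (Z : set R) : nondecreasing_path a -> dcarried_by a Z ->
  (forall s, 0 <= s -> Z s -> W s = 0) -> flat_off a W.
Proof.
move=> na [f [fE nZ]] ZW u v u0 uv hW; apply/eqP; rewrite eq_sym -subr_eq0.
have v0 := le_trans u0 uv.
have n2 : (lebesgue_stieltjes_measure f).-negligible `]u, v]%classic.
  apply: negligibleS nZ => s /=; rewrite in_itv/= => /andP[us sv].
  have s0 : 0 <= s by exact: le_trans u0 (ltW us).
  split; first by rewrite in_itv/= s0.
  by move=> /(ZW s s0) W0; have := hW s; rewrite (ltW us) sv W0 eqxx => /(_ isT).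
have mi : measurable (`]u, v]%classic : set (measurableTypeR R)) by exact: measurable_itv.
have /negligibleP-/(_ mi) n0 := n2.
have [] : (f v - f u)%:E = 0%:E := etrans (esym (lebesgue_stieltjes_itv f uv)) n0.
by rewrite !fE !max_l// => ->.
Qed.

Lemma grid_cover (y : R) : 0 < y -> exists i : nat, i%:R < y <= i.+1%:R.
Proof.
move=> y0; have /andP[h1 h2] := truncn_itv (ltW y0).
move: h1; rewrite le_eqVlt => /predU1P[e|h1]; last first.
  by exists (Num.truncn y); rewrite h1 ltW.
move: e; case: (Num.truncn y) => [|n] e; first by move: y0; rewrite -e ltxx.
by exists n; rewrite -e ltr_nat ltnSn lexx.
Qed.

(** The complement of the zeros of W is covered by the countably many grid
    intervals on which W has no zero, and each of them is da-negligible. *)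
Lemma flat_dcarried a W (Z : set R) : continuous_path a -> nondecreasing_path a ->
  continuous_path W -> W 0 = 0 -> (forall s, 0 <= s -> W s = 0 -> Z s) ->
  flat_off a W -> dcarried_by a Z.
Proof.
move=> ca na cW W0 WZ fl; have [f fE] := cumulative_of_path na (continuous_path_cadlag ca).1.
exists f; split => //.
pose I m i : set R := `]i%:R / m.+1%:R, i.+1%:R / m.+1%:R]%classic.
pose J m i : set R := if `[< forall s, i%:R / m.+1%:R <= s <= i.+1%:R / m.+1%:R -> W s != 0 >]
   then I m i else set0.
have nJ : (lebesgue_stieltjes_measure f).-negligible (\bigcup_m \bigcup_i J m i).
  apply: negligible_bigcup => m; apply: negligible_bigcup => i.
  rewrite /J; case: asboolP => h; last exact: negligible_set0.
  apply/negligibleP; first exact: measurable_itv.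
  have i0 : 0 <= i%:R / m.+1%:R :> R by rewrite divr_ge0.
  have ii : i%:R / m.+1%:R <= i.+1%:R / m.+1%:R :> R.
    by rewrite ler_pM2r ?invr_gt0 ?ltr0Sn// ler_nat.
  apply: (etrans (lebesgue_stieltjes_itv f ii)).
  by rewrite !fE !max_l ?divr_ge0// (fl _ _ i0 ii h) subrr.
apply: negligibleS nJ.
move=> s /= [+ nZ]; rewrite in_itv/= andbT => s0.
have Ws : W s != 0 by apply/eqP => e; apply: nZ; exact: WZ.
have sp : 0 < s by rewrite lt_neqAle s0 andbT; apply: contra_neq Ws => <-.
have e0 : 0 < `|W s| / 2 by rewrite divr_gt0// normr_gt0.
have [de de0 hd] := continuous_path_local cW s0 e0.
(* a grid so fine that the cell of s lies within distance de of s *)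
pose m := Num.truncn de^-1.
have m0 : 0 < m.+1%:R :> R by rewrite ltr0Sn.
have mde : m.+1%:R^-1 < de by rewrite -[ltRHS]invrK ltf_pV2 ?posrE ?invr_gt0// truncnS_gt.
have [i /andP[i1 i2]] := grid_cover (mulr_gt0 sp m0).
exists m => //; exists i => //; rewrite /J.
have j1 : i%:R / m.+1%:R < s by rewrite ltr_pdivrMr.
have j2 : s <= i.+1%:R / m.+1%:R by rewrite ler_pdivlMr.
rewrite ifT; first by rewrite /I/= in_itv/= j1 j2.
apply/asboolP => r /andP[r1 r2]; apply/eqP => Wr.
have : `|W s - W r| <= `|W s| / 2.
  apply: hd; first by apply: le_trans r1; rewrite divr_ge0.
  have l : i.+1%:R / m.+1%:R = i%:R / m.+1%:R + m.+1%:R^-1 :> R by rewrite -(natr1 i) mulrDl mul1r.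
  by rewrite ltr_norml; move: r1 r2 j1 j2 mde; rewrite l; set p := i%:R / _; set q := m.+1%:R^-1 => *; apply/andP; split; lra.
by rewrite Wr subr0; move: e0; lra.
Qed.

Lemma within_subpath x t : 0 <= t -> continuous_path x -> {within `[0, t], continuous x}.
Proof.
move=> t0; apply: continuous_subspaceW => s /=; rewrite !in_itv/= andbT.
by move=> /andP[].
Qed.

Lemma inf_eq (E : set R) m : E m -> (forall y, E y -> m <= y) -> inf E = m.
Proof.
move=> Em lb; apply/eqP; rewrite eq_le; apply/andP; split.
  by apply: ge_inf => //; exists m.
by apply: lb_le_inf; [exists m|].
Qed.

(** The lower bound holds because a is nondecreasing and x >= 0.  It is attained
    at the last zero g of x before t: x has no zero on ]g, t], so a_g = a_t. *)
Lemma reflection_inf x a t : continuous_path x -> (forall s, 0 <= s -> 0 <= x s) ->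
  x 0 = 0 -> integrator_path a -> flat_off a x -> 0 <= t ->
  inf [set (1 + x s) * expR (- a s) | s in `[0, t]%classic] = expR (- a t).
Proof.
move=> cx x_ge0 x0 [ca na a0] fl t0; apply: inf_eq; last first.
  move=> _ [s /= + <-]; rewrite in_itv/= => /andP[s0 st].
  apply: (@le_trans _ _ (expR (- a s))); first by rewrite ler_expR lerN2 na.
  by rewrite ler_peMl ?expR_ge0// lerDl x_ge0.
pose S := [set s | 0 <= s <= t /\ x s = 0].
have S0 : S 0 by split => //; rewrite lexx t0.
have hS : has_sup S by split; [exists 0|exists t => s [/andP[]]].
pose g := sup S.
have g0 : 0 <= g by apply: sup_upper_bound.
have gt : g <= t by apply: ge_sup; [exists 0|move=> s [/andP[]]].
have xg : x g = 0.
  apply/eqP; apply: contraT => xg.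
  have e0 : 0 < `|x g| / 2 by rewrite divr_gt0// normr_gt0.
  have [de de0 hd] := continuous_path_local cx g0 e0.
  have [s [/andP[s0 st] xs] sg] := sup_adherent de0 hS.
  have sg' : s <= g by apply: sup_upper_bound => //; split => //; rewrite s0.
  have : `|x g - x s| <= `|x g| / 2.
    by apply: hd => //; rewrite ger0_norm ?subr_ge0// ltrBlDr -ltrBlDl.
  by rewrite xs subr0; move: e0; lra.
have ag : a g = a t.
  move: (gt); rewrite le_eqVlt => /predU1P[->//|gt'].
  apply/eqP; rewrite eq_sym -subr_eq0 -normr_le0; apply/ler_addgt0Pl => e e0; rewrite addr0.
  have [de de0 hd] := continuous_path_local ca g0 e0.
  pose r := Num.min t (g + de / 2).
  have gr : g < r by rewrite lt_min gt' ltrDl divr_gt0.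
  have rt : r <= t by rewrite ge_min lexx.
  have r0 : 0 <= r by rewrite (le_trans g0)// ltW.
  have -> : a t = a r.
    apply/esym/fl => // s /andP[rs st]; apply/eqP => xs.
    have : s <= g by apply: sup_upper_bound => //; split => //; rewrite st (le_trans r0).
    by rewrite leNgt (lt_le_trans gr).
  rewrite distrC; apply: hd => //; rewrite ltr0_norm ?subr_lt0// opprB.
  have : r <= g + de / 2 by rewrite ge_min lexx orbT.
  lra.
by exists g; rewrite /= ?in_itv/= ?g0 ?gt// xg ag addr0 mul1r.
Qed.

(** If the running infimum decreases between u and v, the minimum of m over [0, v]
    is attained at some g in ]u, v]; there m equals its running infimum, and
    x_g = 0. *)
Lemma running_inf_flat m x : continuous_path m -> (forall s, 0 <= s -> 0 < m s) ->
  (forall s, 0 <= s -> 0 <= x s) ->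
  (forall t, 0 <= t -> x t = m t / inf [set m s | s in `[0, t]%classic] - 1) ->
  [/\ forall t, 0 <= t -> inf [set m s | s in `[0, t]%classic] = m t / (1 + x t),
    forall u v, 0 <= u -> u <= v -> m v / (1 + x v) <= m u / (1 + x u) &
    flat_off (fun t => m t / (1 + x t)) x].
Proof.
move=> cm m0 x0 xE; pose I t := inf [set m s | s in `[0, t]%classic].
have IE t : 0 <= t -> I t = m t / (1 + x t).
  move=> t0; have := x0 t t0; rewrite xE// -/(I t); have mt := m0 t t0.
  have [->|In0] := eqVneq (I t) 0; first by rewrite invr0 mulr0; lra.
  by move=> _; rewrite addrC subrK invf_div mulrC divfK// gt_eqF.
have minI t : 0 <= t -> exists g, [/\ 0 <= g, g <= t, I t = m g & forall s, 0 <= s -> s <= t -> I t <= m s].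
  move=> t0; have [g] := EVT_min t0 (within_subpath t0 cm).
  rewrite in_itv/= => /andP[g0 gt] hg; exists g.
  have e : I t = m g.
    apply: inf_eq; first by exists g => //=; rewrite in_itv/= g0.
    by move=> _ [s /= st <-]; exact: hg.
  by split => // s s0 st; rewrite e; apply: hg; rewrite in_itv/= s0.
have nI u v : 0 <= u -> u <= v -> I v <= I u.
  move=> u0 uv; have [g [g0 gu -> _]] := minI u u0.
  have [_ [_ _ _ h]] := minI v (le_trans u0 uv).
  by apply: h => //; exact: le_trans uv.
split=> [t t0|u v u0 uv|u v u0 uv h]; first exact: IE.
  by rewrite -!IE ?(le_trans u0)//; exact: nI.
have v0 := le_trans u0 uv.
rewrite -!IE//; apply/eqP; rewrite eq_le; apply/andP; split; last exact: nI.
rewrite leNgt; apply/negP => Iuv.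
have [g [g0 gv e hg]] := minI v v0.
have [gu|ug] := leP g u.
  have [_ [_ _ _ h2]] := minI u u0.
  by have := h2 g g0 gu; rewrite -e leNgt Iuv.
have Ig : I g = m g.
  apply/eqP; rewrite eq_le; apply/andP; split; last by rewrite -e; exact: nI.
  by have [_ [_ _ _ h2]] := minI g g0; exact: h2.
have := h g; rewrite (ltW ug) gv => /(_ isT).
by rewrite xE// -/(I g) Ig divff ?subrr ?eqxx// gt_eqF// m0.
Qed.

(** On a small interval the two equal integrals are z times the increments of b
    and b', up to an error which is small compared with these increments.  As |z|
    is bounded below on [s, t], summing over a fine grid compares the increments
    of b and b'. *)
Lemma path_integral_inj z b b' : continuous_path z -> integrator_path b -> integrator_path b' ->
  (forall t, 0 <= t -> path_integral z b t = path_integral z b' t) ->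
  forall s t, 0 <= s -> s <= t -> (forall u, s <= u <= t -> z u != 0) ->
  b t - b s = b' t - b' s.
Proof.
move=> cz hb hb' eJ s t s0 st nz.
have [cb nb _] := hb; have [cb' nb' _] := hb'; have t0 := le_trans s0 st.
have czl := continuous_path_cadlag cz.
have [c] : exists2 c, c \in `[s, t]%R & forall u, u \in `[s, t]%R -> `|z c| <= `|z u|.
  apply: EVT_min => //.
  have cn : continuous_path (fun u => `|z u|).
    apply: (@continuous_path_comp _ (fun y => `|y|)) => // u _; exact: norm_continuous.
  apply: continuous_subspaceW cn => u /=; rewrite !in_itv/= andbT.
  by move=> /andP[su _]; exact: le_trans su.
rewrite in_itv/= => cst zc; pose del := `|z c|.
have del0 : 0 < del by rewrite normr_gt0; exact: nz.
pose g u := b u + b' u.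
have gst : 0 <= g t - g s by have := nb s t s0 st; have := nb' s t s0 st; rewrite /g; lra.
apply/eqP; rewrite -subr_eq0 -normr_le0; apply/ler_addgt0Pl => e e0; rewrite addr0.
pose K := g t - g s + 1.
have K0 : 0 < K by rewrite /K; lra.
have h0 : 0 < del * e / K by rewrite divr_gt0// mulr_gt0.
have [de de0 hd] := @continuous_path_uniform _ _ t _ cz h0.
set h := del * e / K in h0 hd.
have step p q : s <= p -> p <= q -> q <= t -> q - p < de ->
    del * `|(b q - b p) - (b' q - b' p)| <= h * (g q - g p).
  move=> sp pq qt qp; have p0 := le_trans s0 sp.
  have osc r : p < r -> r <= q -> z p - h <= z r <= z p + h.
    move=> pr rq; have : `|z p - z r| <= h.
      apply: hd; first by rewrite p0 (le_trans pq).
        by rewrite (le_trans p0)// ltW.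
      by rewrite ltr0_norm ?subr_lt0// opprB; apply: le_lt_trans qp; rewrite lerD2r.
    by rewrite ler_norml => /andP[? ?]; apply/andP; split; lra.
  have o1 r : p < r -> r <= q -> z r <= z p + h by move=> a1 a2; have /andP[] := osc r a1 a2.
  have o2 r : p < r -> r <= q -> z p - h <= z r by move=> a1 a2; have /andP[] := osc r a1 a2.
  have u1 := path_integral_ub hb czl p0 pq o1; have l1 := path_integral_lb hb czl p0 pq o2.
  have u2 := path_integral_ub hb' czl p0 pq o1; have l2 := path_integral_lb hb' czl p0 pq o2.
  rewrite -!eJ ?(le_trans p0)// in u2 l2.
  apply: (@le_trans _ _ (`|z p| * `|(b q - b p) - (b' q - b' p)|)).
    by rewrite ler_wpM2r// zc// in_itv/= sp (le_trans pq).
  rewrite -normrM ler_norml /g.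
  move: u1 l1 u2 l2; set J := path_integral z b q - _; set k := z p => u1 l1 u2 l2.
  by apply/andP; split; lra.
(* mesh below de, and a grid long enough to reach t *)
pose n := (Num.truncn (de^-1 + (t - s))).
have n1 : n.+1%:R^-1 < de.
  rewrite -[ltRHS]invrK ltf_pV2 ?posrE ?invr_gt0//.
  by apply: le_lt_trans (truncnS_gt _); rewrite lerDl subr_ge0.
have ts0 : 0 <= t - s by rewrite subr_ge0.
have n2 : t - s <= n.+1%:R.
  by apply/ltW/(le_lt_trans _ (truncnS_gt _)); rewrite lerDr invr_ge0 ltW.
pose q k := s + gridpt n (t - s) k.
have q0 : q 0%N = s by rewrite /q gridpt0// addr0.
have qN : q (n.+1 * n.+1)%N = t by rewrite /q gridpt_last// addrC subrK.
have tel (x : R -> R) : \sum_(k < n.+1 * n.+1) (x (q k.+1) - x (q k)) = x t - x s.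
  have := telescope_sumr (fun k => x (q k)) (leq0n (n.+1 * n.+1)).
  by rewrite big_mkord => ->; rewrite q0 qN.
have -> : b t - b s - (b' t - b' s) =
    \sum_(k < n.+1 * n.+1) ((b (q k.+1) - b (q k)) - (b' (q k.+1) - b' (q k))).
  by rewrite sumrB !tel.
rewrite -(ler_pM2l del0).
apply: le_trans (ler_wpM2l (ltW del0) (ler_norm_sum _ _ _)) _.
rewrite mulr_sumr; apply: (@le_trans _ _ (\sum_(k < n.+1 * n.+1) h * (g (q k.+1) - g (q k)))).
  apply: ler_sum => k _; apply: step.
  - by rewrite lerDl gridpt_ge0.
  - by rewrite lerD2l gridpt_mono.
  - by rewrite -lerBrDl gridpt_le.
  - by rewrite /q opprD addrACA subrr add0r; apply: le_lt_trans n1; exact: gridpt_step.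
rewrite -mulr_sumr tel.
apply: (@le_trans _ _ (h * K)); first by rewrite ler_wpM2l ?(ltW h0)// /K lerDl.
by rewrite /h divfK// gt_eqF.
Qed.

(** Bounded variation as domination by a nondecreasing path, a form in which
    stability under products and integrals is immediate. *)
Definition bv_dominated x t := exists g : R -> R, forall u v, 0 <= u -> u <= v -> v <= t ->
  `|x v - x u| <= g v - g u.

Lemma bv_dominatedP x t : 0 <= t -> bounded_variation 0 t x <-> bv_dominated x t.
Proof.
move=> t0; split=> [bx|[g hg]].
  exists (fun s => fine (total_variation 0 s x)) => u v u0 uv vt.
  have v0 := le_trans u0 uv.
  have f0 : total_variation 0 u x \is a fin_num.
    apply/bounded_variationP => //; apply: bounded_variationl bx => //; exact: le_trans vt.
  have bv : bounded_variation 0 v x by apply: bounded_variationl bx.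
  have f1 : total_variation u v x \is a fin_num.
    apply/bounded_variationP => //; exact: bounded_variationr bv.
  rewrite (total_variationD _ u0 uv) fineD// addrAC subrr add0r.
  by rewrite -lee_fin fineK//; exact: total_variation_ge.
move: t0; rewrite le_eqVlt => /predU1P[<-|t0]; first exact: bounded_variationxx.
have gn : {in `[0, t] &, {homo g : x y / x <= y}}.
  move=> u v; rewrite !in_itv/= => /andP[u0 ut] /andP[v0 vt] uv.
  by rewrite -subr_ge0; apply: le_trans (hg u v u0 uv vt).
have xgn : {in `[0, t] &, {homo (x \+ g) : x y / x <= y}}.
  move=> u v; rewrite !in_itv/= => /andP[u0 ut] /andP[v0 vt] uv /=.
  by have := hg u v u0 uv vt; rewrite ler_norml => /andP[? ?]; lra.
have -> : x = (x \+ g) \+ (\- g) by apply/funext => s /=; rewrite addrK.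
apply: bounded_variationD => //; first exact: nondecreasing_bounded_variation.
by apply: bounded_variationN; exact: nondecreasing_bounded_variation.
Qed.

Lemma bv_dominated_nondecreasing x t : nondecreasing_path x -> bv_dominated x t.
Proof.
move=> nx; exists x => u v u0 uv vt; rewrite ger0_norm// subr_ge0.
exact: nx.
Qed.

Lemma bv_dominatedD x y t : bv_dominated x t -> bv_dominated y t ->
  bv_dominated (fun s => x s + y s) t.
Proof.
move=> [g hg] [h hh]; exists (fun s => g s + h s) => u v u0 uv vt.
have := hg u v u0 uv vt; have := hh u v u0 uv vt.
by rewrite !ler_norml => /andP[? ?] /andP[? ?]; apply/andP; split; lra.
Qed.

Lemma bv_dominatedM x y t : 0 <= t -> bv_dominated x t -> bv_dominated y t ->
  bv_dominated (fun s => x s * y s) t.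
Proof.
move=> t0 [g hg] [h hh].
have bnd z k : (forall u v, 0 <= u -> u <= v -> v <= t -> `|z v - z u| <= k v - k u) ->
    forall s, 0 <= s -> s <= t -> `|z s| <= `|z 0| + (k t - k 0).
  move=> hz s s0 st; have h1 := hz 0 s (lexx 0) s0 st.
  have h2 := le_trans (normr_ge0 _) (hz s t s0 st (lexx t)).
  have := ler_normD (z s - z 0) (z 0); rewrite subrK => h3; lra.
set Mx := `|x 0| + (g t - g 0); set My := `|y 0| + (h t - h 0).
exists (fun s => My * g s + Mx * h s) => u v u0 uv vt.
have v0 := le_trans u0 uv; have ut := le_trans uv vt.
have -> : x v * y v - x u * y u = (x v - x u) * y v + x u * (y v - y u) by ring.
apply: le_trans (ler_normD _ _) _; rewrite !normrM.
have a1 := hg u v u0 uv vt; have a2 := hh u v u0 uv vt.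
have b1 : `|y v| <= My by exact: (bnd y h).
have b2 : `|x u| <= Mx by exact: (bnd x g).
have c1 := ler_pM (normr_ge0 _) (normr_ge0 _) a1 b1.
have c2 := ler_pM (normr_ge0 _) (normr_ge0 _) b2 a2.
lra.
Qed.

Lemma bv_dominated_path_integral z b t : cadlag_path z -> integrator_path b -> bv_dominated (path_integral z b) t.
Proof.
move=> cz hb; exists (path_integral (fun s => `|z s|) b) => u v u0 uv _.
exact: path_integral_norm.
Qed.

(** These bounds control the difference between a Riemann-Stieltjes sum against
    exp(-a) and the corresponding sum against a. *)
Lemma exp_decrement (x : R) : 0 <= x ->
  0 <= 1 - expR (- x) <= x /\ `|1 - x - expR (- x)| <= x ^+ 2.
Proof.
move=> x0; have e1 : expR (- x) <= 1 by rewrite -expR0 ler_expR oppr_le0.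
have e2 : 1 - x <= expR (- x) by rewrite expR_ge1Dx.
have e3 : expR (- x) <= (1 + x)^-1.
  rewrite expRN lef_pV2 ?posrE ?expR_gt0 ?expR_ge1Dx//; lra.
have e4 : (1 + x)^-1 <= 1 - x + x ^+ 2.
  rewrite -[(1 + x)^-1]mul1r ler_pdivrMr; last lra.
  by have := exprn_ge0 3 x0; rewrite !exprS expr0; lra.
split; first by apply/andP; split; lra.
by rewrite ler_norml; apply/andP; split; lra.
Qed.

End path_lemmas.

(** * Semimartingales and the passage from Sigma(H) to M *)

Section main.
Context {R : realType} {d : measure_display} {T : measurableType d}.
Variables (P : probability T R) (F : R -> set_system T).
Hypothesis hF : usual_filtration P F.
Implicit Types (s t : R) (M N X Y Z A B G D : process R T).

Lemma density_martingale (Q : {charge set T -> \bar R}) D :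
  density_process P Q F D -> martingale P F D.
Proof.
move=> hD; split.
- by move=> t t0; have [] := hD t t0.
- by move=> t t0; have [] := hD t t0.
move=> s t s0 st; have [ms is_ es] := hD s s0; have [mt it et] := hD t (le_trans s0 st).
split => // E FE; rewrite -es//; apply: et; exact: (filtration_mono hF s0 st).
Qed.

Lemma integrator_comp (g : R -> R) B : continuous g -> g 0 = 0 ->
  (forall x y, 0 <= x -> x <= y -> g x <= g y) -> integrator F B ->
  integrator F (fun t w => g (B t w)).
Proof.
move=> cg g0 ng [aB hB]; split.
  move=> t t0; apply: (measurable_wrt_comp hF t0); last exact: aB.
  exact: continuous_measurable_fun.
move=> w; have [cB nB B0] := hB w; split.
- by apply: continuous_path_comp => // t _; exact: cg.
- by move=> s t s0 st; apply: ng; [rewrite -B0; exact: nB|exact: nB].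
- by rewrite B0.
Qed.

Lemma fv_process V : adapted F V -> {ae P, forall w, cadlag_path (V ^~ w)} ->
  {ae P, forall w, forall t, 0 <= t -> bv_dominated (V ^~ w) t} ->
  finite_variation_process P F V.
Proof.
move=> aV cV bV; split => //; apply: filterS bV => w h t t0.
by apply/bv_dominatedP => //; exact: h.
Qed.

(** With X = L + V: L B = (L B - int L dB) + int L dB is the sum of a local
    martingale and a process of finite variation, and V B has finite variation. *)
Lemma semimartingale_integrator X B : semimartingale P F X -> integrator F B ->
  semimartingale P F (fun t w => X t w * B t w).
Proof.
move=> [aX [L [V [lL [aV cV bV] XLV]]]] iB; have [aB hB] := iB.
have [aL cL _] := lL.
split; first by move=> t t0; apply: (measurable_wrtM hF t0); [exact: aX|exact: aB].
exists (fun t w => L t w * B t w - integral_process L B t w).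
exists (fun t w => integral_process L B t w + V t w * B t w); split.
- exact: (integration_by_parts hF).
- apply: fv_process.
  + move=> t t0; apply: (measurable_wrtD hF t0); first exact: (integral_process_adapted hF aL cL iB).
    by apply: (measurable_wrtM hF t0); [exact: aV|exact: aB].
  + apply: filterS2 cL cV => w cLw cVw; have [cB _ _] := hB w.
    apply: cadlagD; first by apply: continuous_path_cadlag; exact: path_integral_continuous.
    by apply: cadlagM => //; exact: continuous_path_cadlag.
  + apply: filterS2 cL bV => w cLw bVw t t0; have [_ nB _] := hB w.
    apply: bv_dominatedD; first exact: bv_dominated_path_integral.
    apply: bv_dominatedM => //; first by apply/bv_dominatedP => //; exact: bVw.
    exact: bv_dominated_nondecreasing.
- apply: filterS XLV => w h t t0; rewrite h//; ring.
Qed.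

Lemma semimartingaleD X Y : semimartingale P F X -> semimartingale P F Y ->
  semimartingale P F (fun t w => X t w + Y t w).
Proof.
move=> [aX [L [V [lL [aV cV bV] XLV]]]] [aY [K [U [lK [aU cU bU] YKU]]]].
split; first by move=> t t0; apply: (measurable_wrtD hF t0); [exact: aX|exact: aY].
exists (fun t w => L t w + K t w), (fun t w => V t w + U t w); split.
- exact: (local_martingaleD hF).
- apply: fv_process.
  + by move=> t t0; apply: (measurable_wrtD hF t0); [exact: aV|exact: aU].
  + by apply: filterS2 cV cU => w; exact: cadlagD.
  + apply: filterS2 bV bU => w hV hU t t0.
    by apply: bv_dominatedD; apply/bv_dominatedP => //; [exact: hV|exact: hU].
- apply: filterS2 XLV YKU => w h1 h2 t t0; rewrite h1// h2//; ring.
Qed.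

Lemma semimartingaleZ (c : R) X : semimartingale P F X ->
  semimartingale P F (fun t w => c * X t w).
Proof.
move=> [aX [L [V [lL [aV cV bV] XLV]]]].
split; first by move=> t t0; apply: (measurable_wrtM hF t0); [exact: (measurable_wrt_cst hF t0)|exact: aX].
exists (fun t w => c * L t w), (fun t w => c * V t w); split.
- exact: (local_martingaleZ hF).
- apply: fv_process.
  + by move=> t t0; apply: (measurable_wrtM hF t0); [exact: (measurable_wrt_cst hF t0)|exact: aV].
  + by apply: filterS cV => w; exact: cadlagZ.
  + apply: filterS bV => w hV t t0.
    apply: bv_dominatedM => //; first by apply: bv_dominated_nondecreasing => ? ? _ _.
    by apply/bv_dominatedP => //; exact: hV.
- apply: filterS XLV => w h t t0; rewrite h//; ring.
Qed.

Lemma semimartingaleB X Y : semimartingale P F X -> semimartingale P F Y ->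
  semimartingale P F (fun t w => X t w - Y t w).
Proof.
move=> sX sY; have := semimartingaleD sX (semimartingaleZ (-1) sY).
by under eq_fun2 do rewrite mulN1r.
Qed.

Lemma semimartingale_indist X Y : semimartingale P F X -> indistinguishable P X Y ->
  semimartingale P F Y.
Proof.
move=> [aX [L [V [lL fV XLV]]]] XY; split; first exact: (adapted_indist hF aX XY).
exists L, V; split => //; apply: filterS2 XLV XY => w h1 h2 t t0.
by rewrite -h2// h1.
Qed.

Lemma semimartingale_fv V : finite_variation_process P F V -> semimartingale P F V.
Proof.
move=> fV; have [aV _ _] := fV; split => //; exists (fun _ _ => 0), V; split => //.
  have m0 : martingale P F (fun _ _ => 0 : R).
    apply/(martingaleP hF); split => // t t0; first exact: (measurable_wrt_cst hF t0).
    exact: intble_cst.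
  apply: (martingale_local hF m0); apply: aeW => w; exact: cadlag_cst.
by apply: aeW => w t _; rewrite add0r.
Qed.

Lemma integrator_fv B : integrator F B -> finite_variation_process P F B.
Proof.
move=> [aB hB]; apply: fv_process => //; apply: aeW => w; have [cB nB _] := hB w.
  exact: continuous_path_cadlag.
by move=> t _; exact: bv_dominated_nondecreasing.
Qed.

Lemma semimartingale_cst (c : R) : semimartingale P F (fun _ _ => c).
Proof.
apply: semimartingale_fv; apply: fv_process.
- by move=> t t0; exact: (measurable_wrt_cst hF t0).
- by apply: aeW => w; exact: cadlag_cst.
- by apply: aeW => w t _; apply: bv_dominated_nondecreasing => ? ? _ _.
Qed.

(** With a = A_t: exp(-a) = 1 - g1 a and (1 + a) exp(-a) = 1 - g2 a, where g1 and
    g2 are nondecreasing and vanish at 0, as integrators have to. *)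
Let g1 (x : R) := 1 - expR (- x).
Let g2 (x : R) := 1 - (1 + x) * expR (- x).

Let cexpN : continuous (fun x : R => expR (- x)).
Proof.
move=> x; apply: (continuous_comp (g := expR)); first exact: continuousN.
exact: continuous_expR.
Qed.

Let int1 B : integrator F B -> integrator F (fun t w => g1 (B t w)).
Proof.
apply: integrator_comp.
- by move=> x; apply: cvgB; [exact: cvg_cst|exact: cexpN].
- by rewrite /g1 oppr0 expR0 subrr.
- by move=> x y _ xy; rewrite /g1 lerD2l lerN2 ler_expR lerN2.
Qed.

Let int2 B : integrator F B -> integrator F (fun t w => g2 (B t w)).
Proof.
apply: integrator_comp.
- move=> x; apply: cvgB; first exact: cvg_cst.
  apply: cvgM; last exact: cexpN.
  by apply: cvgD; [exact: cvg_cst|exact: cvg_id].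
- by rewrite /g2 oppr0 expR0 addr0 mulr1 subrr.
- move=> x y x0 xy; rewrite /g2 lerD2l lerN2.
  have -> : expR (- x) = expR (- y) * expR (y - x).
    by rewrite -expRD; congr expR; ring.
  rewrite mulrCA [leLHS]mulrC ler_pM2l ?expR_gt0//.
  apply: (@le_trans _ _ ((1 + x) * (1 + (y - x)))); first by nra.
  by apply: ler_wpM2l; [lra|exact: expR_ge1Dx].
Qed.

(** The dA terms of the two integrations by parts, discretized.  In both
    directions they have, up to a factor at most 1, the form
      D (X (1 - exp(-del)) + (1 - del - exp(-del)))
    with del the increment of a: a first-order term X D da, which vanishes as a
    moves only where X D = 0, and a second-order remainder. *)
Lemma bracket_sum (D X a : R -> R) t (e : nat -> nat -> R) : 0 <= t ->
  continuous_path D -> continuous_path X -> integrator_path a ->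
  flat_off a (fun s => X s * D s) ->
  (forall n k p q del, p = gridpt n t k -> q = gridpt n t k.+1 -> del = a q - a p ->
    `|e n k| <= `|D q| * `|X q * (1 - expR (- del)) + (1 - del - expR (- del))|) ->
  \sum_(k < n.+1 * n.+1) e n k @[n --> \oo] --> (0 : R).
Proof.
move=> t0 cD cX [ca na a0] fl he.
have [M hM] := cadlag_bounded t (continuous_path_cadlag cD).
have M0 : 0 <= M by apply: le_trans (hM 0 _); rewrite ?lexx ?t0.
apply: (@flat_sum _ a (fun s => X s * D s) (1 + M) t) => //.
- exact: continuous_pathM.
- by move=> u v u0 uv _ h; exact: fl.
- by rewrite addr_ge0.
move=> n k; apply: le_trans (he n k _ _ _ erefl erefl erefl) _.
have p0 := gridpt_ge0 n k t0; have q0 := gridpt_ge0 n k.+1 t0.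
have Dq : `|D (gridpt n t k.+1)| <= M by apply: hM; rewrite q0 gridpt_le.
have := na _ _ p0 (gridpt_mono n t k); rewrite -subr_ge0.
move: (a _ - a _) => x x0; rewrite normrM.
have [/andP[h1 h2] h3] := exp_decrement x0.
move: Dq; set q := D _; set z := X _ => Dq.
have h4 : `|z * (1 - expR (- x)) + (1 - x - expR (- x))| <= `|z| * x + x ^+ 2.
  apply: le_trans (ler_normD _ _) _; apply: lerD => //.
  by rewrite normrM (ger0_norm h1) ler_wpM2l.
apply: le_trans (ler_wpM2l (normr_ge0 _) h4) _.
have x2 : 0 <= x ^+ 2 by exact: sqr_ge0.
rewrite mulrDr mulrDl mul1r mulrDr.
have : `|q| * (`|z| * x) = `|z| * `|q| * x by ring.
move=> ->; have := ler_wpM2r x2 Dq.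
have : 0 <= M * (`|z| * `|q| * x) by rewrite !mulr_ge0.
lra.
Qed.

Section class.
Variables D X : process R T.
Hypothesis mD : martingale P F D.
Hypothesis cD : {ae P, forall w, continuous_path (D ^~ w)}.
Hypothesis sX : semimartingale P F X.
Hypothesis cX : {ae P, forall w, continuous_path (X ^~ w)}.
Hypothesis X0 : {ae P, forall w, forall t, 0 <= t -> 0 <= X t w}.
Hypothesis XH : vanishes_on_zeros P D X.

Let cDl : {ae P, forall w, cadlag_path (D ^~ w)}.
Proof. by apply: filterS cD => w; exact: continuous_path_cadlag. Qed.

Let lD : local_martingale P F D.
Proof. exact: (martingale_local hF mD cDl). Qed.

(** (1 + X) D exp(-A) = (N D) (1 - g1 A) + D (1 - g2 A), to which integration by
    parts is applied twice; the two integrals cancel by [bracket_sum]. *)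
Lemma class_represents N A : class_Sigma_with P F D X N A ->
  represents P F D X (fun t w => (1 + X t w) * expR (- A t w)).
Proof.
move=> [_ XNA [cN [sN lND] N0] [aA cA nA A0] dA].
have [B iB AB] := regularize hF aA cA nA A0.
have [aB hB] := iB.
pose M t w := (1 + X t w) * expR (- B t w).
have MB : indistinguishable P M (fun t w => (1 + X t w) * expR (- A t w)).
  by apply: filterS AB => w h t t0; rewrite /M h.
have [aX _] := sX.
have sM : semimartingale P F M.
  have s1 := semimartingaleD (semimartingale_cst 1) sX.
  apply: (semimartingale_indist (semimartingaleB s1 (semimartingale_integrator s1 (int1 iB)))).
  by apply: aeW => w t t0; rewrite /M /g1; ring.
have flB : {ae P, forall w, flat_off (B ^~ w) (fun s => X s w * D s w)}.
  apply: filterS3 dA nA (filterI XH AB) => w h1 h2 [h3 h4] u v u0 uv huv.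
  rewrite -!h4 ?(le_trans u0)//; apply: (dcarried_flat h2 h1 _ u0 uv huv) => s s0 [[_ ->]|[_ ->]].
    by rewrite mul0r.
  by rewrite mulr0.
have lMD : local_martingale P F (fun t w => M t w * D t w).
  pose K t w := N t w * D t w.
  have l1 := integration_by_parts hF lND (int1 iB).
  have l2 := integration_by_parts hF lD (int2 iB).
  have lKD := local_martingaleD hF lND lD.
  apply: (local_martingale_indist hF
    (local_martingaleB hF (local_martingaleB hF lKD l1) l2)).
  have [_ cK _] := lND.
  apply: filterS3 (filterI XNA AB) (filterI cX cD) (filterI flB (filterI cK cDl)).
  move=> w [h1 h1'] [h2 h2'] [h3 [h4 h4']] t t0.
  have hb1 := (int1 iB).2 w; have hb2 := (int2 iB).2 w.
  have S0 : integral_process (fun t w => N t w * D t w) (fun t w => g1 (B t w)) t w +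
      integral_process D (fun t w => g2 (B t w)) t w = 0.
    have c1 := path_integral_cvg hb1 h4 t0; have c2 := path_integral_cvg hb2 h4' t0.
    apply: (cvg_unique _ (cvgD c1 c2)) => //.
    pose e n k : R :=
      N (gridpt n t k.+1) w * D (gridpt n t k.+1) w * (g1 (B (gridpt n t k.+1) w) - g1 (B (gridpt n t k) w)) +
      D (gridpt n t k.+1) w * (g2 (B (gridpt n t k.+1) w) - g2 (B (gridpt n t k) w)).
    suff : \sum_(k < n.+1 * n.+1) e n k @[n --> \oo] --> (0 : R).
      have eE n : right_sum n (fun s => N s w * D s w) (fun s => g1 (B s w)) t +
          right_sum n (D ^~ w) (fun s => g2 (B s w)) t = \sum_(k < n.+1 * n.+1) e n k.
        by rewrite /right_sum -big_split.
      move=> h; apply: cvg_trans h; apply: near_eq_cvg; near=> n.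
      exact/esym/eE.
    apply: (@bracket_sum (D ^~ w) (X ^~ w) (B ^~ w) t e) => //.
    move=> n k p q del pE qE delE; rewrite /e -pE -qE.
    have q0 : 0 <= q by rewrite qE; exact: gridpt_ge0.
    have Bp : 0 <= B p w.
      have [_ nB B0] := hB w; rewrite -B0; apply: nB => //; rewrite pE; exact: gridpt_ge0.
    have NE : N q w = X q w - B q w by rewrite h1// h1'//; ring.
    have E : expR (- B q w) = expR (- B p w) * expR (- del).
      by rewrite -expRD; congr expR; rewrite delE; ring.
    have -> : N q w * D q w * (g1 (B q w) - g1 (B p w)) + D q w * (g2 (B q w) - g2 (B p w)) =
      expR (- B p w) * (D q w * (X q w * (1 - expR (- del)) + (1 - del - expR (- del)))).
      by rewrite /g1 /g2 E NE delE; ring.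
    rewrite normrM [leRHS](_ : _ = 1 * `|D q w * (X q w * (1 - expR (- del)) + (1 - del - expR (- del)))|).
      by rewrite ler_wpM2r// ger0_norm ?expR_ge0// -expR0 ler_expR oppr_le0.
    by rewrite mul1r normrM.
  have NE : N t w = X t w - B t w by rewrite h1// h1'//; ring.
  transitivity ((N t w * D t w + D t w -
   (N t w * D t w * g1 (B t w))) - (D t w * g2 (B t w)) +
    (integral_process (fun t w => N t w * D t w) (fun t w => g1 (B t w)) t w +
      integral_process D (fun t w => g2 (B t w)) t w)); first by ring.
  by rewrite S0 addr0 /M NE /g1 /g2; ring.
have X00 : {ae P, forall w, X 0 w = 0}.
  by apply: filterS3 XNA N0 A0 => w h h1 h2; rewrite h// h1 h2 addr0.
split.
- split; first exact: (semimartingale_indist sM MB).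
  apply: (local_martingale_indist hF lMD); apply: filterS MB => w h t t0.
  by rewrite h.
- apply: filterS2 cX cA => w cXw cAw; apply: continuous_pathM.
    by apply: continuous_pathD => //; exact: continuous_path_cst.
  by apply: (@continuous_path_comp _ (fun x => expR (- x))) => // t _; exact: cexpN.
- apply: filterS X0 => w h t t0; rewrite mulr_gt0 ?expR_gt0//.
  by apply: lt_le_trans ltr01 _; rewrite lerDl h.
- by apply: filterS2 X00 A0 => w -> ->; rewrite addr0 oppr0 expR0 mulr1.
apply: filterS3 (filterI X0 X00) (filterI XH AB) (filterI cX flB).
move=> w [h1 h2] [h3 h4] [h5 h6] t t0.
have fl : flat_off (B ^~ w) (X ^~ w).
  move=> u v u0 uv h; apply: h6 => // s suv; rewrite mulf_neq0 ?h//.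
  apply/negP => /eqP Ds; have := h s suv; rewrite h3 ?eqxx//; split => //.
  by have /andP[us _] := suv; exact: le_trans us.
have e := reflection_inf h5 h1 h2 (hB w) fl t0.
have -> : running_inf (fun t w => (1 + X t w) * expR (- A t w)) t w = expR (- B t w).
  rewrite -e /running_inf; congr inf; apply/seteqP; split=> _ [s /= st <-]; exists s => //;
    by move: st; rewrite in_itv/= => /andP[s0 _]; rewrite h4.
by rewrite h4// mulfK ?gt_eqF ?expR_gt0// addrC addKr.
Unshelve. all: by end_near. Qed.

End class.

End main.

(** * From M to Sigma(H), and uniqueness *)

Section converse.
Context {R : realType} {d : measure_display} {T : measurableType d}.
Variables (P : probability T R) (F : R -> set_system T).
Hypothesis hF : usual_filtration P F.
Implicit Types (s t : R) (M N X Y Z A B G D : process R T).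

(** exp(a) = 1 + g3 a, with g3 nondecreasing and zero at 0. *)
Let g3 (x : R) := expR x - 1.

Let int3 B : integrator F B -> integrator F (fun t w => g3 (B t w)).
Proof.
apply: (integrator_comp hF).
- by move=> x; apply: cvgB; [exact: continuous_expR|exact: cvg_cst].
- by rewrite /g3 expR0 subrr.
- by move=> x y _ xy; rewrite /g3 lerD2r ler_expR.
Qed.

Lemma continuous_path_ln (x : R -> R) : continuous_path x -> (forall t, 0 <= t -> 0 < x t) ->
  continuous_path (fun t => ln (x t)).
Proof.
by move=> cx x0; apply: continuous_path_comp => // t t0; apply: continuous_ln; exact: x0.
Qed.

Variables D X : process R T.
Hypothesis mD : martingale P F D.
Hypothesis cD : {ae P, forall w, continuous_path (D ^~ w)}.
Hypothesis sX : semimartingale P F X.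
Hypothesis cX : {ae P, forall w, continuous_path (X ^~ w)}.
Hypothesis X0 : {ae P, forall w, forall t, 0 <= t -> 0 <= X t w}.

(** This is -log of the running infimum of M, written so that it is visibly
    adapted. *)
Definition log_ratio M : process R T := fun t w => ln (1 + X t w) - ln (M t w).

Lemma log_ratio_path M : represents P F D X M ->
  {ae P, forall w, [/\ integrator_path (log_ratio M ^~ w), flat_off (log_ratio M ^~ w) (X ^~ w),
     X 0 w = 0 & forall t, 0 <= t -> (1 + X t w) * expR (- log_ratio M t w) = M t w]}.
Proof.
move=> [_ cM M0 M1 XM].
apply: filterS3 (filterI cM M0) (filterI M1 XM) (filterI cX X0).
move=> w [h1 h2] [h3 h4] [h5 h6].
have [IE nI fl] := running_inf_flat h1 h2 h6 h4.
have X1 t : 0 <= t -> 0 < 1 + X t w by move=> t0; rewrite ltr_pwDl// h6.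
pose q t := M t w / (1 + X t w).
have q0 t : 0 <= t -> 0 < q t by move=> t0; rewrite divr_gt0 ?h2 ?X1.
have AE t : 0 <= t -> log_ratio M t w = - ln (q t).
  move=> t0; rewrite /log_ratio /q lnM ?posrE ?invr_gt0 ?h2 ?X1// lnV ?posrE ?X1//.
  by rewrite opprB.
have X00 : X 0 w = 0.
  have := IE 0 (lexx 0).
  rewrite (@inf_eq _ _ (M 0 w)); last 2 first.
  - by exists 0; rewrite /= ?in_itv/= ?lexx.
  - move=> _ [s /= + <-]; rewrite in_itv/= => /andP[s0 s1].
    by have -> : s = 0 by apply/le_anti; rewrite s0 s1.
  rewrite h3 div1r => /(congr1 GRing.inv); rewrite invr1 invrK => /esym/eqP.
  by rewrite -subr_eq0 addrAC subrr add0r => /eqP.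
split=> //; last first.
  move=> t t0; rewrite AE// opprK lnK ?posrE ?q0// /q mulrC divfK// gt_eqF// X1//.
- by move=> u v u0 uv h; rewrite !AE ?(le_trans u0)// /q (fl u v).
split.
- apply: continuous_pathB; apply: continuous_path_ln => //.
  by apply: continuous_pathD => //; exact: continuous_path_cst.
- move=> u v u0 uv; have v0 := le_trans u0 uv.
  by rewrite !AE// lerN2 ler_ln ?posrE ?q0//; exact: nI.
- by rewrite AE// /q h3 X00 addr0 divr1 ln1 oppr0.
Qed.

Lemma log_ratio_adapted M : represents P F D X M -> adapted F (log_ratio M).
Proof.
move=> [[[aM _] _] _ _ _ _]; have [aX _] := sX; move=> t t0.
apply: (measurable_wrtB hF t0).
  apply: (measurable_wrt_comp hF t0 (@measurable_ln R)); apply: (measurable_wrtD hF t0); last exact: aX.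
  exact: (measurable_wrt_cst hF t0).
by apply: (measurable_wrt_comp hF t0 (@measurable_ln R)); exact: aM.
Qed.

Let cDl : {ae P, forall w, cadlag_path (D ^~ w)}.
Proof. by apply: filterS cD => w; exact: continuous_path_cadlag. Qed.

Let lD : local_martingale P F D.
Proof. exact: (martingale_local hF mD cDl). Qed.

(** N D = (M D) exp(A) - D - A D, to which integration by parts is applied twice;
    the two integrals cancel by [bracket_sum].  The process A is only known up to
    indistinguishability, hence the detour through its regularization B. *)
Lemma represents_class M N A : represents P F D X M ->
  indistinguishable P A (log_ratio M) -> indistinguishable P X (fun t w => N t w + A t w) ->
  class_Sigma_with P F D X N A.
Proof.
move=> rM AM XNA; have hp := log_ratio_path rM.
have [[sM lMD] _ _ _ _] := rM.
have MA : indistinguishable P (log_ratio M) A by apply: filterS AM => w h t t0; rewrite h.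
have aA := adapted_indist hF (log_ratio_adapted rM) MA.
have pA : {ae P, forall w, integrator_path (A ^~ w)}.
  apply: filterS2 hp AM => w [[c n z] _ _ _] h; split.
  - by apply: eq_continuous_path c => t t0; rewrite h.
  - by move=> s t s0 st; rewrite !h ?(le_trans s0)//; exact: n.
  - by rewrite h.
have cA : {ae P, forall w, continuous_path (A ^~ w)} by apply: filterS pA => w [].
have nA : {ae P, forall w, nondecreasing_path (A ^~ w)} by apply: filterS pA => w [].
have A0 : {ae P, forall w, A 0 w = 0} by apply: filterS pA => w [].
have [B iB AB] := regularize hF aA cA nA A0.
have [aB hB] := iB.
have NE : indistinguishable P (fun t w => X t w - B t w) N.
  by apply: filterS2 XNA AB => w h1 h2 t t0; rewrite h1// -h2//; ring.
have ME : {ae P, forall w, forall t, 0 <= t -> (1 + X t w) * expR (- B t w) = M t w}.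
  by apply: filterS3 hp AM AB => w [_ _ _ h] h1 h2 t t0; rewrite -h// -h1// h2.
have flB : {ae P, forall w, flat_off (B ^~ w) (X ^~ w)}.
  apply: filterS3 hp AM AB => w [_ h _ _] h1 h2 u v u0 uv huv.
  by rewrite -!h2 ?(le_trans u0)// !h1 ?(le_trans u0)//; exact: h.
split.
- by [].
- exact: XNA.
- split.
  + apply: filterS3 NE cX cA => w h1 h2 h3.
    by apply: (eq_cadlag h1); apply: continuous_path_cadlag; apply: continuous_pathB => //; have [] := hB w.
  + split; first exact: (semimartingale_indist hF (semimartingaleB hF sX (semimartingale_fv hF (integrator_fv P iB))) NE).
    have l1 := integration_by_parts hF lMD (int3 iB).
    have l2 := integration_by_parts hF lD iB.
    apply: (local_martingale_indist hF (local_martingaleB hF (local_martingaleB hF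
      (local_martingaleD hF lMD l1) lD) l2)).
    have [_ cMD _] := lMD.
    apply: filterS3 (filterI NE ME) (filterI cX cD) (filterI flB (filterI cMD cDl)).
    move=> w [h1 h1'] [h2 h2'] [h3 [h4 h4']] t t0.
    have hb1 := (int3 iB).2 w; have hb2 := hB w.
    have S0 : integral_process (fun t w => M t w * D t w) (fun t w => g3 (B t w)) t w - integral_process D B t w = 0.
      have c1 := path_integral_cvg hb1 h4 t0; have c2 := path_integral_cvg hb2 h4' t0.
      apply: (cvg_unique _ (cvgB c1 c2)) => //.
      pose e n k : R :=
        M (gridpt n t k.+1) w * D (gridpt n t k.+1) w * (g3 (B (gridpt n t k.+1) w) - g3 (B (gridpt n t k) w)) -
        D (gridpt n t k.+1) w * (B (gridpt n t k.+1) w - B (gridpt n t k) w).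
      suff : \sum_(k < n.+1 * n.+1) e n k @[n --> \oo] --> (0 : R).
        have eE n : right_sum n (fun s => M s w * D s w) (fun s => g3 (B s w)) t -
            right_sum n (D ^~ w) (B ^~ w) t = \sum_(k < n.+1 * n.+1) e n k.
          by rewrite /right_sum -sumrB.
        move=> h; apply: cvg_trans h; apply: near_eq_cvg; near=> n.
        exact/esym/eE.
      have fl : flat_off (B ^~ w) (fun s => X s w * D s w).
        move=> u v u0 uv h; apply: h3 => // s suv; have := h s suv.
        by rewrite mulf_eq0 negb_or => /andP[].
      apply: (@bracket_sum _ (D ^~ w) (X ^~ w) (B ^~ w) t e) => //.
      move=> n k p q del pE qE delE; rewrite /e -pE -qE.
      have q0 : 0 <= q by rewrite qE; exact: gridpt_ge0.
      have E : expR (B p w) = expR (B q w) * expR (- del).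
        by rewrite -expRD; congr expR; rewrite delE; ring.
      have E1 : expR (- B q w) * expR (B q w) = 1 by rewrite expRN mulVf// gt_eqF// expR_gt0.
      have -> : M q w * D q w * (g3 (B q w) - g3 (B p w)) - D q w * (B q w - B p w) =
          D q w * (X q w * (1 - expR (- del)) + (1 - del - expR (- del))).
        transitivity (D q w * ((1 + X q w) * (1 - expR (- del)) * (expR (- B q w) * expR (B q w)) - del)).
          by rewrite -h1'// /g3 E delE; ring.
        by rewrite E1; ring.
      by rewrite normrM.
    have E1 : expR (- B t w) * expR (B t w) = 1 by rewrite expRN mulVf// gt_eqF// expR_gt0.
    transitivity (M t w * D t w + (M t w * D t w * g3 (B t w)) - D t w - D t w * B t w -
       (integral_process (fun t w => M t w * D t w) (fun t w => g3 (B t w)) t w - integral_process D B t w)); first by ring.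
    rewrite S0 subr0 -h1// -h1'// /g3.
    transitivity (D t w * ((1 + X t w) * (expR (- B t w) * expR (B t w)) - 1 - B t w)); first by ring.
    by rewrite E1; ring.
  + apply: filterS3 XNA hp A0 => w h1 [_ _ h2 _] h3.
    by have := h1 0 (lexx 0); rewrite h2 h3 addr0.
- by [].
apply: filterS3 (filterI hp cX) AB flB => w [[_ _ h1 _] h2] h3 h4.
have [cB nB _] := hB w.
have [f [fE nZ]] : dcarried_by (B ^~ w) (zeros X w `|` zeros D w).
  by apply: (@flat_dcarried _ _ (X ^~ w)) => // s s0 Xs; left.
by exists f; split => // s; rewrite fE h3// le_max lexx orbT.
Unshelve. all: by end_near. Qed.

(** int D dB' - int D dB is a local martingale, as a combination of
    B' D - int D dB', B D - int D dB and (B' - B) D.  Adding int |D| dB and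
    int |D| dB' to both integrals exhibits it as a difference of two integrators. *)
Lemma represents_unique M M' : represents P F D X M -> represents P F D X M' ->
  eq_off_zeros P D M' M.
Proof.
move=> rM rM'; have hp := log_ratio_path rM; have hp' := log_ratio_path rM'.
have reg M0 : represents P F D X M0 -> exists2 B, integrator F B &
    indistinguishable P (log_ratio M0) B /\ local_martingale P F (fun t w => (X t w - B t w) * D t w).
  move=> r0; have h0 := log_ratio_path r0.
  have [|||B iB AB] := regularize hF (log_ratio_adapted r0).
  - by apply: filterS h0 => w [[]].
  - by apply: filterS h0 => w [[]].
  - by apply: filterS h0 => w [[]].
  exists B => //; split => //.
  have [] := @represents_class M0 (fun t w => X t w - log_ratio M0 t w) (log_ratio M0) r0.
  - by apply: aeW => w t _.
  - by apply: aeW => w t _; rewrite subrK.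
  move=> _ _ [_ [_ l] _] _ _; apply: (local_martingale_indist hF l).
  by apply: filterS AB => w h t t0; rewrite h.
have [B iB [AB lB]] := reg M rM; have [B' iB' [AB' lB']] := reg M' rM'.
have [_ hB] := iB; have [_ hB'] := iB'; have [aD _ _] := lD.
pose nD t w := `|D t w|.
have cnD : {ae P, forall w, cadlag_path (nD ^~ w)} by apply: filterS cDl => w; exact: cadlag_norm.
have anD : adapted F nD.
  move=> t t0; apply: (measurable_wrt_comp hF t0 (h := fun x => `|x|)); last exact: aD.
  exact: normr_measurable.
pose U t w := integral_process D B' t w - integral_process D B t w.
have lU : local_martingale P F U.
  have l1 := integration_by_parts hF lD iB; have l2 := integration_by_parts hF lD iB'.
  apply: (local_martingale_indist hF (local_martingaleB hF (local_martingaleB hF l1 l2)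
    (local_martingaleB hF lB' lB))).
  by apply: aeW => w t _; rewrite /U; ring.
have mono B1 B2 : integrator F B1 -> integrator F B2 -> exists2 G, integrator F G &
    indistinguishable P (fun t w => (integral_process nD B1 t w + integral_process D B1 t w) + integral_process nD B2 t w) G.
  move=> i1 i2; have [_ h1] := i1; have [_ h2] := i2; apply: (regularize hF).
  - move=> t t0; apply: (measurable_wrtD hF t0); last exact: (integral_process_adapted hF anD cnD i2).
    apply: (measurable_wrtD hF t0); first exact: (integral_process_adapted hF anD cnD i1).
    exact: (integral_process_adapted hF aD cDl i1).
  - apply: filterS2 cDl cnD => w c1 c2; apply: continuous_pathD; last exact: path_integral_continuous.
    by apply: continuous_pathD; exact: path_integral_continuous.
  - apply: filterS2 cDl cnD => w c1 c2 u v u0 uv.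
    have := path_integral_norm (h1 w) c1 u0 uv; rewrite ler_norml => /andP[k1 k2].
    have := path_integral_norm (h2 w) c1 u0 uv => /(le_trans (normr_ge0 _)) k3.
    by rewrite /integral_process /nD; lra.
  - by apply: filterS2 cDl cnD => w c1 c2; rewrite /integral_process !path_integral0// !addr0.
have [G1 iG1 e1] := mono B' B iB' iB; have [G2 iG2 e2] := mono B B' iB iB'.
have UG : indistinguishable P U (fun t w => G1 t w - G2 t w).
  by apply: filterS2 e1 e2 => w h1 h2 t t0; rewrite -h1// -h2// /U; ring.
have U0 := fv_local_martingale0 hF lU iG1 iG2 UG.
apply: filterS3 (filterI hp hp') (filterI AB AB') (filterI U0 (filterI cD X0)).
move=> w [[_ _ _ h1] [_ _ _ h1']] [h2 h2'] [h3 [h4 h5]] s t s0 st nz.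
have t0 := le_trans s0 st.
have inj : B t w - B s w = B' t w - B' s w.
  apply: (path_integral_inj h4 (hB w) (hB' w) _ s0 st nz) => u u0.
  by have := h3 u u0; rewrite /U /integral_process => /eqP; rewrite subr_eq0 => /eqP.
have Xs : 1 + X s w != 0 by rewrite gt_eqF// ltr_pwDl// h5.
have ratio b : ((1 + X t w) * expR (- (b t))) / ((1 + X s w) * expR (- (b s))) =
    (1 + X t w) / (1 + X s w) * expR (- (b t - b s)).
  by rewrite opprB expRD -[expR (b s)]invrK -expRN; field; rewrite Xs gt_eqF ?expR_gt0.
rewrite -!h1// -!h1'// !h2// !h2'//.
by rewrite (ratio (B ^~ w)) (ratio (B' ^~ w)) inj.
Qed.

End converse.

(** * The characterization of class Sigma(H) *)

Theorem corollary2 (R : realType) (d : measure_display) (T : measurableType d)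
    (P : probability T R) (Q : {charge set T -> \bar R})
    (F : R -> set_system T) (D X N A : process R T)
    (hF : usual_filtration P F)
    (hQP : Q `<< P)
    (hD : density_process P Q F D)
    (hDc : {ae P, forall w, continuous_path (D ^~ w)})
    (hXs : semimartingale P F X)
    (hXNA : indistinguishable P X (fun t w => N t w + A t w))
    (hXc : {ae P, forall w, continuous_path (X ^~ w)})
    (hX0 : {ae P, forall w, forall t, 0 <= t -> 0 <= X t w})
    (hXH : vanishes_on_zeros P D X) :
  (class_Sigma P F D X <-> exists M, unique_represents P F D X M)
  /\
  (class_Sigma_with P F D X N A <->
   exists M, unique_represents P F D X M /\
     indistinguishable P M (fun t w => (1 + X t w) * expR (- A t w))).
Proof.
have mD := density_martingale hF hD.
have back N' A' : class_Sigma_with P F D X N' A' ->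
    exists M, unique_represents P F D X M /\
      indistinguishable P M (fun t w => (1 + X t w) * expR (- A' t w)).
  move=> hc; have rM := class_represents hF mD hDc hXs hXc hX0 hXH hc.
  eexists; split; last by apply: aeW => w t _; reflexivity.
  split; first exact: rM.
  by move=> M' rM'; exact: (represents_unique hF mD hDc hXs hXc hX0 rM rM').
have forth M N' A' : represents P F D X M ->
    indistinguishable P X (fun t w => N' t w + A' t w) ->
    indistinguishable P A' (log_ratio X M) -> class_Sigma_with P F D X N' A'.
  by move=> rM hX hA; exact: (represents_class hF mD hDc hXs hXc hX0 rM hA hX).
split; split.
- by move=> [N' [A' /back[M [uM _]]]]; exists M.
- move=> [M [rM _]]; exists (fun t w => X t w - log_ratio X M t w), (log_ratio X M).
  by apply: (forth M) => //; apply: aeW => w t _ //; rewrite subrK.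
- exact: back.
move=> [M [[rM _] MA]]; apply: (forth M) => //.
apply: filterS2 MA hX0 => w h1 h2 t t0.
have X1 : 0 < 1 + X t w by rewrite ltr_pwDl// h2.
by rewrite /log_ratio h1// lnM ?posrE ?expR_gt0// expRK opprD addrA subrr add0r opprK.
Qed.
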